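(* Let $V$ be a set of $n$ vertices, let $s\in V$ be a source vertex, let $W\ge 1$, and let $\sigma=e_1,\ldots,e_m$ be a sequence of directed edges on $V$, each with a weight $w(e_i)\in[1,W]$. For $0\le t\le m$ let $G_t$ be the graph on $V$ with edges $e_1,\ldots,e_t$, and let $d^t(v)$ be the length (sum of edge weights) of a shortest path from $s$ to $v$ in $G_t$. For the offline incremental SSSP problem there exists an algorithm that, given $V$, $s$ and the whole sequence $\sigma$ in advance, runs in worst-case total time $O(m\log(nW)(\log^3 n)(\log\log n)/\epsilon)$ and returns $(1+\epsilon)$-approximate single-source shortest-path distances for each time $t$. That is, it produces a data structure which, on a query $(v,t)$ with $v\in V$ and $0\le t\le m$, returns a value $d$ with $d^t(v)\le d\le(1+\epsilon)\,d^t(v)$.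
   Context: $\epsilon>0$ is an approximation parameter, assumed throughout to satisfy $\epsilon=O(1)$. Logarithms are base 2. *)

(* Defs.v *)
From HB Require Import structures.
From mathcomp Require Import all_boot all_order all_algebra.
From mathcomp Require Import all_classical all_reals all_analysis.

Set Implicit Arguments.
Unset Strict Implicit.
Unset Printing Implicit Defensive.
Import Order.TTheory GRing.Theory Num.Theory.
Local Open Scope classical_set_scope.
Local Open Scope ring_scope.

Definition log2 {R : realType} (x : R) : R := ln x / ln 2.

(** * Incremental directed graphs *)

(** The vertex set is ['I_n]; an edge [(u, v, x)] goes from [u] to [v] and has
    weight [x].  An edge sequence may contain parallel edges and loops. *)
Definition edge (R : realType) (n : nat) : Type := ('I_n * 'I_n * R)%type.

Section Distances.
Context {R : realType} {n : nat}.
Implicit Types (e : edge R n) (p sigma : seq (edge R n)) (s v x y : 'I_n).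

Definition src e : 'I_n := e.1.1.
Definition dst e : 'I_n := e.1.2.
Definition weight e : R := e.2.

Fixpoint is_path x p y : bool :=
  if p is e :: p' then (src e == x) && is_path (dst e) p' y else x == y.

(** [sigma] lists [e_1, ..., e_m], so the edges of [G_t] are [take t sigma]. *)
Definition paths sigma (t : nat) s v : set (seq (edge R n)) :=
  [set p | {subset p <= take t sigma} /\ is_path s p v].

(** The infimum is [+oo] when [v] is unreachable; otherwise it is attained when
    the weights are at least 1. *)
Definition dist sigma s (t : nat) v : \bar R :=
  ereal_inf [set (\sum_(e <- p) weight e)%:E | p in paths sigma t s v].

End Distances.

(** * The real RAM

    A word RAM with [w]-bit words, extended with cells that hold exact real
    numbers (Erickson, van der Hoog, Miltzow, "Smoothing the gap between NP and
    ER").  Words can be cast to reals, but nothing other than a comparison goes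
    from reals to words: there is no rounding.

    Programs are syntax: a program is fixed before the input and the word size
    are, and refers by name to finitely many scalar variables and finitely many
    arrays of each of the two sorts.  Only array indices are computed. *)

Inductive iop := IAdd | ISub | IMul | IDiv.
Inductive rop := RAdd | RSub | RMul | RDiv.

Inductive iexp :=
| IConst of nat
| IVar of nat
| IGet of nat & iexp
| IBin of iop & iexp & iexp.

Inductive rexp :=
| RVar of nat
| RGet of nat & iexp
| RCast of iexp
| RBin of rop & rexp & rexp.

Inductive bexp :=
| BLei of iexp & iexp
| BLer of rexp & rexp
| BNot of bexp
| BAnd of bexp & bexp.

Inductive cmd :=
| Skip
| ISet of nat & iexp
| RSet of nat & rexp
| IPut of nat & iexp & iexp
| RPut of nat & iexp & rexp
| Seq of cmd & cmd
| If of bexp & cmd & cmd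
| While of bexp & cmd.

(** [iarr st a i] is the word at index [i] of the word array named [a]. *)
Record state (R : realType) := State {
  ivar : nat -> nat;
  rvar : nat -> R;
  iarr : nat -> nat -> nat;
  rarr : nat -> nat -> R }.

Definition upd (T : Type) (f : nat -> T) (x : nat) (v : T) : nat -> T :=
  fun y => if y == x then v else f y.

Section Semantics.
Context {R : realType} (w : nat).
Implicit Types (st : state R).

(** Word arithmetic is modulo [2 ^ w]; division by 0 yields 0 in both sorts. *)
Definition eval_iop (o : iop) (a b : nat) : nat :=
  match o with
  | IAdd => (a + b) %% 2 ^ w
  | ISub => (a + (2 ^ w - b)) %% 2 ^ w
  | IMul => (a * b) %% 2 ^ w
  | IDiv => a %/ b
  end%N.

Definition eval_rop (o : rop) (a b : R) : R :=
  match o with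
  | RAdd => a + b
  | RSub => a - b
  | RMul => a * b
  | RDiv => a / b
  end.

Fixpoint ieval st (e : iexp) : nat :=
  match e with
  | IConst c => (c %% 2 ^ w)%N
  | IVar x => ivar st x
  | IGet a i => iarr st a (ieval st i)
  | IBin o e1 e2 => eval_iop o (ieval st e1) (ieval st e2)
  end.

Fixpoint reval st (e : rexp) : R :=
  match e with
  | RVar x => rvar st x
  | RGet a i => rarr st a (ieval st i)
  | RCast i => (ieval st i)%:R
  | RBin o e1 e2 => eval_rop o (reval st e1) (reval st e2)
  end.

Fixpoint beval st (b : bexp) : bool :=
  match b with
  | BLei e1 e2 => (ieval st e1 <= ieval st e2)%N
  | BLer e1 e2 => reval st e1 <= reval st e2
  | BNot b1 => ~~ beval st b1
  | BAnd b1 b2 => beval st b1 && beval st b2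
  end.

(** Every node of the syntax tree costs one unit each time it is evaluated. *)
Fixpoint icost (e : iexp) : nat :=
  match e with
  | IConst _ | IVar _ => 1
  | IGet _ i => (icost i).+1
  | IBin _ e1 e2 => (icost e1 + icost e2).+1
  end%N.

Fixpoint rcost (e : rexp) : nat :=
  match e with
  | RVar _ => 1
  | RGet _ i | RCast i => (icost i).+1
  | RBin _ e1 e2 => (rcost e1 + rcost e2).+1
  end%N.

Fixpoint bcost (b : bexp) : nat :=
  match b with
  | BLei e1 e2 => (icost e1 + icost e2).+1
  | BLer e1 e2 => (rcost e1 + rcost e2).+1
  | BNot b1 => (bcost b1).+1
  | BAnd b1 b2 => (bcost b1 + bcost b2).+1
  end%N.

Definition set_ivar st x v := State (upd (ivar st) x v) (rvar st) (iarr st) (rarr st).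
Definition set_rvar st x v := State (ivar st) (upd (rvar st) x v) (iarr st) (rarr st).
Definition set_iarr st a i v :=
  State (ivar st) (rvar st) (upd (iarr st) a (upd (iarr st a) i v)) (rarr st).
Definition set_rarr st a i v :=
  State (ivar st) (rvar st) (iarr st) (upd (rarr st) a (upd (rarr st a) i v)).

(** [exec c st k st']: started in [st], the command [c] halts in [st'] after
    exactly [k] units of time.  Execution is deterministic. *)
Inductive exec : cmd -> state R -> nat -> state R -> Prop :=
| ExSkip st : exec Skip st 1 st
| ExISet st x e :
    exec (ISet x e) st (icost e).+1 (set_ivar st x (ieval st e))
| ExRSet st x e :
    exec (RSet x e) st (rcost e).+1 (set_rvar st x (reval st e))
| ExIPut st a i e :
    exec (IPut a i e) st (icost i + icost e).+1
      (set_iarr st a (ieval st i) (ieval st e))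
| ExRPut st a i e :
    exec (RPut a i e) st (icost i + rcost e).+1
      (set_rarr st a (ieval st i) (reval st e))
| ExSeq st st1 st2 c1 c2 k1 k2 :
    exec c1 st k1 st1 -> exec c2 st1 k2 st2 ->
    exec (Seq c1 c2) st (k1 + k2).+1 st2
| ExIfTrue st st1 b c1 c2 k :
    beval st b -> exec c1 st k st1 ->
    exec (If b c1 c2) st (bcost b + k).+1 st1
| ExIfFalse st st1 b c1 c2 k :
    ~~ beval st b -> exec c2 st k st1 ->
    exec (If b c1 c2) st (bcost b + k).+1 st1
| ExWhileFalse st b c :
    ~~ beval st b -> exec (While b c) st (bcost b).+1 st
| ExWhileTrue st st1 st2 b c k1 k2 :
    beval st b -> exec c st k1 st1 -> exec (While b c) st1 k2 st2 ->
    exec (While b c) st (bcost b + k1 + k2).+1 st2.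

End Semantics.

(** * Input, queries and answers *)

Section InputOutput.
Context {R : realType} {n : nat}.

(** Word variables 0, 1, 2 hold [n], [m] and the source, real variable 0 holds
    [eps].  Index [i] of word arrays 0 and 1 and of real array 0 holds the tail,
    the head and the weight of [e_(i+1)].  All other cells are 0. *)
Definition input_state (s : 'I_n) (sigma : seq (edge R n)) (eps : R) : state R :=
  State (nth 0%N [:: n; size sigma; s : nat])
        (nth 0 [:: eps])
        (nth (fun=> 0%N)
           [:: nth 0%N [seq (src e : nat) | e <- sigma];
               nth 0%N [seq (dst e : nat) | e <- sigma]])
        (nth (fun=> 0) [:: nth 0 [seq weight e | e <- sigma]]).

(** The data structure left by a computation is the contents of its arrays.  A
    query starts from it with the vertex and the time in word variables 0 and 1
    and all other variables 0. *)
Definition query_state (st : state R) (v : 'I_n) (t : nat) : state R :=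
  State (nth 0%N [:: v : nat; t]) (fun=> 0) (iarr st) (rarr st).

(** The answer is read off real variable 0, unless word variable 0 is 0, which
    stands for an infinite distance. *)
Definition answer (st : state R) : \bar R :=
  if ivar st 0 == 0%N then +oo%E else (rvar st 0)%:E.

End InputOutput.

(* Main.v *)
(** The times [0, ..., m] are cut into chunks of [K = 2 ^ h] consecutive times,
    where [K] is about [min m (n * n)].  Only the lightest of parallel edges that
    precede a chunk matters, so at most [2 * K] edges concern a chunk.

    Inside a chunk the times are bisected.  Let [D_l] and [D_r] be the distances
    computed for the ends of an interval.  A vertex with [D_l v <= od * D_r v] is
    dead: its distance is taken to be [D_r v] at the midpoint.  The other vertices
    are alive and get their midpoint distances from Dijkstra's algorithm, which
    takes the distances of the dead vertices as given.  As the rounding is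
    downwards, the distances stay a feasible potential ([D v <= D u + w] for every
    edge), hence lower bounds; and each of the [h] levels costs one factor [od] in
    the other direction, so [od ^+ h * D v] is an upper bound.  With
    [od = 1 + min eps 1 / (2 * h)] this yields [D <= dist <= (1 + eps) * D].

    The distance of an alive vertex drops by a factor [od] over the interval.  So a
    vertex is alive in at most about [ln INF / ln od] intervals of a level, which
    bounds the work of all calls of Dijkstra's algorithm on that level.

    A distance is stored only at the times where the vertex was alive; elsewhere it
    equals the one at the next stored time, which is found by descending the
    bisection tree. *)

(* The model compares reals but cannot round them, so distances cannot be bucketed by powers of 1 +
   eps. The ratio test between the two ends of an interval takes the place of bucketing; logarithms
   occur only in the analysis. Exactness of Dijkstra's algorithm is never proved for the alive
   vertices. Two properties suffice: every edge present satisfies the triangle inequality, which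
   holds once the queue is empty, and every value written is infinite or witnessed by a path, which
   relaxations preserve. The order of extraction matters for the time alone. Chunks keep the depth h
   at O(log n) even when m is far above n^2. Their ends are computed without rounding, so no error
   passes from one chunk to the next. Time: on one level the degrees of the alive vertices sum to
   O(K) times ln INF / ln od, which is O(K h log(nW) / eps), as ln od is of order eps / h. Each
   incidence costs O(log n) for lookup and queue, and there are h levels. The factor log log n
   enters through its lower bound 1 / 2. *)
Require Import Defs.
From HB Require Import structures.
From mathcomp Require Import all_boot all_order all_algebra.
From mathcomp Require Import all_classical all_reals all_analysis.
From mathcomp Require Import zify lra.

Set Implicit Arguments.
Unset Strict Implicit.
Unset Printing Implicit Defensive.
Import Order.TTheory GRing.Theory Num.Theory.
Local Open Scope ring_scope.

(** * Running programs without overflow *)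

Section NoOverflow.
Context {R : realType} (w : nat).
Implicit Types (st : state R) (c : cmd).

(** [inval] evaluates a word expression in [nat]; it agrees with [ieval] when no
    operation overflows, which is what [iexp_ok] says.  The same holds for
    [rnval], [bnval] and [final_state]. *)
Fixpoint inval st (e : iexp) : nat :=
  match e with
  | IConst c => c
  | IVar x => ivar st x
  | IGet a i => iarr st a (inval st i)
  | IBin IAdd a b => inval st a + inval st b
  | IBin ISub a b => inval st a - inval st b
  | IBin IMul a b => inval st a * inval st b
  | IBin IDiv a b => inval st a %/ inval st b
  end%N.

Fixpoint iexp_ok st (e : iexp) : Prop :=
  match e with
  | IConst c => (c < 2 ^ w)%N
  | IVar _ => True
  | IGet _ i => iexp_ok st i
  | IBin IAdd a b => [/\ iexp_ok st a, iexp_ok st b & (inval st a + inval st b < 2 ^ w)%N]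
  | IBin ISub a b => [/\ iexp_ok st a, iexp_ok st b & (inval st b <= inval st a < 2 ^ w)%N]
  | IBin IMul a b => [/\ iexp_ok st a, iexp_ok st b & (inval st a * inval st b < 2 ^ w)%N]
  | IBin IDiv a b => iexp_ok st a /\ iexp_ok st b
  end.

Lemma invalP st e : iexp_ok st e -> ieval w st e = inval st e.
Proof.
elim: e => //= [c|a i IH|[] a IHa b IHb] /=.
- exact: modn_small.
- by move=> /IH ->.
- by case=> /IHa -> /IHb -> lt; rewrite modn_small.
- case=> /IHa -> /IHb -> /andP[ba aw].
  rewrite addnBA; last by apply: ltnW; apply: leq_ltn_trans aw.
  by rewrite -addnBAC // modnDr modn_small // (leq_ltn_trans (leq_subr _ _)).
- by case=> /IHa -> /IHb -> lt; rewrite modn_small.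
- by case=> /IHa -> /IHb ->.
Qed.

Fixpoint rnval st (e : rexp) : R :=
  match e with
  | RVar x => rvar st x
  | RGet a i => rarr st a (inval st i)
  | RCast i => (inval st i)%:R
  | RBin o a b => eval_rop o (rnval st a) (rnval st b)
  end.

Fixpoint rexp_ok st (e : rexp) : Prop :=
  match e with
  | RVar _ => True
  | RGet _ i | RCast i => iexp_ok st i
  | RBin _ a b => rexp_ok st a /\ rexp_ok st b
  end.

Lemma rnvalP st e : rexp_ok st e -> reval w st e = rnval st e.
Proof.
by elim: e => //= [a i|i|o a IHa b IHb]; [move=> /invalP ->|move=> /invalP ->|case=> /IHa -> /IHb ->].
Qed.

Fixpoint bnval st (b : bexp) : bool :=
  match b with
  | BLei e1 e2 => (inval st e1 <= inval st e2)%N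
  | BLer e1 e2 => rnval st e1 <= rnval st e2
  | BNot b1 => ~~ bnval st b1
  | BAnd b1 b2 => bnval st b1 && bnval st b2
  end.

(** The right conjunct is evaluated, without effect, even when the left one is
    false; its arithmetic may overflow then. *)
Fixpoint bexp_ok st (b : bexp) : Prop :=
  match b with
  | BLei e1 e2 => iexp_ok st e1 /\ iexp_ok st e2
  | BLer e1 e2 => rexp_ok st e1 /\ rexp_ok st e2
  | BNot b1 => bexp_ok st b1
  | BAnd b1 b2 => bexp_ok st b1 /\ (bnval st b1 -> bexp_ok st b2)
  end.

Lemma bnvalP st b : bexp_ok st b -> beval w st b = bnval st b.
Proof.
elim: b => //= [e1 e2|e1 e2|b IH|b1 IH1 b2 IH2].
- by case=> /invalP -> /invalP ->.
- by case=> /rnvalP -> /rnvalP ->.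
- by move=> /IH ->.
- by case=> /IH1 -> H; case: (bnval st b1) H => //= /(_ isT) /IH2 ->.
Qed.

(** Straight-line code is handled by evaluating [final_state] instead of applying rules one by one;
    the [While] cases of the functions below are placeholders that [loop_free] rules out. *)
Fixpoint loop_free c : bool :=
  match c with
  | Seq a b | If _ a b => loop_free a && loop_free b
  | While _ _ => false
  | _ => true
  end.

Fixpoint final_state c st : state R :=
  match c with
  | Skip | While _ _ => st
  | ISet x e => set_ivar st x (inval st e)
  | RSet x e => set_rvar st x (rnval st e)
  | IPut a i e => set_iarr st a (inval st i) (inval st e)
  | RPut a i e => set_rarr st a (inval st i) (rnval st e)
  | Seq a b => final_state b (final_state a st)
  | If b c1 c2 => if bnval st b then final_state c1 st else final_state c2 st
  end.

Fixpoint cmd_ok c st : Prop :=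
  match c with
  | Skip | While _ _ => True
  | ISet x e => iexp_ok st e
  | RSet x e => rexp_ok st e
  | IPut a i e => iexp_ok st i /\ iexp_ok st e
  | RPut a i e => iexp_ok st i /\ rexp_ok st e
  | Seq a b => cmd_ok a st /\ cmd_ok b (final_state a st)
  | If b c1 c2 => bexp_ok st b /\ (if bnval st b then cmd_ok c1 st else cmd_ok c2 st)
  end.

Fixpoint csize c : nat :=
  match c with
  | Skip | While _ _ => 1
  | ISet x e => (icost e).+1
  | RSet x e => (rcost e).+1
  | IPut a i e => (icost i + icost e).+1
  | RPut a i e => (icost i + rcost e).+1
  | Seq a b => (csize a + csize b).+1
  | If b c1 c2 => (bcost b + maxn (csize c1) (csize c2)).+1
  end.

(** A Hoare triple for total correctness in which [k] is only an upper bound on the time, so that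
    branches of different cost can share one budget. *)
Definition run c st (k : nat) (Q : state R -> Prop) : Prop :=
  exists k' st', [/\ exec w c st k' st', (k' <= k)%N & Q st'].

Lemma exec_final_state c st : loop_free c -> cmd_ok c st ->
  exists2 k, exec w c st k (final_state c st) & (k <= csize c)%N.
Proof.
elim: c st => //=.
- by move=> st _ _; exists 1%N => //; constructor.
- by move=> x e st _ ok; exists (icost e).+1 => //; rewrite -(invalP ok); constructor.
- by move=> x e st _ ok; exists (rcost e).+1 => //; rewrite -(rnvalP ok); constructor.
- move=> a i e st _ [ok1 ok2]; exists (icost i + icost e).+1%N => //.
  by rewrite -(invalP ok1) -(invalP ok2); constructor.
- move=> a i e st _ [ok1 ok2]; exists (icost i + rcost e).+1%N => //.
  by rewrite -(invalP ok1) -(rnvalP ok2); constructor.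
- move=> a IHa b IHb st /andP[la lb] [oa ob].
  have [ka ea ha] := IHa _ la oa; have [kb eb hb] := IHb _ lb ob.
  by exists (ka + kb).+1; [apply: ExSeq ea eb|lia].
- move=> b c1 IH1 c2 IH2 st /andP[l1 l2] [ob].
  have := bnvalP ob; case: (bnval st b) => be oc.
    have [k e hk] := IH1 _ l1 oc; exists (bcost b + k).+1; last by lia.
    by apply: ExIfTrue e; rewrite be.
  have [k e hk] := IH2 _ l2 oc; exists (bcost b + k).+1; last by lia.
  by apply: ExIfFalse e; rewrite be.
Qed.

Lemma run_weaken c st k k' (Q Q' : state R -> Prop) :
  run c st k Q -> (k <= k')%N -> (forall st', Q st' -> Q' st') -> run c st k' Q'.
Proof.
move=> [k0 [st' [e le q]]] kk H; exists k0, st'; split => //; last exact: H.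
exact: leq_trans kk.
Qed.

Lemma run_loop_free c st k (Q : state R -> Prop) :
  loop_free c -> cmd_ok c st -> (csize c <= k)%N -> Q (final_state c st) -> run c st k Q.
Proof.
move=> lf ok le q; have [k' e h] := exec_final_state lf ok.
by exists k', (final_state c st); split => //; lia.
Qed.

(** The postcondition of the first command is itself a [run], as in a weakest-precondition calculus.
    The inequality is strict because [Seq] costs one unit of its own. *)
Lemma run_seq a b st k1 k2 k Q :
  run a st k1 (fun st1 => run b st1 k2 Q) -> (k1 + k2 < k)%N -> run (Seq a b) st k Q.
Proof.
move=> [ka [st1 [ea la [kb [st2 [eb lb q]]]]]] lt.
by exists (ka + kb).+1, st2; split => //; [apply: ExSeq ea eb|lia].
Qed.

Lemma run_if b c1 c2 st k k' Q :
  bexp_ok st b ->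
  (bnval st b -> run c1 st k' Q) -> (~~ bnval st b -> run c2 st k' Q) ->
  (bcost b + k' < k)%N -> run (If b c1 c2) st k Q.
Proof.
move=> ob; have := bnvalP ob; case: (bnval st b) => be H1 H2 le.
  have [k0 [st' [e l q]]] := H1 isT; exists (bcost b + k0).+1, st'; split => //; last by lia.
  by apply: ExIfTrue e; rewrite be.
have [k0 [st' [e l q]]] := H2 isT; exists (bcost b + k0).+1, st'; split => //; last by lia.
by apply: ExIfFalse e; rewrite be.
Qed.

(** The time budget [k] of the invariant also bounds the number of iterations. *)
Lemma run_while b c (I : nat -> state R -> Prop) (Q : state R -> Prop) :
  (forall k st, I k st -> bexp_ok st b) ->
  (forall k st, I k st -> bnval st b ->
     exists k1 k2, run c st k1 (I k2) /\ (bcost b + k1 + k2 < k)%N) ->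
  (forall k st, I k st -> ~~ bnval st b -> (bcost b < k)%N /\ Q st) ->
  forall k st, I k st -> run (While b c) st k Q.
Proof.
move=> Hok Hstep Hend k; have [n] := ubnP k; elim: n k => // n IH k ltkn st Ik.
have be := bnvalP (Hok _ _ Ik); case B : (bnval st b) be => be.
  have [k1 [k2 [[k' [st1 [e le Ik2]]] lt]]] := Hstep _ _ Ik B.
  have [//|k'' [st2 [e2 le2 q]]] := IH k2 _ st1 Ik2; first by lia.
  exists (bcost b + k' + k'').+1, st2; split => //; last by lia.
  by apply: ExWhileTrue e e2; rewrite be.
have [lt q] := Hend _ _ Ik (negbT B).
by exists (bcost b).+1, st; split => //; apply: ExWhileFalse; rewrite be.
Qed.

Fixpoint written_ivars c : seq nat :=
  match c with
  | ISet x _ => [:: x]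
  | Seq a b | If _ a b => written_ivars a ++ written_ivars b
  | While _ a => written_ivars a
  | _ => [::]
  end.
Fixpoint written_rvars c : seq nat :=
  match c with
  | RSet x _ => [:: x]
  | Seq a b | If _ a b => written_rvars a ++ written_rvars b
  | While _ a => written_rvars a
  | _ => [::]
  end.
Fixpoint written_iarrs c : seq nat :=
  match c with
  | IPut x _ _ => [:: x]
  | Seq a b | If _ a b => written_iarrs a ++ written_iarrs b
  | While _ a => written_iarrs a
  | _ => [::]
  end.
Fixpoint written_rarrs c : seq nat :=
  match c with
  | RPut x _ _ => [:: x]
  | Seq a b | If _ a b => written_rarrs a ++ written_rarrs b
  | While _ a => written_rarrs a
  | _ => [::]
  end.

(** Programs name their variables and arrays statically, so what a command cannot change is read off
    its syntax. Arrays are tracked as a whole; single cells are left to the invariants. *)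
Definition frame c st st' : Prop :=
  [/\ forall x, x \notin written_ivars c -> ivar st' x = ivar st x,
      forall x, x \notin written_rvars c -> rvar st' x = rvar st x,
      forall a, a \notin written_iarrs c -> iarr st' a = iarr st a &
      forall a, a \notin written_rarrs c -> rarr st' a = rarr st a].

Lemma frame_trans c st1 st2 st3 : frame c st1 st2 -> frame c st2 st3 -> frame c st1 st3.
Proof.
case=> a1 a2 a3 a4 [b1 b2 b3 b4]; split=> x hx.
- by rewrite b1 // a1.
- by rewrite b2 // a2.
- by rewrite b3 // a3.
- by rewrite b4 // a4.
Qed.

Lemma frame_refl c st : frame c st st. Proof. by []. Qed.

Lemma upd_other (T : Type) (f : nat -> T) x y v : y \notin [:: x] -> upd f x v y = f y.
Proof. by rewrite inE /upd => /negbTE ->. Qed.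

Lemma exec_frame c st k st' : exec w c st k st' -> frame c st st'.
Proof.
elim=> {c st k st'}.
- by move=> st; exact: frame_refl.
- by move=> st x e; split=> //= y; exact: upd_other.
- by move=> st x e; split=> //= y; exact: upd_other.
- by move=> st x i e; split=> //= y; exact: upd_other.
- by move=> st x i e; split=> //= y; exact: upd_other.
- move=> st st1 st2 c1 c2 _ _ _ [a1 a2 a3 a4] _ [b1 b2 b3 b4].
  split=> x /=; rewrite mem_cat negb_or => /andP[h1 h2].
  + by rewrite b1 // a1.
  + by rewrite b2 // a2.
  + by rewrite b3 // a3.
  + by rewrite b4 // a4.
- move=> st st1 b c1 c2 _ _ _ [a1 a2 a3 a4].
  by split=> x /=; rewrite mem_cat negb_or => /andP[h1 h2]; auto.
- move=> st st1 b c1 c2 _ _ _ [a1 a2 a3 a4].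
  by split=> x /=; rewrite mem_cat negb_or => /andP[h1 h2]; auto.
- by move=> *; exact: frame_refl.
- move=> st st1 st2 b c k1 k2 _ _ f1 _ f2; exact: frame_trans f1 f2.
Qed.

Lemma run_frame c st k Q :
  run c st k Q -> run c st k (fun st' => Q st' /\ frame c st st').
Proof.
by move=> [k' [st' [e le q]]]; exists k', st'; split=> //; split=> //; apply: exec_frame e.
Qed.

Lemma run_seq_frame a b st k1 k2 k Qa Q :
  run a st k1 Qa ->
  (forall st1, Qa st1 -> frame a st st1 -> run b st1 k2 Q) ->
  (k1 + k2 < k)%N -> run (Seq a b) st k Q.
Proof.
move=> /run_frame ra H; apply: run_seq; apply: run_weaken ra _ _; first exact: leqnn.
by move=> st' [q f]; exact: H.
Qed.

Lemma run_loop_free_seq a b st k1 k Q :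
  loop_free a -> cmd_ok a st -> run b (final_state a st) k1 Q ->
  (csize a + k1 < k)%N -> run (Seq a b) st k Q.
Proof. by move=> lf ok r; apply: run_seq; apply: run_loop_free => //; exact: leqnn. Qed.

Lemma frame_final_state c st : frame c st (final_state c st).
Proof.
elim: c st => //=.
- by move=> x e st; split=> //= y; exact: upd_other.
- by move=> x e st; split=> //= y; exact: upd_other.
- by move=> x i e st; split=> //= y; exact: upd_other.
- by move=> x i e st; split=> //= y; exact: upd_other.
- move=> a IHa b IHb st; have [a1 a2 a3 a4] := IHa st.
  have [b1 b2 b3 b4] := IHb (final_state a st).
  split=> x /=; rewrite mem_cat negb_or => /andP[h1 h2].
  + by rewrite b1 // a1.
  + by rewrite b2 // a2.
  + by rewrite b3 // a3.
  + by rewrite b4 // a4.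
- move=> b c1 IH1 c2 IH2 st; case: (bnval st b).
    have [a1 a2 a3 a4] := IH1 st.
    by split=> x /=; rewrite mem_cat negb_or => /andP[h1 h2]; auto.
  have [a1 a2 a3 a4] := IH2 st.
  by split=> x /=; rewrite mem_cat negb_or => /andP[h1 h2]; auto.
Qed.

Lemma frame_iv c st st' x : frame c st st' -> x \notin written_ivars c -> ivar st' x = ivar st x.
Proof. by case=> H _ _ _; exact: H. Qed.
Lemma frame_rv c st st' x : frame c st st' -> x \notin written_rvars c -> rvar st' x = rvar st x.
Proof. by case=> _ H _ _; exact: H. Qed.
Lemma frame_ia c st st' x : frame c st st' -> x \notin written_iarrs c -> iarr st' x = iarr st x.
Proof. by case=> _ _ H _; exact: H. Qed.
Lemma frame_ra c st st' x : frame c st st' -> x \notin written_rarrs c -> rarr st' x = rarr st x.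
Proof. by case=> _ _ _ H; exact: H. Qed.

(** With the frame at hand in every iteration, an invariant only has to speak of what the body
    changes. *)
Lemma run_while_frame b c (I : nat -> state R -> Prop) (Q : state R -> Prop) st0 :
  (forall k st, frame c st0 st -> I k st -> bexp_ok st b) ->
  (forall k st, frame c st0 st -> I k st -> bnval st b ->
     exists k1 k2, run c st k1 (I k2) /\ (bcost b + k1 + k2 < k)%N) ->
  (forall k st, frame c st0 st -> I k st -> ~~ bnval st b -> (bcost b < k)%N /\ Q st) ->
  forall k, I k st0 -> run (While b c) st0 k Q.
Proof.
move=> Hok Hstep Hend k Ik.
apply: (@run_while _ _ (fun k st => frame c st0 st /\ I k st)) => //.
- by move=> k' st [f i]; exact: Hok f i.
- move=> k' st [f i] be; have [k1 [k2 [r le]]] := Hstep _ _ f i be.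
  exists k1, k2; split=> //; apply: run_weaken (run_frame r) _ _ => // st' [i' f'].
  by split=> //; apply: frame_trans f f'.
- by move=> k' st [f i]; exact: Hend.
Qed.

End NoOverflow.

(** * The program *)

Arguments upd T f x v y /.

Declare Scope prog_scope.
Delimit Scope prog_scope with prog.
Notation "e1 + e2" := (IBin IAdd e1 e2) : prog_scope.
Notation "e1 - e2" := (IBin ISub e1 e2) : prog_scope.
Notation "e1 * e2" := (IBin IMul e1 e2) : prog_scope.
Notation "e1 / e2" := (IBin IDiv e1 e2) : prog_scope.
Notation "e1 <=i e2" := (BLei e1 e2) (at level 70) : prog_scope.
Notation "e1 <=r e2" := (BLer e1 e2) (at level 70) : prog_scope.
Notation "e1 +^ e2" := (RBin RAdd e1 e2) (at level 50, left associativity) : prog_scope.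
Notation "e1 -^ e2" := (RBin RSub e1 e2) (at level 50, left associativity) : prog_scope.
Notation "e1 *^ e2" := (RBin RMul e1 e2) (at level 40, left associativity) : prog_scope.
Notation "e1 /^ e2" := (RBin RDiv e1 e2) (at level 40, left associativity) : prog_scope.
Notation "c1 ;; c2" := (Seq c1 c2) (at level 90, right associativity) : prog_scope.
Notation "# c" := (IConst c) (at level 2, format "# c") : prog_scope.
Notation "$ x" := (IVar x) (at level 2, format "$ x") : prog_scope.
Notation "$$ x" := (RVar x) (at level 2, format "$$ x") : prog_scope.
Notation "x ::= e" := (ISet x e) (at level 80) : prog_scope.
Notation "x :r= e" := (RSet x e) (at level 80) : prog_scope.
Bind Scope prog_scope with iexp rexp bexp cmd.

Notation vm := 1%N (only parsing).
Notation vs := 2%N (only parsing).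
Notation vn := 3%N (only parsing).
Notation vK := 4%N (only parsing).
Notation vT := 5%N (only parsing).
Notation vc := 6%N (only parsing).
Notation vB := 7%N (only parsing).
Notation vlim := 8%N (only parsing).
Notation vt := 9%N (only parsing).
Notation vl := 10%N (only parsing).
Notation vu := 11%N (only parsing).
Notation vr := 12%N (only parsing).
Notation vh := 13%N (only parsing).
Notation vi := 14%N (only parsing).
Notation vx := 15%N (only parsing).
Notation vp := 16%N (only parsing).
Notation vj := 17%N (only parsing).
Notation va := 18%N (only parsing).
Notation vv := 19%N (only parsing).
Notation vsz := 20%N (only parsing).
Notation vq := 21%N (only parsing).
Notation vrt := 22%N (only parsing).
Notation vpm := 23%N (only parsing).
Notation vna := 24%N (only parsing).
Notation vcnt := 25%N (only parsing).
Notation vNE := 26%N (only parsing).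
Notation vhh := 27%N (only parsing).
Notation vk := 28%N (only parsing).

(** Two-dimensional arrays are stored by rows of length [n]; the rows of [aAL],
    [aS] and [rP] are times.  [aAL], [aCN]: the list of the alive vertices at a time
    and its length.  [aS]: whether a value is stored in [rP].  [aEU], [aEV], [rEW]:
    the edges that concern the current chunk.  [aHD], [aNX]: their incidence lists,
    where the entries [2 * j + 1] and [2 * j + 2] stand for the two ends of edge [j]
    and 0 ends a list.  [aM]: one plus the position of the lightest edge between two
    vertices.  [aHF]: whether a vertex is listed among the heads.  [aPar], [rPar]:
    the parameters of the query. *)
Notation aTail := 0%N (only parsing).
Notation aHead := 1%N (only parsing).
Notation aPar := 2%N (only parsing).
Notation aEU := 3%N (only parsing).
Notation aEV := 4%N (only parsing).
Notation aHD := 5%N (only parsing).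
Notation aNX := 6%N (only parsing).
Notation aHF := 7%N (only parsing).
Notation aAL := 8%N (only parsing).
Notation aCN := 9%N (only parsing).
Notation aS := 10%N (only parsing).
Notation aM := 11%N (only parsing).

Notation xeps := 0%N (only parsing).
Notation xW := 1%N (only parsing).
Notation xinf := 2%N (only parsing).
Notation xdel := 3%N (only parsing).
Notation xkey := 4%N (only parsing).

(** [rP] stores [INF - D] in place of a distance [D], so that 0, the initial
    content, stands for an infinite distance.  [rTR] is a tournament tree for the
    maximum, with the leaf of vertex [v] at [n + v] and 0 for an absent vertex. *)
Notation rWt := 0%N (only parsing).
Notation rPar := 1%N (only parsing).
Notation rEW := 2%N (only parsing).
Notation rP := 3%N (only parsing).
Notation rTR := 4%N (only parsing).

(** [vr] is the right end of the current interval and [vh] half its length. When the midpoint is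
    late enough but not stored, nothing inside the interval is, by the property [closedS] below, and
    the remaining rounds leave [vr] unchanged. *)
Definition lookb : cmd :=
  (If (BAnd ($vt + $vh <=i $vr)
            (#1 <=i IGet aS (($vr - $vh) * $vn + $vu)))
      (vr ::= $vr - $vh) Skip ;;
   vh ::= $vh / #2)%prog.

Definition lookup : cmd :=
  (vr ::= $vT ;; vh ::= $vK / #2 ;; While (#1 <=i $vh) lookb)%prog.

Definition treesetb : cmd :=
  (vi ::= $vi / #2 ;;
   If (RGet rTR (#2 * $vi + #1) <=r RGet rTR (#2 * $vi))
      (RPut rTR $vi (RGet rTR (#2 * $vi)))
      (RPut rTR $vi (RGet rTR (#2 * $vi + #1))))%prog.

Definition treeset : cmd :=
  (vi ::= $vn + $vv ;; RPut rTR $vi ($$xkey) ;;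
   While (#2 <=i $vi) treesetb)%prog.

Definition descendb : cmd :=
  (If (RGet rTR (#2 * $vi + #1) <=r RGet rTR (#2 * $vi))
      (vi ::= #2 * $vi) (vi ::= #2 * $vi + #1))%prog.

Definition descend : cmd :=
  (vi ::= #1 ;; While (BNot ($vn <=i $vi)) descendb)%prog.

(** A dead tail has its value only at a later time, hence the [lookup]. Only alive heads are
    written, and [vlim] hides the edges inserted after time [vt]. *)
Definition relax : cmd :=
  (vu ::= IGet aEU $vj ;; vv ::= IGet aEV $vj ;;
   If (BNot ($vlim <=i $vj))
    (If (#1 <=i IGet aS ($vt * $vn + $vv))
      (lookup ;;
       xkey :r= RGet rP ($vr * $vn + $vu) -^ RGet rEW $vj ;;
       If (BNot ($$xkey <=r RGet rP ($vt * $vn + $vv)))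
         (RPut rP ($vt * $vn + $vv) ($$xkey) ;; treeset) Skip)
      Skip) Skip)%prog.

Definition scanb : cmd :=
  (vj ::= ($vp - #1) / #2 ;; relax ;; vp ::= IGet aNX ($vp - #1))%prog.

Definition scan : cmd :=
  (vp ::= IGet aHD ($vc * $vn + $vx) ;; While (#1 <=i $vp) scanb)%prog.

Definition markb : cmd :=
  (vv ::= IGet aAL ($vt * $vn + $va) ;;
   IPut aS ($vt * $vn + $vv) (#1) ;;
   xkey :r= RGet rP ($vl * $vn + $vv) ;;
   RPut rP ($vt * $vn + $vv) ($$xkey) ;;
   treeset ;; va ::= $va + #1)%prog.

Definition mark : cmd :=
  (va ::= #0 ;; While (BNot (IGet aCN $vt <=i $va)) markb)%prog.

Definition initscanb : cmd :=
  (vx ::= IGet aAL ($vt * $vn + $va) ;; scan ;; va ::= $va + #1)%prog.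

(** Dead vertices are never queued, so their outgoing edges must be relaxed from the other end: the
    incidence lists contain incoming edges too, and every alive vertex is scanned once before the
    first extraction. *)
Definition initscan : cmd :=
  (va ::= #0 ;; While (BNot (IGet aCN $vt <=i $va)) initscanb)%prog.

(** Key 0 at a leaf means absence, so writing it deletes the extracted vertex. *)
Definition pop : cmd :=
  (descend ;; vx ::= $vi - $vn ;; vv ::= $vx ;; xkey :r= RCast #0 ;; treeset)%prog.

Definition poploop : cmd :=
  (While (BNot (RGet rTR #1 <=r RCast #0)) (pop ;; scan))%prog.

Definition dijkstra : cmd :=
  (vlim ::= $vB + ($vt - $vc) ;; mark ;; initscan ;; poploop)%prog.

Definition filterb : cmd :=
  (vv ::= IGet aAL ($vpm * $vn + $va) ;;
   If (BNot (($$xinf -^ RGet rP ($vl * $vn + $vv)) <=r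
             ($$xdel *^ ($$xinf -^ RGet rP ($vrt * $vn + $vv)))))
     (IPut aAL ($vt * $vn + $vna) $vv ;; vna ::= $vna + #1) Skip ;;
   va ::= $va + #1)%prog.

Definition filterlist : cmd :=
  (vna ::= #0 ;; va ::= #0 ;;
   While (BNot (IGet aCN $vpm <=i $va)) filterb ;;
   IPut aCN $vt $vna)%prog.

(** [vpm] is the midpoint of the interval of twice the length; for the topmost interval it is the
    end of the chunk, whose list holds all heads other than the source. *)
Definition process : cmd :=
  (vl ::= $vc + $vq * $vsz ;; vrt ::= $vl + $vsz ;; vt ::= $vl + $vsz / #2 ;;
   vpm ::= $vc + (#2 * ($vq / #2) + #1) * $vsz ;;
   filterlist ;; dijkstra ;; vq ::= $vq + #1)%prog.

Definition level : cmd :=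
  (vq ::= #0 ;; While (BNot ($vK <=i $vq * $vsz)) process ;; vsz ::= $vsz / #2)%prog.

Definition levels : cmd := (vsz ::= $vK ;; While (#2 <=i $vsz) level)%prog.

Definition loadb : cmd :=
  (IPut aEU ($vB + $vk) (IGet aTail ($vc + $vk)) ;;
   IPut aEV ($vB + $vk) (IGet aHead ($vc + $vk)) ;;
   RPut rEW ($vB + $vk) (RGet rWt ($vc + $vk)) ;;
   vk ::= $vk + #1)%prog.

Definition load : cmd :=
  (vk ::= #0 ;; While (BNot ($vcnt <=i $vk)) loadb)%prog.

(** Rows of [aHD] and [aHF] are indexed by the start of the chunk: each chunk finds fresh zeros, and
    no time proportional to [n] goes into clearing. A vertex that is no head is unreachable unless
    it is the source, so only heads are ever listed. *)
Definition buildb : cmd :=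
  (vu ::= IGet aEU $vk ;; vv ::= IGet aEV $vk ;;
   IPut aNX (#2 * $vk) (IGet aHD ($vc * $vn + $vu)) ;;
   IPut aHD ($vc * $vn + $vu) (#2 * $vk + #1) ;;
   IPut aNX (#2 * $vk + #1) (IGet aHD ($vc * $vn + $vv)) ;;
   IPut aHD ($vc * $vn + $vv) (#2 * $vk + #2) ;;
   If (BNot (BAnd ($vv <=i $vs) ($vs <=i $vv)))
     (If (IGet aHF ($vc * $vn + $vv) <=i #0)
        (IPut aHF ($vc * $vn + $vv) (#1) ;;
         IPut aAL ($vT * $vn + $vna) $vv ;; vna ::= $vna + #1) Skip) Skip ;;
   vk ::= $vk + #1)%prog.

Definition build : cmd :=
  (vna ::= #0 ;; vk ::= #0 ;; While (BNot ($vNE <=i $vk)) buildb ;;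
   IPut aCN $vT $vna)%prog.

(** The edges of the chunk are read from the input again, because the growing block of the first
    [vB] positions overwrites the copies made by [load]. *)
Definition foldb : cmd :=
  (vu ::= IGet aTail ($vc + $vk) ;; vv ::= IGet aHead ($vc + $vk) ;;
   vj ::= IGet aM ($vu * $vn + $vv) ;;
   If (#1 <=i $vj)
     (If (RGet rEW ($vj - #1) <=r RGet rWt ($vc + $vk)) Skip
         (RPut rEW ($vj - #1) (RGet rWt ($vc + $vk))))
     (IPut aEU $vB $vu ;; IPut aEV $vB $vv ;;
      RPut rEW $vB (RGet rWt ($vc + $vk)) ;;
      vB ::= $vB + #1 ;; IPut aM ($vu * $vn + $vv) $vB) ;;
   vk ::= $vk + #1)%prog.

Definition fold : cmd :=
  (vk ::= #0 ;; While (BNot ($vcnt <=i $vk)) foldb)%prog.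

(** The source is never alive: the value [INF], that is distance 0, written for it at the end of the
    chunk is what every lookup inside the chunk finds. *)
Definition chunk : cmd :=
  (vT ::= $vc + $vK ;;
   RPut rP ($vT * $vn + $vs) ($$xinf) ;;
   If ($vT <=i $vm) (vcnt ::= $vK) (vcnt ::= $vm - $vc) ;;
   vNE ::= $vB + $vcnt ;;
   load ;; build ;;
   vl ::= $vc ;; vt ::= $vT ;; dijkstra ;;
   levels ;; fold ;; vc ::= $vT)%prog.

Definition chunks : cmd := (While (BNot ($vm <=i $vc)) chunk)%prog.

Definition maxwb : cmd :=
  (If (RGet rWt $vk <=r $$xW) Skip (xW :r= RGet rWt $vk) ;; vk ::= $vk + #1)%prog.

Definition maxw : cmd :=
  (xW :r= RCast #1 ;; vk ::= #0 ;; While (BNot ($vm <=i $vk)) maxwb)%prog.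

Definition sizeKb : cmd := (vK ::= $vK * #2 ;; vhh ::= $vhh + #1)%prog.

Definition sizeK : cmd :=
  (vK ::= #1 ;; vhh ::= #0 ;;
   While (BAnd (BNot ($vm <=i $vK)) (BNot ($vn * $vn <=i $vK))) sizeKb)%prog.

(** [xinf] exceeds (1 + eps) times any finite distance, since a simple path has fewer than [n]
    edges. For [vhh] = 0 the division by zero yields 0 and [xdel] becomes 1; nothing is bisected
    then. *)
Definition setup : cmd :=
  (xinf :r= (RCast #1 +^ $$xeps) *^ RCast $vn *^ $$xW ;;
   If ($$xeps <=r RCast #1) (xdel :r= $$xeps) (xdel :r= RCast #1) ;;
   xdel :r= RCast #1 +^ $$xdel /^ RCast (#2 * $vhh) ;;
   RPut rP $vs ($$xinf) ;;
   IPut aPar (#0) $vn ;; IPut aPar (#1) $vK ;;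
   RPut rPar (#0) ($$xinf) ;; RPut rPar (#1) ($$xeps) ;;
   vc ::= #0 ;; vB ::= #0)%prog.

Definition preprocess : cmd :=
  (vn ::= $0 ;; maxw ;; sizeK ;; setup ;; chunks)%prog.

(** The stored distance is a lower bound, so the factor 1 + eps is multiplied in to get an upper
    bound; a result of at least [INF] can only come from an unreachable vertex. *)
Definition query : cmd :=
  (vu ::= $0 ;; vt ::= $1 ;; vn ::= IGet aPar #0 ;; vK ::= IGet aPar #1 ;;
   vT ::= ($vt + $vK - #1) / $vK * $vK ;;
   lookup ;;
   xkey :r= (RCast #1 +^ RGet rPar #1) *^
            (RGet rPar #0 -^ RGet rP ($vr * $vn + $vu)) ;;
   If (RGet rPar #0 <=r $$xkey) (0%N ::= #0) (0%N ::= #1 ;; xeps :r= $$xkey))%prog.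

(** The search of [lookup] for the first time [t' >= t] at which a value is stored;
    [S] tells where, and [r] is the end of the bisected interval. *)
Fixpoint next_stored (S : nat -> bool) (h r t : nat) : nat :=
  if h is h'.+1 then
    if (t + 2 ^ h' <= r)%N && S (r - 2 ^ h')%N then next_stored S h' (r - 2 ^ h') t
    else next_stored S h' r t
  else r.

Lemma next_stored_le S h r t : (next_stored S h r t <= r)%N.
Proof.
elim: h r => //= h IH r; case: ifP => // _.
exact: leq_trans (IH _) (leq_subr _ _).
Qed.

(** The leaves sit at n, ..., 2n - 1 and the parent of i is i / 2. For every n > 0, power of two or
    not, these chains end at the root 1. *)
Definition tree_ok {R : realType} (n : nat) (TR : nat -> R) : Prop :=
  forall i, (0 < i < n)%N -> TR i = Num.max (TR (2 * i)%N) (TR (2 * i + 1)%N).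

Lemma tree_root {R : realType} n (TR : nat -> R) i :
  tree_ok n TR -> (0 < i < 2 * n)%N -> TR i <= TR 1%N.
Proof.
move=> tok; have [m] := ubnP i; elim: m i => // m IH i im /andP[i0 i2].
have [->//|i1] := eqVneq i 1%N.
have hp : (0 < i %/ 2 < n)%N by lia.
have := IH (i %/ 2)%N; rewrite (tok _ hp) => H.
apply: (le_trans _ (H _ _)); try lia.
have [e|e] : (i = 2 * (i %/ 2) \/ i = 2 * (i %/ 2) + 1)%N by lia.
  by rewrite {1}e le_max lexx.
by rewrite {1}e le_max lexx orbT.
Qed.

(** * Searching for stored times; the tournament tree *)

Section Words.
Context {R : realType} (w NB : nat).
Hypothesis NB1 : (1 < NB)%N.
Hypothesis NBw : (8 * NB * NB < 2 ^ w)%N.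
Implicit Types (st : state R).

(** Overflow checks reduce to two shapes: small multiples of [NB], and array indices a * b + c with
    all three numbers up to [NB]. *)
Lemma word_le a : (a <= 8 * NB)%N -> (a < 2 ^ w)%N.
Proof.
move=> h; apply: leq_ltn_trans NBw; apply: leq_trans h _.
by rewrite leq_pmulr //; lia.
Qed.

Lemma word_mul a b : (a <= NB)%N -> (b <= NB)%N -> (a * b < 2 ^ w)%N.
Proof.
move=> ha hb; apply: leq_ltn_trans NBw; rewrite -mulnA.
by have := leq_mul ha hb; lia.
Qed.

Lemma word_mul_add a b c : (a <= NB)%N -> (b <= NB)%N -> (c <= NB)%N -> (a * b + c < 2 ^ w)%N.
Proof.
move=> ha hb hc; apply: leq_ltn_trans NBw; rewrite -mulnA.
have := leq_mul ha hb; have : (NB <= NB * NB)%N by rewrite leq_pmulr //; lia.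
by lia.
Qed.

Ltac words := first
  [ by [] | by apply: word_le; lia | by apply: word_mul; lia | by apply: word_mul_add; lia
  | by apply/andP; split; [lia | apply: word_le; lia] ].
Ltac oks := repeat match goal with
  | |- _ /\ _ => split
  | |- and3 _ _ _ => split
  | |- _ => words
  end.

Lemma lookup_run st n T h t v :
  ivar st vn = n -> ivar st vT = T -> ivar st vK = (2 ^ h)%N -> ivar st vt = t ->
  ivar st vu = v -> (n <= NB)%N -> (T <= NB)%N -> (2 ^ h <= NB)%N -> (t <= NB)%N ->
  (v <= NB)%N ->
  run w lookup st (40 * h.+1) (fun st' =>
    ivar st' vr = next_stored (fun x => 0 < iarr st aS (x * n + v))%N h T t).
Proof.
move=> Hn HT HK Ht Hv ln lT lK lt lv.
apply: (@run_loop_free_seq _ _ _ _ _ (40 * h + 30)) => //; last by rewrite /=; lia.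
apply: (@run_loop_free_seq _ _ _ _ _ (40 * h + 20)) => //; last by rewrite /=; lia.
  by split=> //=; words.
(* [vh] is 2 ^ h' / 2, so that h' = 0 makes it 0 and ends the loop. *)
pose I k st' := exists h' r, [/\ ivar st' vh = (2 ^ h' %/ 2)%N, ivar st' vr = r, (h' <= h /\ r <= NB)%N,
   (40 * h' + 20 <= k)%N &
   next_stored (fun x => 0 < iarr st aS (x * n + v))%N h' r t =
   next_stored (fun x => 0 < iarr st aS (x * n + v))%N h T t].
apply: (@run_while_frame _ _ _ _ I).
- by move=> k st' _ _; split=> //=; words.
- move=> k st' F [h' [r [eh er [lh lr] lk' ec]]] /=; rewrite eh.
  case: h' eh lh lk' ec => [//|h'] eh lh lk' ec _.
  have e2 : (2 ^ h'.+1 %/ 2 = 2 ^ h')%N by rewrite expnS mulKn.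
  rewrite e2 in eh.
  have l2 : (2 ^ h' <= NB)%N by apply: leq_trans lK; rewrite leq_exp2l //; lia.
  have en : ivar st' vn = n by rewrite (frame_iv F).
  have et : ivar st' vt = t by rewrite (frame_iv F).
  have ev : ivar st' vu = v by rewrite (frame_iv F).
  have eS : iarr st' aS = iarr st aS by rewrite (frame_ia F).
  exists 35, (40 * h' + 20)%N; split; last by rewrite /=; lia.
  apply: run_loop_free => //.
    rewrite /= eh er en et ev eS; split; last first.
      by oks.
    split; first by split; [oks|move=> hle; oks].
    by case: ifP => //= /andP[hle _]; oks.
  rewrite /= eh er en et ev eS /=; case: ifP => hc.
    exists h', (r - 2 ^ h')%N; split=> //=; rewrite ?eh //; try lia.
    by rewrite -ec /= hc.
  exists h', r; split=> //=; rewrite ?eh //; try lia.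
  by rewrite -ec /= hc.
- move=> k st' F [h' [r [eh er [lh lr] lk' ec]]] /=; rewrite eh er.
  case: h' eh lh lk' ec => [|h'] eh lh lk' ec.
    by move=> _; split; [lia|].
  by rewrite expnS mulKn // expn_gt0.
- by exists h, T; split=> //; rewrite /= ?/upd /= ?HK ?HT.
Qed.

(** While the walk stands at [i], the tournament equation can fail only at proper ancestors of [i];
    the root has none. *)
Lemma treeset_run st n v LG :
  ivar st vn = n -> ivar st vv = v -> (v < n <= NB)%N -> (2 * n <= 2 ^ LG)%N ->
  tree_ok n (rarr st rTR) ->
  run w treeset st (40 * LG + 20) (fun st' =>
    tree_ok n (rarr st' rTR) /\
    forall u, (u < n)%N ->
      rarr st' rTR (n + u)%N = if u == v then rvar st xkey else rarr st rTR (n + u)%N).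
Proof.
move=> Hn Hv /andP[vn' nN] nL tok.
apply: (@run_loop_free_seq _ _ _ _ _ (40 * LG + 10)) => //; last by rewrite /=; lia.
  by rewrite /= Hn Hv; oks.
apply: (@run_loop_free_seq _ _ _ _ _ (40 * LG + 4)) => //; last by rewrite /=; lia.
pose I k st' := exists i l, [/\ ivar st' vi = i, (0 < i < 2 * n)%N, (i < 2 ^ l)%N,
   (40 * l + 4 <= k)%N &
   (forall u, (u < n)%N ->
      rarr st' rTR (n + u)%N = if u == v then rvar st xkey else rarr st rTR (n + u)%N) /\
   forall j, (0 < j < n)%N ->
      rarr st' rTR j = Num.max (rarr st' rTR (2 * j)%N) (rarr st' rTR (2 * j + 1)%N)
      \/ exists d, j = (i %/ 2 ^ d.+1)%N].
apply: (@run_while_frame _ _ _ _ I).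
- by move=> k st' _ _; split=> //=; words.
- move=> k st' F [i [l [ei i2 il lk [leaf inn]]]] /=; rewrite ei => i1.
  case: l il lk => [|l] il lk; first by lia.
  exists 36, (40 * l + 4)%N; split; last by rewrite /=; lia.
  have hp : (i %/ 2 < n)%N by lia.
  apply: run_loop_free => //; first by rewrite /= ei; case: ifP => _; oks.
  rewrite /= ei; set p := (i %/ 2)%N; exists p, l.
  set st2 := (X in ivar X); have -> : ivar st2 vi = p by rewrite /st2; case: ifP.
  have e2 : forall x, rarr st2 rTR x = if x == p then
     Num.max (rarr st' rTR (2 * p)%N) (rarr st' rTR (2 * p + 1)%N) else rarr st' rTR x.
    move=> x; rewrite /st2; case: leP => h /=; case: (x == p) => //=.
  have il2 : (i < 2 * 2 ^ l)%N by rewrite -expnS.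
  split=> //; try by rewrite /p; lia.
  split=> [u un|j jn].
    rewrite e2 ifF ?leaf //; lia.
  rewrite !e2; have [jp|jp] := eqVneq j p.
    left; rewrite !ifF ?jp //; by rewrite /p; lia.
  have [e|[d e]] := inn j jn.
    have [k2|k2] := eqVneq (2 * j)%N p.
      by right; exists 0%N; rewrite expn1 -k2 mulKn.
    have [k3|k3] := eqVneq (2 * j + 1)%N p; last by left.
    by right; exists 0%N; rewrite expn1 -k3; lia.
  case: d e => [|d] e; first by move: jp; rewrite e /p expn1 eqxx.
  by right; exists d; rewrite e /p -divnMA -expnS.
- move=> k st' F [i [l [ei i2 il lk [leaf inn]]]] /=; rewrite ei => i1.
  split; first by lia.
  split=> // j jn; have [//|[d e]] := inn j jn.
  have i1' : i = 1%N by lia.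
  by move: jn; rewrite e i1' divn_small // -{1}(expn0 2) ltn_exp2l.
- exists (n + v)%N, LG; split=> //=; rewrite ?Hn ?Hv //; try lia.
  split=> [u un|j jn]; first by rewrite eqn_add2l.
  rewrite ifF; last by lia.
  have [k2|k2] := eqVneq (2 * j)%N (n + v)%N.
    by right; exists 0%N; rewrite expn1 -k2 mulKn.
  have [k3|k3] := eqVneq (2 * j + 1)%N (n + v)%N.
    by right; exists 0%N; rewrite expn1 -k3; lia.
  by left; exact: tok.
Qed.

(** The child chosen carries the value of its parent, and the index at least doubles, which limits
    the rounds to [LG]. *)
Lemma descend_run st n LG :
  ivar st vn = n -> (0 < n <= NB)%N -> (n <= 2 ^ LG)%N ->
  tree_ok n (rarr st rTR) ->
  run w descend st (40 * LG + 20) (fun st' =>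
    (n <= ivar st' vi < 2 * n)%N /\ rarr st rTR (ivar st' vi) = rarr st rTR 1%N).
Proof.
move=> Hn /andP[n0 nN] nL tok.
apply: (@run_loop_free_seq _ _ _ _ _ (40 * LG + 10)) => //=; try lia.
pose I k st' := exists l, [/\ (2 ^ l <= ivar st' vi < 2 * n)%N, (l <= LG)%N,
   (40 * (LG - l) + 10 <= k)%N &
   rarr st rTR (ivar st' vi) = rarr st rTR 1%N].
apply: (@run_while_frame _ _ _ _ I).
- by move=> k st' _ _; split=> //=; words.
- move=> k st' F [l [/andP[li i2] lL lk e]] /=.
  have en : ivar st' vn = n by rewrite (frame_iv F).
  have eT : rarr st' rTR = rarr st rTR by rewrite (frame_ra F).
  rewrite en -ltnNge => ltn.
  have lL2 : (l < LG)%N.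
    by rewrite -(ltn_exp2l _ _ (ltnSn 1)); apply: leq_ltn_trans li _; apply: leq_trans nL.
  exists 30, (40 * (LG - l.+1) + 10)%N; split; last by rewrite /=; lia.
  apply: run_loop_free => //; first by rewrite /=; case: ifP => _; oks.
  have i0 : (0 < ivar st' vi)%N by rewrite (leq_trans _ li) // expn_gt0.
  have := tok (ivar st' vi); rewrite i0 ltn => /(_ isT); rewrite e => mx.
  exists l.+1; rewrite /= eT expnS; case: leP mx => h mx /=; split=> //; try lia.
- move=> k st' F [l [/andP[li i2] lL lk e]] /=.
  by rewrite (frame_iv F) //= Hn negbK => nle; rewrite nle i2; split; [lia|].
- exists 0%N; rewrite /= subn0; split=> //; lia.
Qed.

End Words.

Ltac words NB1 NBw := first
  [ by [] | by apply: (word_le NB1 NBw); lia | by apply: (word_mul NB1 NBw); lia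
  | by apply: (word_mul_add NB1 NBw); lia
  | by apply/andP; split; [lia | apply: (word_le NB1 NBw); lia] ].
Ltac oks NB1 NBw := repeat match goal with
  | |- _ /\ _ => split
  | |- and3 _ _ _ => split
  | |- _ => words NB1 NBw
  end.

Lemma idx_inj n a b u v : (u < n)%N -> (v < n)%N -> (a * n + u = b * n + v)%N -> a = b /\ u = v.
Proof.
move=> un vn e; have n0 : (0 < n)%N by lia.
have := congr1 (fun x => x %/ n)%N e; have := congr1 (fun x => x %% n)%N e.
by rewrite /= !modnMDl !modn_small // !divnMDl // !divn_small // !addn0.
Qed.

Lemma idx_eq n a b u v : (u < n)%N -> (v < n)%N ->
  ((a * n + u == b * n + v) = (a == b) && (u == v))%N.
Proof.
move=> un vn; apply/eqP/andP => [/(idx_inj un vn)[-> ->]|[/eqP -> /eqP ->]] //.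
Qed.

Fixpoint linked (NX : nat -> nat) (p : nat) (L : seq nat) : Prop :=
  if L is j :: L' then (0 < p)%N /\ ((p - 1) %/ 2)%N = j /\ linked NX (NX (p - 1)%N) L'
  else p = 0%N.

(** * Dijkstra's algorithm at one time *)

(** [A] lists the alive vertices at time [t], [Pd] holds the values of the dead
    ones, and [Val u x] says that [x] is an admissible value for [u]. *)
Section Dijkstra.
Context {R : realType} (w NB : nat).
Hypothesis NB1 : (1 < NB)%N.
Hypothesis NBw : (8 * NB * NB < 2 ^ w)%N.
Variables (n T h c t lim NE LG : nat).
Variables (EU EV HD NX AL CN S1 : nat -> nat) (EW P0 : nat -> R).
Variables (A : seq nat) (Pd Pl : nat -> R) (Val : nat -> R -> Prop).
Hypothesis bounds : [/\ (0 < n <= NB)%N, (T <= NB)%N, (2 ^ h <= NB)%N, (c <= NB)%N & (t <= NB)%N].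
Hypothesis bounds2 : [/\ (lim <= NB)%N, (2 * NE + 1 <= NB)%N, (h <= LG)%N & (2 * n <= 2 ^ LG)%N].
Hypothesis EUn : forall j, (j < NE)%N -> (EU j < n)%N.
Hypothesis EVn : forall j, (j < NE)%N -> (EV j < n)%N.
Hypothesis EW0 : forall j, (j < NE)%N -> 0 < EW j.
Hypothesis An : forall v, v \in A -> (v < n)%N.
Hypothesis S1A : forall v, (v < n)%N -> (0 < S1 (t * n + v)%N)%N = (v \in A).
Hypothesis lookA : forall u, u \in A -> next_stored (fun x => 0 < S1 (x * n + u)%N)%N h T t = t.
Hypothesis lookD : forall u, (u < n)%N -> u \notin A ->
  P0 (next_stored (fun x => 0 < S1 (x * n + u)%N)%N h T t * n + u)%N = Pd u.
Hypothesis ValE : forall j x, (j < lim)%N -> (j < NE)%N -> EV j \in A ->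
  Val (EU j) x -> Val (EV j) (x - EW j).
Hypothesis ValD : forall u, (u < n)%N -> u \notin A -> Val u (Pd u).
Implicit Types (st : state R).

Record dijkstra_envS Sx st : Prop := Denv {
  env_n : ivar st vn = n; env_T : ivar st vT = T; env_K : ivar st vK = (2 ^ h)%N;
  env_c : ivar st vc = c; env_t : ivar st vt = t; env_lim : ivar st vlim = lim;
  env_EU : iarr st aEU = EU; env_EV : iarr st aEV = EV; env_HD : iarr st aHD = HD;
  env_NX : iarr st aNX = NX; env_AL : iarr st aAL = AL; env_CN : iarr st aCN = CN;
  env_S : iarr st aS = Sx; env_EW : rarr st rEW = EW }.

Notation dijkstra_env := (dijkstra_envS S1).

Lemma dijkstra_env_frame cm st st' : frame cm st st' ->
  all (fun x => x \notin written_ivars cm) [:: vn; vT; vK; vc; vt; vlim] ->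
  all (fun x => x \notin written_iarrs cm) [:: aEU; aEV; aHD; aNX; aAL; aCN; aS] ->
  rEW \notin written_rarrs cm -> dijkstra_env st -> dijkstra_env st'.
Proof.
case=> f1 f2 f3 f4 /= /and5P[i1 i2 i3 i4 /and3P[i5 i6 _]].
move=> /and5P[a1 a2 a3 a4 /and4P[a5 a6 a7 _]] r1 [*]; split.
all: by rewrite ?f1 ?f3 ?f4.
Qed.

Definition cur (P : nat -> R) u := if u \in A then P (t * n + u)%N else Pd u.

(** [Ex] contains the edges that may still violate the triangle inequality
    although their tail is not queued, [X] the vertices already extracted. *)
Record dijkstra_inv (Ex : nat -> Prop) (X : seq nat) st : Prop := Dinv {
  di_out : forall x, (forall v, v \in A -> x <> t * n + v)%N -> rarr st rP x = P0 x;
  di_tree : tree_ok n (rarr st rTR);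
  di_leaf : forall u, (u < n)%N -> rarr st rTR (n + u)%N = 0 \/
     (u \in A /\ rarr st rTR (n + u)%N = rarr st rP (t * n + u)%N);
  di_ge : forall v, v \in A -> 0 <= rarr st rP (t * n + v)%N;
  di_val : forall v, v \in A -> Val v (rarr st rP (t * n + v)%N);
  di_mono : forall v, v \in A -> Pl v <= rarr st rP (t * n + v)%N;
  di_edge : forall j, (j < lim)%N -> (j < NE)%N -> EV j \in A ->
     cur (rarr st rP) (EU j) - EW j <= rarr st rP (t * n + EV j)%N \/
     0 < rarr st rTR (n + EU j)%N \/ Ex j;
  di_X : forall v, v \in X -> [/\ v \in A, rarr st rTR (n + v)%N = 0,
     (forall y, (y < n)%N -> rarr st rTR (n + y)%N <= rarr st rP (t * n + v)%N) &
     (forall j, (j < NE)%N -> Ex j -> cur (rarr st rP) (EU j) <= rarr st rP (t * n + v)%N)] }.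

Lemma dijkstra_inv_ext Ex X st st' : dijkstra_inv Ex X st -> rarr st' rP = rarr st rP ->
  rarr st' rTR = rarr st rTR -> dijkstra_inv Ex X st'.
Proof. by case=> h1 h2 h3 h4 h5 h6 h7 h8 e1 e2; split; rewrite ?e1 ?e2. Qed.

(** An edge may leave the exceptions once it satisfies the triangle inequality. The exceptions may
    grow only while nothing is extracted, because [di_X] bounds all their tails. *)
Lemma dijkstra_inv_Ex (Ex Ex' : nat -> Prop) X st : dijkstra_inv Ex X st ->
  (X = [::] \/ forall j, Ex' j -> Ex j) ->
  (forall j, (j < lim)%N -> (j < NE)%N -> EV j \in A -> Ex j -> Ex' j \/
     cur (rarr st rP) (EU j) - EW j <= rarr st rP (t * n + EV j)%N) ->
  dijkstra_inv Ex' X st.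
Proof.
case=> h1 h2 h3 h4 h5 h6 h7 h8 sub sup; split=> //.
  move=> j j1 j2 jA; have [|[|e]] := h7 j j1 j2 jA; [by left|by right; left|].
  by have [] := sup j j1 j2 jA e; [by right; right|left].
move=> v vX; have [q1 q2 q3 q4] := h8 v vX; split=> // j jN e.
by case: sub => [X0|sub]; [rewrite X0 in vX|apply: q4 => //; apply: sub].
Qed.

Lemma cur_lookup Ex X st u : dijkstra_inv Ex X st -> dijkstra_env st -> (u < n)%N ->
  rarr st rP (next_stored (fun x => 0 < S1 (x * n + u)%N)%N h T t * n + u)%N = cur (rarr st rP) u.
Proof.
move=> D E un; rewrite /cur; case: ifP => uA; first by rewrite lookA.
rewrite (di_out D) ?lookD ?uA // => v vA /(idx_inj un (An vA))[_ uv].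
by move: uA; rewrite uv vA.
Qed.

Definition relax_cost := (80 * LG + 200)%N.

(** The tail of an improving edge is queued or belongs to an exception, so its value is at most that
    of any extracted vertex; as weights are positive, the new key is smaller still. Hence extracted
    vertices are never improved and never queued again. *)
Lemma relax_run Ex X st j : dijkstra_env st -> dijkstra_inv Ex X st -> ivar st vj = j -> (j < NE)%N ->
  run w relax st relax_cost (fun st' => dijkstra_inv (fun i => Ex i /\ i <> j) X st').
Proof.
move=> E D ej jN.
have [/andP[n0 nNB] TN hN cN tN] := bounds; have [limN NEN hL nL] := bounds2.
have eu := EUn jN; have ev := EVn jN.
apply: (@run_loop_free_seq _ _ _ _ _ (80 * LG + 190)) => //; last by rewrite /relax_cost /=; lia.
set st1 := final_state _ _.
apply: (@run_loop_free_seq _ _ _ _ _ (80 * LG + 180)) => //; last by rewrite /=; lia.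
set st2 := final_state _ _.
have E1 : dijkstra_env st1 by apply: dijkstra_env_frame (frame_final_state _ _) _ _ _ E.
have E2 : dijkstra_env st2 by apply: dijkstra_env_frame (frame_final_state _ _) _ _ _ E1.
have D2 : dijkstra_inv Ex X st2 by apply: dijkstra_inv_ext D _ _.
have [u2 v2 j2] : [/\ ivar st2 vu = EU j, ivar st2 vv = EV j & ivar st2 vj = j].
  by rewrite /st2 /st1 /= ej (env_EU E) (env_EV E).
clearbody st2; clear st1 E1.
apply: (@run_if _ _ _ _ _ _ _ (80 * LG + 160)) => //; last 1 first.
- by rewrite /=; lia.
- rewrite /= (env_lim E2) j2 -ltnNge => jlim.
  apply: (@run_if _ _ _ _ _ _ _ (80 * LG + 150)) => //; last 1 first.
  + by rewrite /=; lia.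
  + by rewrite /= (env_t E2) (env_n E2) v2; oks NB1 NBw.
  + rewrite /= (env_t E2) (env_n E2) v2 (env_S E2) S1A // => evA.
    have := @lookup_run R w NB NB1 NBw st2 n T h t (EU j) (env_n E2) (env_T E2) (env_K E2) (env_t E2) u2.
    rewrite (env_S E2) => L.
    apply: (run_seq_frame (k2 := 40 * LG + 80)); [apply: L; lia| |by lia].
    move=> st3 r3 F3; have E3 : dijkstra_env st3 by apply: dijkstra_env_frame F3 _ _ _ E2.
    have D3 : dijkstra_inv Ex X st3 by apply: dijkstra_inv_ext D2 _ _; rewrite (frame_ra F3).
    have u3 : ivar st3 vu = EU j by rewrite (frame_iv F3).
    have v3 : ivar st3 vv = EV j by rewrite (frame_iv F3).
    have j3 : ivar st3 vj = j by rewrite (frame_iv F3).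
    have rT : (ivar st3 vr <= NB)%N by rewrite r3; apply: (leq_trans (n := T)); [exact: next_stored_le|by []].
    apply: (@run_loop_free_seq _ _ _ _ _ (40 * LG + 60)) => //=; last by lia.
      by rewrite u3 (env_n E3); oks NB1 NBw.
    set st4 := set_rvar _ _ _.
    have key4 : rvar st4 xkey = cur (rarr st4 rP) (EU j) - EW j.
      by rewrite /st4 /= u3 j3 (env_n E3) r3 (env_EW E3) (cur_lookup D3 E3).
    have E4 : dijkstra_env st4 by case: E3 => *; split.
    have D4 : dijkstra_inv Ex X st4 by apply: dijkstra_inv_ext D3 _ _.
    have v4 : ivar st4 vv = EV j by [].
    clearbody st4; clear st3 r3 F3 E3 D3 u3 v3 j3 rT L st2 E2 D2 u2 v2 j2.
    apply: (@run_if _ _ _ _ _ _ _ (40 * LG + 50)) => //; last 1 first.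
    * by rewrite /=; lia.
    * by rewrite /= (env_t E4) (env_n E4) v4; oks NB1 NBw.
    * rewrite /= (env_t E4) (env_n E4) v4 key4 -ltNge => lt.
      apply: (@run_loop_free_seq _ _ _ _ _ (40 * LG + 20)) => //=; last by lia.
        by rewrite v4 (env_n E4) (env_t E4); oks NB1 NBw.
      rewrite v4 (env_n E4) (env_t E4) key4.
      set key := cur _ _ - _ in lt *.
      set st5 := set_rarr _ _ _ _.
      apply: (@run_weaken _ _ _ _ (40 * LG + 20)); [|by []|].
        apply: run_frame; apply: (@treeset_run R w NB NB1 NBw st5 n (EV j) LG) => //=; try lia.
          by rewrite (env_n E4).
        exact: di_tree D4.
      move=> st6 [[tok leaf] F6]; rewrite /= in leaf.
      have p6 : rarr st6 rP = upd (rarr st4 rP) (t * n + EV j)%N key by rewrite (frame_ra F6).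
      have pe : forall x, x \in A -> rarr st6 rP (t * n + x)%N =
          if x == EV j then key else rarr st4 rP (t * n + x)%N.
        by move=> x xA; rewrite p6 /= idx_eq ?An // eqxx.
      have ce : forall u, cur (rarr st6 rP) u = if u == EV j then key else cur (rarr st4 rP) u.
        move=> u; rewrite /cur; case: ifP => uA; first exact: pe.
        by case: eqP => // ue; rewrite ue evA in uA.
      have le6 : forall x, x \in A -> rarr st4 rP (t * n + x)%N <= rarr st6 rP (t * n + x)%N.
        by move=> x xA; rewrite pe //; case: eqP => // ->; apply: ltW.
      have key0 : 0 < key by apply: le_lt_trans lt; apply: (di_ge D4).
      have lfe : forall u, (u < n)%N -> rarr st6 rTR (n + u)%N = if u == EV j then key else rarr st4 rTR (n + u)%N.
        by move=> u un; rewrite leaf // key4.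
      (* A loop cannot improve its own head, as its weight is positive. *)
      have neu : (EU j == EV j) = false.
        apply/eqP => ee; move: lt; rewrite /key ee /cur evA.
        by have := EW0 jN; lra.
      have evX : EV j \notin X.
        apply/negP => vX; have [_ t0 q1 q2] := di_X D4 vX.
        (* The edge is already satisfied, or its tail is queued, or it is an exception. *)
        have [h1|[h1|h1]] := di_edge D4 jlim jN evA.
        - by move: lt; rewrite /key; lra.
        - have [h2|[uA h2]] := di_leaf D4 eu; first by rewrite h2 ltxx in h1.
          have := q1 _ eu; rewrite h2 => h3; move: lt; rewrite /key /cur uA.
          by have := EW0 jN; lra.
        - have := q2 _ jN h1 => h3; move: lt; rewrite /key.
          by have := EW0 jN; lra.
      have keyX : forall v, v \in X -> key <= rarr st4 rP (t * n + v)%N.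
        move=> v vX; have [_ t0 q1 q2] := di_X D4 vX.
        have [h1|[h1|h1]] := di_edge D4 jlim jN evA.
        - by move: lt; rewrite /key; lra.
        - have [h2|[uA h2]] := di_leaf D4 eu; first by rewrite h2 ltxx in h1.
          have := q1 _ eu; rewrite h2 => h3; rewrite /key /cur uA.
          by have := EW0 jN; lra.
        - have := q2 _ jN h1 => h3; rewrite /key.
          by have := EW0 jN; lra.
      split.
      -- move=> x xA; rewrite p6 /= ifF; first exact: (di_out D4).
         by apply/eqP; exact: xA.
      -- exact: tok.
      -- move=> u un; rewrite lfe //; case: eqP => [->|/eqP uv].
           by right; rewrite evA pe // eqxx.
         have [h1|[uA h1]] := di_leaf D4 un; [by left|right; split=> //].
         by rewrite pe // (negbTE uv).
      -- by move=> v vA; apply: le_trans (di_ge D4 vA) (le6 _ vA).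
      -- move=> v vA; rewrite pe //; case: eqP => [->|_]; last exact: (di_val D4).
         apply: ValE => //; rewrite /cur; case: ifP => uA; first exact: (di_val D4).
         by apply: ValD => //; rewrite uA.
      -- by move=> v vA; apply: le_trans (di_mono D4 vA) (le6 _ vA).
      -- move=> i il iN iA; have [->|ij] := eqVneq i j.
           by left; rewrite ce pe // eqxx neu.
         rewrite ce lfe ?EUn //; case: eqP => [_|/eqP ue]; first by right; left.
         have [h1|[h1|h1]] := di_edge D4 il iN iA.
         + by left; apply: le_trans h1 (le6 _ iA).
         + by right; left.
         + by right; right; split=> //; apply/eqP.
      -- move=> v vX; have [vA t0 q1 q2] := di_X D4 vX.
         have vne : (v == EV j) = false.
           by apply/eqP => ve; move: evX; rewrite -ve vX.
         split=> //.
         + by rewrite lfe ?An // vne.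
         + move=> y yn; rewrite lfe // pe // vne; case: eqP => // _; first exact: keyX.
           exact: q1.
         + move=> i iN [ei _]; rewrite ce pe // vne; case: eqP => // _; first exact: keyX.
           exact: q2.
    * rewrite /= (env_t E4) (env_n E4) v4 key4 negbK => le.
      apply: run_loop_free => //=; first by lia.
      apply: dijkstra_inv_Ex D4 _ _ => [|i il iN iA ei]; first by right=> i [].
      by have [->|/eqP ij] := eqVneq i j; [right|left].
  + rewrite /= (env_t E2) (env_n E2) v2 (env_S E2) S1A // => evA.
    apply: run_loop_free => //=; first by lia.
    apply: dijkstra_inv_Ex D2 _ _ => [|i il iN iA ei]; first by right=> i [].
    left; split=> // ij.
    by move: evA; rewrite -ij iA.
- rewrite /= (env_lim E2) j2 negbK => limj.
  apply: run_loop_free => //=; first by lia.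
  apply: dijkstra_inv_Ex D2 _ _ => [|i il iN iA ei]; first by right=> i [].
  left; split=> // ij.
  by move: il; rewrite ij ltnNge limj.
Qed.

Variable adj : nat -> seq nat.
Hypothesis adjL : forall x, (x < n)%N -> linked NX (HD (c * n + x)%N) (adj x).
Hypothesis adjN : forall x j, (x < n)%N -> j \in adj x -> (j < NE)%N.

Definition scan_cost x := ((relax_cost + 40) * size (adj x) + 30)%N.

Lemma scan_run Ex X st x : dijkstra_env st -> dijkstra_inv Ex X st -> ivar st vx = x -> (x < n)%N ->
  run w scan st (scan_cost x) (fun st' => dijkstra_inv (fun i => Ex i /\ i \notin adj x) X st').
Proof.
move=> E D ex xn.
have [/andP[n0 nNB] TN hN cN tN] := bounds; have [limN NEN hL nL] := bounds2.
apply: (@run_loop_free_seq _ _ _ _ _ ((relax_cost + 40) * size (adj x) + 10)) => //.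
- by rewrite /= (env_c E) (env_n E) ex; oks NB1 NBw.
- rewrite /= (env_c E) (env_n E) ex (env_HD E); set st1 := set_ivar _ _ _.
  have E1 : dijkstra_env st1 by case: E => *; split.
  pose I k st' := exists L0 L, [/\ linked NX (ivar st' vp) L, adj x = L0 ++ L,
    dijkstra_inv (fun i => Ex i /\ i \notin L0) X st' &
    ((relax_cost + 40) * size L + 10 <= k)%N].
  apply: (@run_while_frame _ _ _ _ I).
  + by move=> k st' _ _; rewrite /=; oks NB1 NBw.
  + move=> k st' F [L0 [[|j L] [lk eL D' le]]]; first by rewrite /= in lk; rewrite /= lk.
    move=> _; case: lk => p0 [ej lk].
    have E' : dijkstra_env st' by apply: dijkstra_env_frame F _ _ _ E1.
    have jN : (j < NE)%N by apply: (@adjN x) => //; rewrite eL mem_cat mem_head orbT.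
    exists (relax_cost + 30)%N, ((relax_cost + 40) * size L + 10)%N; split; last by move: le; rewrite /= mulnS; lia.
    apply: (@run_loop_free_seq _ _ _ _ _ (relax_cost + 20)) => //=; last by lia.
      by oks NB1 NBw.
    set st2 := set_ivar _ _ _.
    have E2 : dijkstra_env st2 by case: E' => *; split.
    have D2 : dijkstra_inv (fun i => Ex i /\ i \notin L0) X st2 by apply: dijkstra_inv_ext D' _ _.
    have j2 : ivar st2 vj = j by [].
    apply: (run_seq_frame (relax_run E2 D2 j2 jN) (k2 := 12)); last by lia.
    move=> st3 D3 F3; have E3 : dijkstra_env st3 by apply: dijkstra_env_frame F3 _ _ _ E2.
    have p3 : ivar st3 vp = ivar st' vp by rewrite (frame_iv F3).
    apply: run_loop_free => //=; first by rewrite p3; oks NB1 NBw.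
    exists (rcons L0 j), L; split=> //=.
    * by rewrite p3 (env_NX E3).
    * by rewrite eL cat_rcons.
    * apply: (@dijkstra_inv_Ex (fun i => (Ex i /\ i \notin L0) /\ i <> j)).
      - by apply: dijkstra_inv_ext D3 _ _.
      - by right=> i [ei]; rewrite mem_rcons inE negb_or => /andP[/eqP ij iL].
      - move=> i _ _ _ [[ei iL] /eqP ij]; left; split=> //.
        by rewrite mem_rcons inE negb_or ij.
  + move=> k st' F [L0 [[|j L] [lk eL D' le]]]; last by rewrite /= -ltnNge; case: lk; lia.
    rewrite /= in le *; split; first by lia.
    by move: eL D'; rewrite cats0 => ->.
  + exists [::], (adj x); split=> //=; first exact: adjL.
    have D1 : dijkstra_inv Ex X st1 by apply: dijkstra_inv_ext D _ _.
    by apply: dijkstra_inv_Ex D1 _ _ => [|i _ _ _ ei]; [right=> i []|left].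
- by rewrite /scan_cost /=; lia.
Qed.

Hypothesis Auniq : uniq A.
Hypothesis adjU : forall j, (j < NE)%N -> j \in adj (EU j).
Hypothesis adjV : forall j, (j < NE)%N -> j \in adj (EV j).

(** The root of the tree is the maximum, so the extracted vertex has the largest queued value. Its
    outgoing edges become the exceptions, and this value is the bound on their tails that [di_X]
    asks for. *)
Lemma pop_run X st : dijkstra_env st -> dijkstra_inv (fun=> False) X st -> 0 < rarr st rTR 1%N ->
  run w pop st (80 * LG + 80) (fun st' => exists x, [/\ x \in A, x \notin X,
    ivar st' vx = x & dijkstra_inv (fun j => EU j = x) (x :: X) st']).
Proof.
move=> E D root.
have [/andP[n0 nNB] TN hN cN tN] := bounds; have [limN NEN hL nL] := bounds2.
have H := @descend_run R w NB NB1 NBw st n LG (env_n E).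
apply: (run_seq_frame (H _ _ (di_tree D)) (k2 := 40 * LG + 50)); try lia.
move=> st1 [/andP[ni in2] eq] F1 {H}; have E1 := dijkstra_env_frame F1 isT isT isT E.
have [x ex xn] : exists2 x, ivar st1 vi = (n + x)%N & (x < n)%N.
  by exists (ivar st1 vi - n)%N; lia.
rewrite ex in eq.
have [h0|[xA lf]] := di_leaf D xn; first by move: root; rewrite -eq h0 ltxx.
have xX : x \notin X.
  by apply/negP => /(di_X D)[_ h0]; move: root; rewrite -eq h0 ltxx.
have D1 : dijkstra_inv (fun=> False) X st1 by apply: dijkstra_inv_ext D _ _; rewrite (frame_ra F1).
have eT1 : rarr st1 rTR = rarr st rTR by rewrite (frame_ra F1).
have eP1 : rarr st1 rP = rarr st rP by rewrite (frame_ra F1).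
apply: (@run_loop_free_seq _ _ _ _ _ (40 * LG + 40)) => //=; last by lia.
  by rewrite ex (env_n E1); oks NB1 NBw.
apply: (@run_loop_free_seq _ _ _ _ _ (40 * LG + 35)) => //=; last by lia.
apply: (@run_loop_free_seq _ _ _ _ _ (40 * LG + 30)) => //=; last by lia.
  by oks NB1 NBw.
rewrite ex (env_n E1) addKn; set st4 := set_rvar _ _ _.
apply: (@run_weaken _ _ _ _ (40 * LG + 20)); [|by lia|].
  apply: run_frame; apply: (@treeset_run R w NB NB1 NBw st4 n x LG) => //=; try lia.
    by rewrite (env_n E1).
  exact: di_tree D1.
move=> st5 [[tok leaf] F5]; exists x; rewrite /= in leaf.
have eP5 : rarr st5 rP = rarr st rP by rewrite (frame_ra F5).
have lf5 : forall u, (u < n)%N -> rarr st5 rTR (n + u)%N = if u == x then 0 else rarr st rTR (n + u)%N.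
  by move=> u un; rewrite leaf // eT1.
split=> //; first by rewrite (frame_iv F5).
case: D => h1 h2 h3 h4 h5 h6 h7 h8; split=> //; rewrite ?eP5 //.
- move=> u un; rewrite lf5 //; case: eqP => _; first by left.
  exact: h3.
- move=> j jl jN jA; have [e|[e|//]] := h7 j jl jN jA; first by left.
  rewrite lf5 ?EUn //; have [eu|nu] := eqVneq (EU j) x; first by right; right.
  by right; left.
- move=> v; rewrite inE => /orP[/eqP ->|vX].
    split=> //; first by rewrite lf5 // eqxx.
      move=> y yn; rewrite lf5 //; case: eqP => _; first exact: h4.
      by rewrite -lf eq; apply: (tree_root h2); lia.
    by move=> j jN ->; rewrite /cur xA.
  have [vA t0 q1 q2] := h8 v vX; split=> //.
  + by rewrite lf5 ?An //; case: eqP.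
  + move=> y yn; rewrite lf5 //; case: eqP => _; [exact: h4|exact: q1].
  + move=> j jN ->; rewrite /cur xA -lf; exact: q1.
Qed.

Definition pop_cost x := (scan_cost x + 80 * LG + 120)%N.

(** Every alive vertex is extracted at most once, so the sum over those outside [X] pays for the
    remaining rounds. *)
Lemma poploop_run X st : dijkstra_env st -> dijkstra_inv (fun=> False) X st ->
  run w poploop st (\sum_(x <- A | x \notin X) pop_cost x + 10)
   (fun st' => exists X', dijkstra_inv (fun=> False) X' st' /\
      forall u, (u < n)%N -> rarr st' rTR (n + u)%N = 0).
Proof.
move=> E D.
have [/andP[n0 nNB] TN hN cN tN] := bounds.
pose I k st' := exists X', dijkstra_inv (fun=> False) X' st' /\
  (\sum_(x <- A | x \notin X') pop_cost x + 10 <= k)%N.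
apply: (@run_while_frame _ _ _ _ I); last by exists X.
- by move=> k st' _ _ /=; oks NB1 NBw.
- move=> k st' F [X' [D' le]] /=; rewrite -ltNge => root.
  have E' := dijkstra_env_frame F isT isT isT E.
  have /run_frame[k1 [st1 [e1 le1 [[x [xA xX ex D1]] F1]]]] := pop_run E' D' root.
  have E1 := dijkstra_env_frame F1 isT isT isT E'.
  have [k2 [st2 [e2 le2 D2]]] := scan_run E1 D1 ex (An xA).
  exists (80 * LG + 80 + scan_cost x).+1, (\sum_(x0 <- A | x0 \notin x :: X') pop_cost x0 + 10)%N.
  split.
    exists (k1 + k2).+1, st2; split; [by apply: ExSeq e1 e2|by lia|].
    exists (x :: X'); split=> //; apply: dijkstra_inv_Ex D2 _ _ => [|j jl jN jA [ej nj]]; first by right.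
    by move: nj; rewrite -ej adjU.
  apply: leq_trans le; rewrite [X in (_ < X + _)%N]big_mkcond (bigD1_seq x) //= xX -big_mkcondr.
  have -> : (\sum_(i <- A | (i != x) && (i \notin X')) pop_cost i =
            \sum_(x0 <- A | x0 \notin x :: X') pop_cost x0)%N.
    by apply: eq_bigl => i; rewrite inE negb_or.
  by rewrite /pop_cost /=; lia.
- move=> k st' F [X' [D' le]] /=; rewrite negbK => root; split; first by lia.
  exists X'; split=> // u un.
  have [//|[uA e]] := di_leaf D' un; apply/eqP; rewrite eq_le.
  have /= hr := @tree_root R n (rarr st' rTR) (n + u)%N (di_tree D').
  by rewrite (le_trans (hr _) root) ?e ?(di_ge D') //; lia.
Qed.

Variables (l : nat) (S0 : nat -> nat).
Hypothesis lNB : (l <= NB)%N.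
Hypothesis lt_neq : l != t.
Hypothesis A_def : A = [seq AL (t * n + i)%N | i <- iota 0 (CN t)].
Hypothesis CNn : (CN t <= n)%N.
Definition marked (B : seq nat) y : nat :=
  if y \in [seq (t * n + v)%N | v <- B] then 1%N else S0 y.
Hypothesis S1_def : S1 = marked A.
Hypothesis PlE : forall v, v \in A -> Pl v = P0 (l * n + v)%N.
Hypothesis Pl0 : forall v, v \in A -> 0 <= Pl v.
Hypothesis ValP : forall v, v \in A -> Val v (Pl v).

Definition mark_cost := (40 * LG + 80)%N.

Lemma marked_rcons B v y :
  marked (rcons B v) y = if y == (t * n + v)%N then 1%N else marked B y.
Proof. by rewrite /marked map_rcons mem_rcons inE; case: eqP. Qed.

Lemma sizeA : size A = CN t.
Proof. by rewrite A_def size_map size_iota. Qed.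

Lemma nthA i : (i < CN t)%N -> AL (t * n + i)%N = nth 0%N A i.
Proof. by move=> lt; rewrite A_def (nth_map 0%N) ?size_iota // nth_iota. Qed.

Lemma mark_run st : dijkstra_envS S0 st -> ivar st vl = l -> rarr st rP = P0 ->
  tree_ok n (rarr st rTR) -> (forall u, (u < n)%N -> rarr st rTR (n + u)%N = 0) ->
  run w mark st (mark_cost * size A + 20) (fun st' => dijkstra_env st' /\
    dijkstra_inv (fun j => EU j \notin A) [::] st').
Proof.
move=> E el eP tok leaf0.
have [/andP[n0 nNB] TN hN cN tN] := bounds; have [limN NEN hL nL] := bounds2.
apply: (@run_loop_free_seq _ _ _ _ _ (mark_cost * size A + 10)) => //=; last by lia.
  by words NB1 NBw.
set st1 := set_ivar _ _ _; have E1 : dijkstra_envS S0 st1 by case: E => *; split.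
pose I k st' := exists i, [/\ ivar st' va = i, (i <= size A)%N, iarr st' aS = marked (take i A),
   (mark_cost * (size A - i) + 10 <= k)%N &
   [/\ forall x, (forall v, v \in A -> x <> t * n + v)%N -> rarr st' rP x = P0 x,
     forall v, v \in take i A -> rarr st' rP (t * n + v)%N = Pl v,
     tree_ok n (rarr st' rTR) &
     forall u, (u < n)%N -> rarr st' rTR (n + u)%N = if u \in take i A then Pl u else 0]].
apply: (@run_while_frame _ _ _ _ I).
- by move=> k st' F _ /=.
- move=> k st' F [i [ei iA eS le [out inn tok' leaf]]].
  have eCN : iarr st' aCN = CN by rewrite (frame_ia F) // (env_CN E1).
  have et : ivar st' vt = t by rewrite (frame_iv F) // (env_t E1).
  have en : ivar st' vn = n by rewrite (frame_iv F) // (env_n E1).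
  have el' : ivar st' vl = l by rewrite (frame_iv F).
  have eAL : iarr st' aAL = AL by rewrite (frame_ia F) // (env_AL E1).
  rewrite /= ei et eCN -ltnNge => iCN; set v := nth 0%N A i.
  have iA' : (i < size A)%N by rewrite sizeA.
  have vA : v \in A by rewrite mem_nth.
  have vn := An vA.
  have tk : take i.+1 A = rcons (take i A) v by rewrite -take_nth.
  exists (40 * LG + 70)%N, (mark_cost * (size A - i.+1) + 10)%N; split; last first.
    move: le; have -> : (size A - i = (size A - i.+1).+1)%N by lia.
    by rewrite mulnS {1}/mark_cost /=; lia.
  apply: (@run_loop_free_seq _ _ _ _ _ (40 * LG + 60)) => //=; last by lia.
    by rewrite et en ei; oks NB1 NBw.
  rewrite et en ei eAL nthA // -/v.
  apply: (@run_loop_free_seq _ _ _ _ _ (40 * LG + 50)) => //=; last by lia.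
    by rewrite et en; oks NB1 NBw.
  rewrite et en.
  apply: (@run_loop_free_seq _ _ _ _ _ (40 * LG + 40)) => //=; last by lia.
    by rewrite el' en; oks NB1 NBw.
  rewrite el' en.
  apply: (@run_loop_free_seq _ _ _ _ _ (40 * LG + 30)) => //=; last by lia.
    by rewrite et en; oks NB1 NBw.
  (* Row [l] differs from row [t], so it still holds the old values. *)
  rewrite et en out ?PlE; last first.
    by move=> u uA /(idx_inj vn (An uA))[lt _]; move: lt_neq; rewrite lt eqxx.
  rewrite -PlE //; set st2 := set_rarr _ _ _ _.
  have Tr := @treeset_run R w NB NB1 NBw st2 n v LG.
  apply: (run_seq_frame (k2 := 5)); [apply: Tr => //=; lia| |lia].
  move=> st3 [tok3 leaf3] F3.
  apply: run_loop_free => //=; first by rewrite (frame_iv F3) //= ei; oks NB1 NBw.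
  exists i.+1; split=> //=.
  + by rewrite (frame_iv F3) //= ei addn1.
  + by rewrite (frame_ia F3) //= eS tk; apply/funext => y; rewrite marked_rcons.
  + rewrite (frame_ra F3) //= tk; split=> //.
    * move=> x xA; case: eqP => [e|_]; last exact: out.
      by case: (xA v vA).
    * move=> u; rewrite mem_rcons inE => /orP[/eqP ->|uA]; first by rewrite eqxx.
      have uA' := mem_take uA; rewrite idx_eq ?An // eqxx /=.
      by case: eqP => [->//|_]; exact: inn.
    * move=> u un; rewrite leaf3 //= mem_rcons inE; case: eqP => [->//|_]; exact: leaf.
- move=> k st' F [i [ei iA eS le [out inn tok' leaf]]].
  rewrite /= ei (frame_ia F) // (frame_iv F) // (env_t E1) (env_CN E1) negbK => CNi.
  have iz : i = size A by apply/eqP; rewrite eqn_leq iA sizeA.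
  move: eS inn leaf; rewrite iz take_size -S1_def => eS inn leaf.
  split; first by lia.
  split.
    case: E1 => e1 e2 e3 e4 e5 e6 e7 e8 e9 e10 e11 e12 e13 e14; split=> //;
      by rewrite ?(frame_iv F) ?(frame_ia F) ?(frame_ra F).
  split=> //.
  + move=> u un; rewrite leaf //; case: ifP => uA; last by left.
    by right; split=> //; rewrite inn.
  + by move=> v vA; rewrite inn // Pl0.
  + by move=> v vA; rewrite inn // ; exact: ValP.
  + by move=> v vA; rewrite inn.
  (* An alive tail is queued, or its value is 0, an infinite distance, and the edge holds trivially.
     Only edges with dead tails remain as exceptions. *)
  + move=> j jl jN jA; case: (boolP (EU j \in A)) => uA; last by right; right.
    rewrite leaf ?EUn // uA /cur uA !inn //.
    have [h0|h0] := ltP 0 (Pl (EU j)); first by right; left.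
    by left; have := EW0 jN; have := Pl0 jA; lra.
- exists 0%N; rewrite take0; split=> //=; first by rewrite (env_S E).
    by rewrite subn0.
  by rewrite eP.
Qed.

(** The exceptions that matter lead from dead tails to alive heads. Each of them is in the list of
    its head, so scanning all alive vertices settles it. *)
Lemma initscan_run st : dijkstra_env st -> dijkstra_inv (fun j => EU j \notin A) [::] st ->
  run w initscan st (\sum_(x <- A) (scan_cost x + 40) + 20) (fun st' => dijkstra_env st' /\
    dijkstra_inv (fun=> False) [::] st').
Proof.
move=> E D.
have [/andP[n0 nNB] TN hN cN tN] := bounds; have [limN NEN hL nL] := bounds2.
apply: (@run_loop_free_seq _ _ _ _ _ (\sum_(x <- A) (scan_cost x + 40) + 10)) => //=; last by lia.
  by words NB1 NBw.
set st1 := set_ivar _ _ _; have E1 : dijkstra_env st1 by case: E => *; split.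
have D1 : dijkstra_inv (fun j => EU j \notin A) [::] st1 by apply: dijkstra_inv_ext D _ _.
pose I k st' := exists i, [/\ ivar st' va = i, (i <= size A)%N,
   dijkstra_inv (fun j => EU j \notin A /\ EV j \notin take i A) [::] st' &
   (\sum_(x <- drop i A) (scan_cost x + 40) + 10 <= k)%N].
apply: (@run_while_frame _ _ _ _ I).
- by move=> k st' F _ /=.
- move=> k st' F [i [ei iA D' le]].
  have E' := dijkstra_env_frame F isT isT isT E1.
  rewrite /= ei (env_t E') (env_CN E') -ltnNge => iCN; set v := nth 0%N A i.
  have iA' : (i < size A)%N by rewrite sizeA.
  have vA : v \in A by rewrite mem_nth.
  have tk : take i.+1 A = rcons (take i A) v by rewrite -take_nth.
  move: le; rewrite (drop_nth 0%N iA') big_cons -/v => le.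
  exists (scan_cost v + 20)%N, (\sum_(x <- drop i.+1 A) (scan_cost x + 40) + 10)%N; split; last by lia.
  apply: (@run_loop_free_seq _ _ _ _ _ (scan_cost v + 10)) => //=; last by lia.
    by rewrite ei (env_t E') (env_n E'); oks NB1 NBw.
  rewrite ei (env_t E') (env_n E') (env_AL E') nthA // -/v; set st2 := set_ivar _ _ _.
  have E2 : dijkstra_env st2 by case: E' => *; split.
  have D2 : dijkstra_inv (fun j => EU j \notin A /\ EV j \notin take i A) [::] st2 by apply: dijkstra_inv_ext D' _ _.
  apply: (run_seq_frame (scan_run E2 D2 erefl (An vA)) (k2 := 5)); last by rewrite /=; lia.
  move=> st3 D3 F3; apply: run_loop_free => //=; first by rewrite (frame_iv F3) //= ei; oks NB1 NBw.
  exists i.+1; split=> //=; first by rewrite (frame_iv F3) //= ei addn1.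
  apply: (@dijkstra_inv_Ex (fun j => (EU j \notin A /\ EV j \notin take i A) /\ j \notin adj v)).
  + by apply: dijkstra_inv_ext D3 _ _.
  + by left.
  + move=> j _ jN jA [[h1 h2] h3]; left; split=> //.
    rewrite tk mem_rcons inE negb_or h2 andbT; apply/eqP => ev.
    by move: h3; rewrite -ev adjV.
- move=> k st' F [i [ei iA D' le]].
  have E' := dijkstra_env_frame F isT isT isT E1.
  rewrite /= ei (env_t E') (env_CN E') negbK => CNi.
  have iz : i = size A by apply/eqP; rewrite eqn_leq iA sizeA.
  split; first by lia.
  split=> //; apply: dijkstra_inv_Ex D' _ _ => [|j _ _ jA [_]]; first by left.
  by rewrite iz take_size jA.
- exists 0%N; split=> //=; last by rewrite drop0.
  by apply: dijkstra_inv_Ex D1 _ _ => [|j _ _ _ uA]; left; rewrite ?take0.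
Qed.

(** Each incidence is scanned twice, by [initscan] and after the extraction: the coefficient is 2 *
    ([relax_cost] + 40). *)
Definition dijkstra_cost := ((160 * LG + 480) * \sum_(x <- A) (size (adj x)).+1 + 100)%N.

Lemma dijkstra_run st : dijkstra_envS S0 (set_ivar st vlim lim) -> ivar st vl = l ->
  (ivar st vB + (t - c))%N = lim -> (c <= t)%N -> (ivar st vB <= NB)%N -> rarr st rP = P0 ->
  tree_ok n (rarr st rTR) -> (forall u, (u < n)%N -> rarr st rTR (n + u)%N = 0) ->
  run w dijkstra st dijkstra_cost (fun st' =>
    [/\ iarr st' aS = S1, dijkstra_inv (fun=> False) [::] st',
     forall u, (u < n)%N -> rarr st' rTR (n + u)%N = 0 &
     forall j, (j < lim)%N -> (j < NE)%N -> EV j \in A ->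
       cur (rarr st' rP) (EU j) - EW j <= rarr st' rP (t * n + EV j)%N]).
Proof.
move=> E el elim ct Bn eP tok leaf0.
have [/andP[n0 nNB] TN hN cN tN] := bounds; have [limN NEN hL nL] := bounds2.
set K1 := (mark_cost * size A + 20)%N; set K2 := (\sum_(x <- A) (scan_cost x + 40) + 20)%N.
set K3 := (\sum_(x <- A) pop_cost x + 10)%N.
apply: (@run_loop_free_seq _ _ _ _ _ (K1 + K2 + K3 + 10)) => //.
- have [_ _ _ ec et _ _ _ _ _ _ _ _ _] := E.
  by rewrite /= in ec et; rewrite /= ec et; oks NB1 NBw.
- have -> : final_state (vlim ::= $vB + ($vt - $vc))%prog st = set_ivar st vlim lim.
    have [_ _ _ ec et _ _ _ _ _ _ _ _ _] := E.
    by rewrite /= in ec et; rewrite /= ec et elim.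
  apply: (run_seq (k1 := K1) (k2 := K2 + K3 + 5)); last by lia.
  apply: run_weaken (mark_run E _ _ _ _) _ _ => // st1 [E1 D1].
  apply: (run_seq_frame (initscan_run E1 D1) (k2 := K3)); last by rewrite /K2; lia.
  move=> st2 [E2 D2] _.
  apply: run_weaken (run_frame (poploop_run E2 D2)) _ _.
    by rewrite /K3; under eq_bigl => x do rewrite in_nil /=.
  move=> st3 [[X [D3 z]] F3]; split=> //.
  + by rewrite (frame_ia F3) // (env_S E2).
  + by case: D3 => h1 h2 h3 h4 h5 h6 h7 h8; split.
  + move=> j jl jN jA; have [//|[]] := di_edge D3 jl jN jA; last by [].
    by rewrite z ?EUn // ltxx.
- rewrite /dijkstra_cost /K1 /K2 /K3 /=.
  have -> : (mark_cost * size A = \sum_(x <- A) mark_cost)%N by rewrite big_const_seq count_predT iter_addn_0.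
  have : (\sum_(x <- A) mark_cost + \sum_(x <- A) (scan_cost x + 40) + \sum_(x <- A) pop_cost x <=
          (160 * LG + 480) * \sum_(x <- A) (size (adj x)).+1)%N.
    rewrite -!big_split /= big_distrr /=; apply: leq_sum => x _.
    by rewrite /mark_cost /pop_cost /scan_cost /relax_cost; nia.
  by lia.
Qed.

End Dijkstra.

(** * Stored values *)

Section NextTime.
Variables (c h : nat).

Definition midtime k q := (c + q * 2 ^ k.+1 + 2 ^ k)%N.
(** The midpoint of the interval of length 2 ^ k.+1 that contains the interval number [q] of length
    2 ^ k, counting from 0. *)
Definition parenttime k q := (c + (2 * (q %/ 2) + 1) * 2 ^ k)%N.

(** A vertex that is alive at a midpoint is alive at the midpoint of the parent
    interval; the parent of the topmost interval is the end of the chunk. *)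
Definition closedS (S : nat -> bool) := forall k q, (k < h)%N -> (q < 2 ^ (h - k.+1))%N ->
  S (midtime k q) -> S (parenttime k.+1 q) \/ parenttime k.+1 q = (c + 2 ^ h)%N.

Definition isnext (S : nat -> bool) T t x :=
  [/\ (t <= x <= T)%N, x = T \/ S x & forall y, (t <= y < x)%N -> S y = false].

(** Serves to compare searches in different states: it suffices that the old result meets the
    specification of the new search. *)
Lemma isnext_uniq S T t x y : isnext S T t x -> isnext S T t y -> x = y.
Proof.
move=> [/andP[tx xT] xs xm] [/andP[ty yT] ys ym].
have [lt|lt|//] := ltngtP x y.
  have := ym x; rewrite tx lt => /(_ isT); case: xs => [xe|-> //].
  by move: lt; rewrite xe ltnNge yT.
have := xm y; rewrite ty lt => /(_ isT); case: ys => [ye|-> //].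
by move: lt; rewrite ye ltnNge xT.
Qed.

Lemma parenttime_mid k q b : parenttime k.+1 (2 * q + (b : bool))%N = midtime k.+1 q.
Proof.
rewrite /parenttime /midtime.
have -> : ((2 * q + b) %/ 2 = q)%N by case: b; lia.
by rewrite (expnS 2 k.+1); lia.
Qed.

Lemma closed_empty S : closedS S -> forall k q, (k < h)%N -> (q < 2 ^ (h - k.+1))%N ->
  S (midtime k q) = false ->
  forall t, (c + q * 2 ^ k.+1 < t < c + q.+1 * 2 ^ k.+1)%N -> S t = false.
Proof.
move=> cl; elim=> [|k IH] q kh qh Sm t /andP[lt tr].
  have -> : t = midtime 0 q by rewrite /midtime; lia.
  exact: Sm.
have e2 : (2 ^ k.+2 = 2 * 2 ^ k.+1)%N by rewrite expnS.
have e1 : (2 ^ (h - k.+1) = 2 * 2 ^ (h - k.+2))%N by rewrite -expnS; congr (_ ^ _)%N; lia.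
have em : (midtime k.+1 q = c + (2 * q + 1) * 2 ^ k.+1)%N by rewrite /midtime e2; nia.
(* A midpoint lies strictly inside the chunk, so the exceptional case of [closedS] does not
   arise. *)
have emT : midtime k.+1 q <> (c + 2 ^ h)%N.
  have : (2 ^ h = 2 ^ k.+2 * 2 ^ (h - k.+2))%N by rewrite -expnD; congr (_ ^ _)%N; lia.
  have : (0 < 2 ^ k.+1)%N by rewrite expn_gt0.
  by rewrite em e2; nia.
have [tm|tm|->//] := ltngtP t (midtime k.+1 q).
  apply: (IH (2 * q + false)%N) => //; try lia.
  by apply/negP => /cl[]; rewrite ?parenttime_mid ?Sm //; lia.
apply: (IH (2 * q + true)%N) => //; try lia.
by apply/negP => /cl[]; rewrite ?parenttime_mid ?Sm //; lia.
Qed.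

Lemma next_stored_none S k r t : (forall y, (t <= y < r)%N -> S y = false) -> next_stored S k r t = r.
Proof.
elim: k => //= k IH H; case: ifP => [/andP[le]|_]; last exact: IH.
by have p0 : (0 < 2 ^ k)%N; [rewrite expn_gt0|rewrite H; [|lia]].
Qed.

(** If the midpoint is before [t], only the right half matters. If it is stored and not before [t],
    the answer lies in the left half. If it is not stored, the interior is empty by [closed_empty]
    and the answer is the right end. *)
Lemma next_stored_isnext S : closedS S -> forall k q t, (k <= h)%N -> (q < 2 ^ (h - k))%N ->
  (c + q * 2 ^ k < t <= c + q.+1 * 2 ^ k)%N ->
  isnext S (c + q.+1 * 2 ^ k) t (next_stored S k (c + q.+1 * 2 ^ k) t).
Proof.
move=> cl; elim=> [|k IH] q t kh qh /andP[lt tr].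
  rewrite /= expn0 muln1; split; [lia|by left|by move=> y; move: lt; rewrite expn0; lia].
have e2 : (2 ^ k.+1 = 2 * 2 ^ k)%N by rewrite expnS.
have e1 : (2 ^ (h - k) = 2 * 2 ^ (h - k.+1))%N by rewrite -expnS; congr (_ ^ _)%N; lia.
have p0 : (0 < 2 ^ k)%N by rewrite expn_gt0.
set r := (c + q.+1 * 2 ^ k.+1)%N.
have em : (r - 2 ^ k = midtime k q)%N by rewrite /r /midtime e2; nia.
have em2 : (midtime k q = c + (2 * q).+1 * 2 ^ k)%N by rewrite /midtime e2; nia.
have er : (r = c + (2 * q).+2 * 2 ^ k)%N by rewrite /r e2; nia.
have mr : (midtime k q <= r)%N by rewrite em2 er; nia.
rewrite /= em; have [tm|tm] := leqP t (midtime k q); last first.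
  rewrite ifF; last by apply/negbTE; rewrite negb_and; apply/orP; left; lia.
  by rewrite er; apply: (IH (2 * q).+1); lia.
have -> /= : (t + 2 ^ k <= r)%N by lia.
case: ifP => Sm.
  have [||/andP[h1 h2] h3 h4] := IH (2 * q)%N t (ltnW kh); [lia|lia|].
  rewrite -em2 in h1 h2 h3 h4 *; split=> //; first by rewrite h1 (leq_trans h2).
  by case: h3 => [->|]; right.
have H : forall y, (t <= y < r)%N -> S y = false.
  by move=> y /andP[ty yr]; apply: (closed_empty cl kh qh Sm); rewrite -/r yr andbT; lia.
rewrite next_stored_none //; split; [by rewrite leqnn tr|by left|exact: H].
Qed.

Lemma next_stored_ext S S' k r t : (forall y, (t <= y < r)%N -> S y = S' y) ->
  next_stored S k r t = next_stored S' k r t.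
Proof.
elim: k r => //= k IH r H; have p0 : (0 < 2 ^ k)%N by rewrite expn_gt0.
case: (boolP (t + 2 ^ k <= r)%N) => [le|_] /=; last exact: IH.
rewrite H; last by lia.
by case: ifP => _; apply: IH => y yr; apply: H; lia.
Qed.

Lemma next_stored_chunk S t : closedS S -> (c < t <= c + 2 ^ h)%N ->
  isnext S (c + 2 ^ h) t (next_stored S h (c + 2 ^ h) t).
Proof.
move=> cl ht; have := @next_stored_isnext S cl h 0 t; rewrite subnn mul1n mul0n addn0; exact.
Qed.

End NextTime.

(** Chunks are open on the left, so a boundary time is its own chunk end and its value is read
    directly from its row. *)
Definition chunk_end h t := ((t + 2 ^ h - 1) %/ 2 ^ h * 2 ^ h)%N.

Lemma chunk_end_in h j t : (j * 2 ^ h < t <= j.+1 * 2 ^ h)%N -> chunk_end h t = (j * 2 ^ h + 2 ^ h)%N.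
Proof.
move=> /andP[lt le]; rewrite /chunk_end; have p0 : (0 < 2 ^ h)%N by rewrite expn_gt0.
have -> : (t + 2 ^ h - 1 = j.+1 * 2 ^ h + (t - (j * 2 ^ h) - 1))%N by move: lt le; rewrite mulSn; lia.
rewrite divnMDl // divn_small; last by move: lt le; rewrite mulSn; lia.
by rewrite addn0 mulSn addnC.
Qed.

Lemma chunk_end_mul h j : chunk_end h (j * 2 ^ h) = (j * 2 ^ h)%N.
Proof.
rewrite /chunk_end; have p0 : (0 < 2 ^ h)%N by rewrite expn_gt0.
by rewrite -addnBA // divnMDl // divn_small ?addn0; lia.
Qed.

Lemma chunk_end_ge h t : (t <= chunk_end h t)%N.
Proof.
rewrite /chunk_end; have p0 : (0 < 2 ^ h)%N by rewrite expn_gt0.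
have := divn_eq (t + 2 ^ h - 1) (2 ^ h); have := ltn_pmod (t + 2 ^ h - 1) p0; lia.
Qed.

Definition stored_val {R : realType} h n (S : nat -> nat) (P : nat -> R) t v : R :=
  P (next_stored (fun x => 0 < S (x * n + v)%N)%N h (chunk_end h t) t * n + v)%N.

Lemma stored_val_mul {R : realType} h n S (P : nat -> R) j v :
  stored_val h n S P (j * 2 ^ h) v = P (j * 2 ^ h * n + v)%N.
Proof. by rewrite /stored_val chunk_end_mul next_stored_none // => y; lia. Qed.

(** * Approximate feasible potentials *)

Section Good.
Context {R : realType}.
Variables (n m s : nat) (INF : R) (U V : nat -> nat) (Wt : nat -> R).
Variable pth : nat -> nat -> R -> Prop.
Hypothesis sn : (s < n)%N.
Hypothesis Un : forall i, (i < m)%N -> (U i < n)%N.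
Hypothesis Vn : forall i, (i < m)%N -> (V i < n)%N.
Hypothesis W1 : forall i, (i < m)%N -> 1 <= Wt i.
Hypothesis pth_s : forall t, pth t s 0.
Hypothesis pth_edge : forall t i x, (i < t)%N -> (i < m)%N -> pth t (U i) x -> pth t (V i) (x + Wt i).
Hypothesis pth_mono : forall t t' v x y, (t <= t')%N -> x <= y -> pth t v x -> pth t' v y.

(** [D] is a feasible potential of [G_t] and approximates the distances within the
    factor [b]; [INF] stands for unreachable, and [pth t v x] for a path to [v] in
    [G_t] of length at most [x]. *)
Record good t b (D : nat -> R) : Prop := Good {
  g_s : D s = 0;
  g_edge : forall i, (i < t)%N -> (i < m)%N -> D (V i) <= D (U i) + Wt i;
  g_1 : forall v, (v < n)%N -> v != s -> 1 <= D v;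
  g_0 : forall v, (v < n)%N -> 0 <= D v;
  g_inf : forall v, (v < n)%N -> D v <= INF;
  g_pth : forall v, (v < n)%N -> INF <= b * D v \/ pth t v (b * D v) }.

(** [low] is a feasible potential for [G_t] that the new distances must not undercut. *)
Definition valid_val t b (low : nat -> R) v x : Prop :=
  [/\ v != s -> 1 <= INF - x, low v <= INF - x &
      INF <= b * (INF - x) \/ pth t v (b * (INF - x))].

(** The factor survives because b * (d + w) >= b * d + w for b >= 1: the added edge itself carries
    no error. *)
Lemma valid_val_edge t b low i x w : (i < t)%N -> (i < m)%N -> 1 <= b -> w = Wt i ->
  0 <= low (U i) -> low (V i) <= low (U i) + Wt i ->
  valid_val t b low (U i) x -> valid_val t b low (V i) (x - w).
Proof.
move=> it im b1 -> l0 le [h1 h2 h3]; have w1 := W1 im; split.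
- by move=> _; lra.
- by lra.
- have e : INF - (x - Wt i) = (INF - x) + Wt i by lra.
  rewrite e mulrDr; have bw : Wt i <= b * Wt i by rewrite ler_peMl //; lra.
  case: h3 => h3; [left; lra|right].
  by apply: (pth_mono (leqnn t) _ (pth_edge it im h3)); lra.
Qed.

(** A path present at time [l] is still there at time [t], so the old estimate justifies every [d]
    that is large enough for the new factor. *)
Lemma valid_val_good l t b b' Dl low v d : (l <= t)%N -> good l b Dl -> (v < n)%N ->
  (v != s -> 1 <= d) -> low v <= d -> b * Dl v <= b' * d -> valid_val t b' low v (INF - d).
Proof.
move=> lt G vn d1 dl le; have e : INF - (INF - d) = d by lra.
rewrite /valid_val e; split=> //; have [h|h] := g_pth G vn; [left; lra|right].
exact: pth_mono lt le h.
Qed.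

Lemma good_valid_val t b low D : D s = 0 -> (forall v, (v < n)%N -> D v <= INF) ->
  (forall v, (v < n)%N -> 0 <= low v) ->
  (forall v, (v < n)%N -> valid_val t b low v (INF - D v)) ->
  (forall i, (i < t)%N -> (i < m)%N -> D (V i) <= D (U i) + Wt i) ->
  good t b D /\ forall v, (v < n)%N -> low v <= D v.
Proof.
move=> Ds Di l0 va ed; have e v : INF - (INF - D v) = D v by lra.
split=> [|v vn]; last by have [_] := va v vn; rewrite e.
split=> // v vn; have := va v vn; rewrite /valid_val e => -[h1 h2 h3] //.
by apply: le_trans h2; exact: l0.
Qed.

End Good.

Definition row_list (n : nat) (AL CN : nat -> nat) t := [seq AL (t * n + i)%N | i <- iota 0 (CN t)].

Lemma row_list_ext n AL CN AL' CN' t : CN' t = CN t ->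
  (forall i, (i < CN t)%N -> AL' (t * n + i)%N = AL (t * n + i)%N) ->
  row_list n AL' CN' t = row_list n AL CN t.
Proof.
move=> e H; rewrite /row_list e; apply/eq_in_map => i; rewrite mem_iota => hi; exact: H.
Qed.

Lemma size_row_list n AL CN t : size (row_list n AL CN t) = CN t.
Proof. by rewrite size_map size_iota. Qed.

Lemma nth_row_list n AL CN t i : (i < CN t)%N -> nth 0%N (row_list n AL CN t) i = AL (t * n + i)%N.
Proof. by move=> lt; rewrite (nth_map 0%N) ?size_iota // nth_iota. Qed.

(** * One level of the bisection *)

Section Filter.
Context {R : realType} (w NB : nat).
Hypothesis NB1 : (1 < NB)%N.
Hypothesis NBw : (8 * NB * NB < 2 ^ w)%N.
Implicit Types (st : state R).

(** Row [p] of the lists is read while row [t] is written, whence p != t. *)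
Lemma filter_run st n t p l r :
  ivar st vn = n -> ivar st vt = t -> ivar st vpm = p -> ivar st vl = l -> ivar st vrt = r ->
  (n <= NB)%N -> (t <= NB)%N -> (p <= NB)%N -> (l <= NB)%N -> (r <= NB)%N -> p != t ->
  (iarr st aCN p <= n)%N ->
  (forall v, v \in row_list n (iarr st aAL) (iarr st aCN) p -> (v < n)%N) ->
  let L := row_list n (iarr st aAL) (iarr st aCN) p in
  let f v := ~~ (rvar st xinf - rarr st rP (l * n + v)%N <=
                 rvar st xdel * (rvar st xinf - rarr st rP (r * n + v)%N)) in
  run w filterlist st (70 * size L + 40) (fun st' =>
    [/\ iarr st' aCN = upd (iarr st aCN) t (size (seq.filter f L)),
      row_list n (iarr st' aAL) (iarr st' aCN) t = seq.filter f L &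
      forall y, (forall i, (i < n)%N -> y <> t * n + i)%N -> iarr st' aAL y = iarr st aAL y]).
Proof.
move=> en et ep el er nN tN pN lN rN pt cn Ln L f.
apply: (@run_loop_free_seq _ _ _ _ _ (70 * size L + 30)) => //=; last by lia.
  by words NB1 NBw.
apply: (@run_loop_free_seq _ _ _ _ _ (70 * size L + 25)) => //=; last by lia.
  by words NB1 NBw.
set st1 := set_ivar _ _ _.
pose I k st' := exists i, [/\ ivar st' va = i, (i <= size L)%N,
   ivar st' vna = size (seq.filter f (take i L)), (70 * (size L - i) + 10 <= k)%N &
   (forall j, (j < size (seq.filter f (take i L)))%N ->
      iarr st' aAL (t * n + j)%N = nth 0%N (seq.filter f (take i L)) j) /\
   forall y, (forall i, (i < n)%N -> y <> t * n + i)%N -> iarr st' aAL y = iarr st aAL y].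
pose Q st' := [/\ frame (While (BNot (IGet aCN $vpm <=i $va)) filterb)%prog st1 st',
   ivar st' vna = size (seq.filter f L),
   forall j, (j < size (seq.filter f L))%N -> iarr st' aAL (t * n + j)%N = nth 0%N (seq.filter f L) j &
   forall y, (forall i, (i < n)%N -> y <> t * n + i)%N -> iarr st' aAL y = iarr st aAL y].
have szL : size L = iarr st aCN p by rewrite size_row_list.
have szf i : (size (seq.filter f (take i L)) <= n)%N.
  rewrite size_filter; apply: leq_trans (count_size _ _) _.
  by rewrite size_take_min; lia.
have rl : run w (While (BNot (IGet aCN $vpm <=i $va)) filterb)%prog st1 (70 * size L + 10) Q.
  apply: (run_weaken (k := 70 * size L + 10) (Q := fun st' => [/\
   ivar st' vna = size (seq.filter f L),
   forall j, (j < size (seq.filter f L))%N -> iarr st' aAL (t * n + j)%N = nth 0%N (seq.filter f L) j &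
   forall y, (forall i, (i < n)%N -> y <> t * n + i)%N -> iarr st' aAL y = iarr st aAL y] /\
   frame (While (BNot (IGet aCN $vpm <=i $va)) filterb)%prog st1 st')) => //; last first.
    by move=> st' [[? ? ?] ?]; split.
  apply: run_frame.
  apply: (@run_while_frame _ _ _ _ I).
  - by [].
  - move=> k st' F [i [ei iL ena le [inn out]]].
    rewrite /= ei (frame_iv F) // (frame_ia F) //= ep -szL -ltnNge => iL'.
    set v := nth 0%N L i; have vL : v \in L by rewrite mem_nth.
    have vltn := Ln v vL.
    have tk : take i.+1 L = rcons (take i L) v by rewrite -take_nth.
    have [e1 e2 e3] : [/\ ivar st' vn = n, ivar st' vt = t & ivar st' vpm = p].
      by split; rewrite (frame_iv F).
    have [e4 e5] : ivar st' vl = l /\ ivar st' vrt = r by split; rewrite (frame_iv F).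
    have e6 : rarr st' rP = rarr st rP by rewrite (frame_ra F).
    have [e7 e8] : rvar st' xinf = rvar st xinf /\ rvar st' xdel = rvar st xdel.
      by split; rewrite (frame_rv F).
    have ev : iarr st' aAL (p * n + i)%N = v.
      rewrite out; last first.
        move=> j jn e; have iN : (i < n)%N by lia.
        by have [pe _] := idx_inj iN jn e; move: pt; rewrite pe eqxx.
      by rewrite /v nth_row_list // -szL.
    exists 62, (70 * (size L - i.+1) + 10)%N; split; last first.
      move: le; have -> : (size L - i = (size L - i.+1).+1)%N by lia.
      by rewrite mulnS /=; lia.
    have fv : seq.filter f (take i.+1 L) = if f v then rcons (seq.filter f (take i L)) v else seq.filter f (take i L).
      by rewrite tk filter_rcons.
    have szf' := szf i.
    have szf2 := szf i.+1.
    apply: (@run_loop_free_seq _ _ _ _ _ 53) => //=.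
      by rewrite e1 e3 ei; oks NB1 NBw.
    rewrite e1 e3 ei ev; set st2 := set_ivar _ _ _.
    apply: (@run_seq _ _ _ _ _ 45 6) => //.
    have fE : f v = ~~ (rvar st' xinf - rarr st' rP (l * n + v)%N <=
              rvar st' xdel * (rvar st' xinf - rarr st' rP (r * n + v)%N)).
      by rewrite e6 e7 e8.
    apply: (@run_if _ _ _ _ _ _ _ 18) => //.
    + by rewrite /= e4 e5 e1; oks NB1 NBw.
    + rewrite /= e4 e5 e1 -fE => fvt; rewrite fvt in fv.
      have lt : (size (seq.filter f (take i L)) < n)%N by move: szf2; rewrite fv size_rcons.
      apply: run_loop_free => //=; first by rewrite e1 e2 ena; oks NB1 NBw.
      apply: run_loop_free => //=; first by rewrite ei; oks NB1 NBw.
      exists i.+1; split=> //=; first by rewrite ei addn1.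
        by rewrite fv size_rcons ena addn1.
      rewrite e1 e2 ena fv; split.
        move=> j; rewrite size_rcons nth_rcons ltnS leq_eqVlt eqn_add2l.
        by case: eqP => [->|_] /=; [rewrite ltnn|move=> jl; rewrite jl inn].
      move=> y yn; case: eqP => [e|_]; last exact: out.
      by case: (yn _ lt).
    + rewrite /= e4 e5 e1 -fE => fvt; rewrite (negbTE fvt) in fv.
      apply: run_loop_free => //=.
      apply: run_loop_free => //=; first by rewrite ei; oks NB1 NBw.
      exists i.+1; split=> //=; first by rewrite ei addn1.
        by rewrite fv.
      by rewrite fv.
  - move=> k st' F [i [ei iL ena le [inn out]]].
    rewrite /= ei (frame_iv F) // (frame_ia F) //= ep -szL negbK => iL'.
    have ie : i = size L by lia.
    by move: ena inn; rewrite ie take_size => ena inn; split; [lia|].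
  - by exists 0%N; rewrite take0; split=> //=; rewrite subn0.
apply: (run_seq (k1 := 70 * size L + 10) (k2 := 5)); last by lia.
apply: run_weaken rl _ _ => // st2 [F ena inn out].
have [e1 e2] : ivar st2 vt = t /\ iarr st2 aCN = iarr st aCN.
  by rewrite (frame_iv F) // (frame_ia F).
apply: run_loop_free => //=; rewrite e1 e2 ena; split=> //.
rewrite /row_list /= eqxx; apply: (@eq_from_nth _ 0%N); first by rewrite size_map size_iota.
move=> i; rewrite size_map size_iota => hi.
by rewrite (nth_map 0%N) ?size_iota // nth_iota // inn.
Qed.

End Filter.

Lemma next_stored_ge S k r t : (t <= r)%N -> (t <= next_stored S k r t)%N.
Proof.
elim: k r => //= k IH r tr; case: ifP => [/andP[le _]|_]; last exact: IH.
by apply: IH; have p0 : (0 < 2 ^ k)%N; [rewrite expn_gt0|lia].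
Qed.

Lemma chunk_end_le h j t : (t <= j * 2 ^ h)%N -> (chunk_end h t <= j * 2 ^ h)%N.
Proof.
move=> le; rewrite -[X in (_ <= X)%N](chunk_end_mul h j) /chunk_end leq_mul2r; apply/orP; right.
by apply: leq_div2r; lia.
Qed.

(** Uniqueness of the odd part: a time strictly inside a chunk is the midpoint of exactly one
    interval of the bisection. *)
Lemma odd_pow_inj a b i j : ((2 * a + 1) * 2 ^ i = (2 * b + 1) * 2 ^ j)%N -> i = j /\ a = b.
Proof.
wlog ij : a b i j / (i <= j)%N => [H e|].
  by have [/H/(_ e)//|/ltnW/H/(_ (esym e))[-> ->]] := leqP i j.
rewrite -(subnKC ij) expnD; case: (j - i)%N => [|d] e.
  by move/eqP: e; rewrite expn0 muln1 addn0 eqn_mul2r expn_eq0 /=; lia.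
have p0 : (0 < 2 ^ i)%N by rewrite expn_gt0.
move/eqP: e; rewrite [X in _ == X]mulnCA [X in X == _]mulnC eqn_pmul2l // expnS => /eqP; lia.
Qed.

Lemma mid_bounds c k q : (c + q * 2 ^ k.+1 < midtime c k q < c + q.+1 * 2 ^ k.+1)%N.
Proof. by have p0 : (0 < 2 ^ k)%N; [rewrite expn_gt0|rewrite /midtime expnS; lia]. Qed.

Lemma right_le h c k q : (k <= h)%N -> (q < 2 ^ (h - k))%N -> (c + q.+1 * 2 ^ k <= c + 2 ^ h)%N.
Proof. by move=> kh qh; rewrite leq_add2l -(subnK kh) expnD leq_mul2r qh orbT. Qed.

Lemma parent_le h c k q : (k <= h)%N -> (q < 2 ^ (h - k))%N -> (parenttime c k q <= c + 2 ^ h)%N.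
Proof.
move=> kh qh; rewrite /parenttime leq_add2l -(subnK kh) expnD leq_mul2r; apply/orP; right.
case: (h - k)%N qh => [|d]; first by rewrite expn0; lia.
by rewrite expnS; lia.
Qed.

Lemma parent_neq_mid c k q q' : parenttime c k.+1 q != midtime c k q'.
Proof.
apply/eqP; rewrite /parenttime /midtime => e.
have : ((2 * (q %/ 2) + 1) * 2 ^ k.+1 = (2 * q' + 1) * 2 ^ k)%N by move: e; rewrite expnS; lia.
by move/odd_pow_inj => [e1 _]; lia.
Qed.

Section Level.
Context {R : realType}.
Variables (n h j0 m s : nat) (INF od : R) (HL : seq nat).
Variables (U V : nat -> nat) (Wt : nat -> R) (pth : nat -> nat -> R -> Prop).
Hypothesis sn : (s < n)%N.
Hypothesis Un : forall i, (i < m)%N -> (U i < n)%N.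
Hypothesis Vn : forall i, (i < m)%N -> (V i < n)%N.
Hypothesis W1 : forall i, (i < m)%N -> 1 <= Wt i.
Hypothesis pth_edge : forall t i x, (i < t)%N -> (i < m)%N -> pth t (U i) x -> pth t (V i) (x + Wt i).
Hypothesis pth_mono : forall t t' v x y, (t <= t')%N -> x <= y -> pth t v x -> pth t' v y.
Hypothesis od1 : 1 <= od.
Hypothesis HLuniq : uniq HL.
Hypothesis HLn : forall v, v \in HL -> (v < n)%N /\ v != s.

Local Notation c := (j0 * 2 ^ h)%N.
Local Notation T := (c + 2 ^ h)%N.
Local Notation Good := (good n m s INF U V Wt pth).
Implicit Types (S AL CN : nat -> nat) (P : nat -> R).

Definition stored_dist S P t v := INF - stored_val h n S P t v.

(** What is known of the interval number [q] of length [2 ^ k] before it is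
    bisected: by [rd_dead] the vertices not in the list of the parent are dead, and by
    [rd_par] the listed ones were alive there. *)
Record ready S P AL CN k q : Prop := Ready {
  rd_dead : forall v, (v < n)%N -> v \notin row_list n AL CN (parenttime c k q) ->
    stored_dist S P (c + q * 2 ^ k) v <= od * stored_dist S P (c + q.+1 * 2 ^ k) v;
  rd_sub : {subset row_list n AL CN (parenttime c k q) <= HL};
  rd_l : forall v, v \in row_list n AL CN (parenttime c k q) ->
    stored_val h n S P (c + q * 2 ^ k) v = P ((c + q * 2 ^ k) * n + v)%N;
  rd_r : forall v, v \in row_list n AL CN (parenttime c k q) ->
    stored_val h n S P (c + q.+1 * 2 ^ k) v = P ((c + q.+1 * 2 ^ k) * n + v)%N;
  rd_ls : forall v, v \in row_list n AL CN (parenttime c k q) ->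
    q = 0%N \/ (0 < S ((c + q * 2 ^ k) * n + v))%N;
  rd_ps : forall v, v \in row_list n AL CN (parenttime c k q) ->
    parenttime c k q = T \/ (0 < S (parenttime c k q * n + v))%N;
  rd_uniq : uniq (row_list n AL CN (parenttime c k q));
  rd_gl : Good (c + q * 2 ^ k)%N (od ^+ (h - k)) (stored_dist S P (c + q * 2 ^ k));
  rd_gr : Good (c + q.+1 * 2 ^ k)%N (od ^+ (h - k)) (stored_dist S P (c + q.+1 * 2 ^ k));
  rd_mono : forall v, (v < n)%N ->
    stored_dist S P (c + q.+1 * 2 ^ k) v <= stored_dist S P (c + q * 2 ^ k) v;
  rd_par : forall v, v \in row_list n AL CN (parenttime c k q) -> k = h \/
    od * stored_dist S P (c + (q %/ 2).+1 * 2 ^ k.+1) v < stored_dist S P (c + (q %/ 2) * 2 ^ k.+1) v }.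

(** The state of a sweep that halves the intervals of length [2 ^ k.+1], the
    first [q] of which are done. *)
Record sweep_inv S P AL CN k q : Prop := Linv {
  li_hi : forall q', (q <= q')%N -> (q' < 2 ^ (h - k.+1))%N -> ready S P AL CN k.+1 q';
  li_lo : forall q', (q' < 2 * q)%N -> ready S P AL CN k q';
  li_clo : forall v, (v < n)%N -> closedS c h (fun x => 0 < S (x * n + v))%N;
  li_fresh : forall t v, (c < t < T)%N -> (v < n)%N -> (0 < S (t * n + v))%N ->
    (2 ^ k %| t - c)%N /\ ((2 ^ k.+1 %| t - c)%N \/ (t < c + q * 2 ^ k.+1)%N);
  li_HL : row_list n AL CN T = HL }.

(** An offset strictly between consecutive multiples of 2 ^ k.+1 is no such multiple, and the sweep
    has not come this far; [li_fresh] allows no other stored times. *)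
Lemma fresh_node S P AL CN k q t v : sweep_inv S P AL CN k q -> (k < h)%N -> (q < 2 ^ (h - k.+1))%N ->
  (c + q * 2 ^ k.+1 < t < c + q.+1 * 2 ^ k.+1)%N -> (v < n)%N -> (0 < S (t * n + v))%N = false.
Proof.
move=> L kh qh /andP[lt tr] vn; apply/negP => St.
have hT : (q.+1 * 2 ^ k.+1 <= 2 ^ h)%N.
  have -> : (2 ^ h = 2 ^ (h - k.+1) * 2 ^ k.+1)%N by rewrite -expnD; congr (_ ^ _)%N; lia.
  by rewrite leq_mul2r qh orbT.
have hct : (c < t < T)%N by lia.
have [_ [/dvdnP[a ea]|lt2]] := li_fresh L hct vn St; last by lia.
have p0 : (0 < 2 ^ k.+1)%N by rewrite expn_gt0.
have h1 : (q * 2 ^ k.+1 < a * 2 ^ k.+1)%N by lia.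
have h2 : (a * 2 ^ k.+1 < q.+1 * 2 ^ k.+1)%N by lia.
by move: h1 h2; rewrite !ltn_pmul2r //; lia.
Qed.

(** * Bisecting one interval *)

Section Step.
Variables (S P0 S' P0' : nat -> nat) (P P' : nat -> R) (AL CN AL' CN' : nat -> nat) (k q : nat).
Hypothesis kh : (k < h)%N.
Hypothesis qh : (q < 2 ^ (h - k.+1))%N.
Hypothesis LI : sweep_inv S P AL CN k q.

Let l := (c + q * 2 ^ k.+1)%N.
Let r := (c + q.+1 * 2 ^ k.+1)%N.
Let mid := midtime c k q.
Let L := row_list n AL CN (parenttime c k.+1 q).
(** The test reads the rows [l] and [r] without a lookup: by [rd_l] and [rd_r] these cells hold the
    true values of the vertices in the parent's list. *)
Definition alive := [seq v <- L | ~~ (INF - P (l * n + v)%N <= od * (INF - P (r * n + v)%N))].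
Let A := alive.
Hypothesis S'_def : S' = marked n mid S A.
Hypothesis P'_out : forall x, (forall v, v \in A -> x <> mid * n + v)%N -> P' x = P x.

Let RD : ready S P AL CN k.+1 q. Proof. exact: (li_hi LI). Qed.

Lemma alive_sub v : v \in A -> v \in L. Proof. by rewrite mem_filter => /andP[]. Qed.

Lemma alive_n v : v \in A -> (v < n)%N.
Proof. by move=> /alive_sub /(rd_sub RD) /HLn[]. Qed.

Lemma mid_eq : mid = (c + (2 * q + 1) * 2 ^ k)%N.
Proof. by rewrite /mid /midtime expnS; lia. Qed.
Lemma l_eq : l = (c + (2 * q) * 2 ^ k)%N.
Proof. by rewrite /l expnS; lia. Qed.
Lemma r_eq : r = (c + (2 * q + 2) * 2 ^ k)%N.
Proof. by rewrite /r expnS; lia. Qed.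
Lemma pk0 : (0 < 2 ^ k)%N. Proof. by rewrite expn_gt0. Qed.
Lemma lmr : (l < mid < r)%N.
Proof. exact: mid_bounds. Qed.
Lemma r_le : (r <= T)%N.
Proof. exact: right_le. Qed.

Lemma S'E v x : (v < n)%N -> S' (x * n + v)%N = if (x == mid) && (v \in A) then 1%N else S (x * n + v)%N.
Proof.
move=> vn; rewrite S'_def /marked; case: mapP => [[u uA /(idx_inj vn (alive_n uA))[-> ->]]|H].
  by rewrite eqxx uA.
by case: eqP => //= xm; case: ifP => // vA; case: H; exists v; rewrite ?xm.
Qed.

Lemma S'_ge v x : (v < n)%N -> (0 < S (x * n + v))%N -> (0 < S' (x * n + v))%N.
Proof. by move=> vn h0; rewrite S'E //; case: ifP. Qed.

(** A vertex marked at [mid] comes from the parent's list and was marked there, by [rd_ps];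
    [odd_pow_inj] identifies [mid] among all midpoints. *)
Lemma clo' v : (v < n)%N -> closedS c h (fun x => 0 < S' (x * n + v))%N.
Proof.
move=> vn k1 q1 k1h q1h /=; rewrite S'E //; case: ifP => [/andP[/eqP me vA] _|_ h0].
  move: me; rewrite mid_eq /midtime expnS => me.
  have /odd_pow_inj[-> ->] : ((2 * q1 + 1) * 2 ^ k1 = (2 * q + 1) * 2 ^ k)%N by lia.
  by have [->|h0] := rd_ps RD (alive_sub vA); [right|left; exact: S'_ge].
by have [h1|->] := li_clo LI vn k1h q1h h0; [left; exact: S'_ge|right].
Qed.

Lemma chunk_end_T t : (c < t <= T)%N -> chunk_end h t = T.
Proof. by move=> ht; apply: chunk_end_in; rewrite mulSn addnC. Qed.

(** Marking [mid] affects only searches that start in (l, mid]: earlier ones within the chunk stop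
    at [l] at the latest, where an alive vertex is stored unless [l] is the start of the chunk. Of
    the multiples of 2 ^ k only [mid] lies in that range. *)
Lemma stored_val_stable a v : (v < n)%N -> a != (2 * q + 1)%N -> (c + a * 2 ^ k <= T)%N ->
  stored_val h n S' P' (c + a * 2 ^ k) v = stored_val h n S P (c + a * 2 ^ k) v.
Proof.
move=> vn am aT; set t := (c + a * 2 ^ k)%N.
have tm : t != mid by rewrite mid_eq /t eqn_add2l eqn_mul2r negb_or am andbT -lt0n pk0.
have tle : (t < mid)%N -> (t <= l)%N.
  by rewrite mid_eq l_eq /t !ltn_add2l !leq_add2l ltn_pmul2r ?pk0 // leq_pmul2r ?pk0 //; lia.
rewrite /stored_val; set r0 := chunk_end h t.
have tr0 : (t <= r0)%N by exact: chunk_end_ge.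
case: (boolP (v \in A)) => vA; last first.
  rewrite (@next_stored_ext _ (fun x => 0 < S (x * n + v))%N); last first.
    by move=> y _; rewrite S'E // (negbTE vA) andbF.
  by apply: P'_out => u uA /(idx_inj vn (alive_n uA))[_ vu]; rewrite vu uA in vA.
have e : next_stored (fun x => 0 < S' (x * n + v))%N h r0 t = next_stored (fun x => 0 < S (x * n + v))%N h r0 t
   /\ next_stored (fun x => 0 < S (x * n + v))%N h r0 t <> mid.
  have [lt|lt|e] := ltngtP t mid; last by move: tm; rewrite e eqxx.
    have tl := tle lt.
    have [a0|a0] := posnP a.
      have tc : t = c by rewrite /t a0 mul0n addn0.
      have r0c : r0 = c by rewrite /r0 tc chunk_end_mul.
      rewrite tc r0c; split; first by apply: next_stored_ext; lia.
      by have := @next_stored_le (fun x => 0 < S (x * n + v))%N h c c; move: lt; rewrite tc; lia.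
    have ct : (c < t <= T)%N by rewrite aT andbT /t; have := pk0; nia.
    have r0T : r0 = T by exact: chunk_end_T.
    rewrite r0T.
    have n1 := next_stored_chunk (clo' vn) ct; have n2 := next_stored_chunk (li_clo LI vn) ct.
    move: n1 n2; set x1 := next_stored _ _ _ _; set x2 := next_stored _ _ _ _ => n1 n2.
    have x2l : (x2 <= l)%N.
      rewrite leqNgt; apply/negP => lx; case: n2 => _ _ /(_ l); rewrite tl lx => /(_ isT).
      have [q0|->//] := rd_ls RD (alive_sub vA).
      by move: ct tl; rewrite /l q0 mul0n addn0; lia.
    have := lmr => lm; split; last by lia.
    apply: isnext_uniq n1 _; case: n2 => h1 h2 h3; split=> //.
      by case: h2 => [->|h2]; [left|right; exact: S'_ge].
    move=> y hy; rewrite S'E // ifF; first exact: h3.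
    by apply/negbTE; rewrite negb_and; apply/orP; left; lia.
  split.
    apply: next_stored_ext => y hy; rewrite S'E // ifF //.
    by apply/negbTE; rewrite negb_and; apply/orP; left; lia.
  by have := @next_stored_ge (fun x => 0 < S (x * n + v))%N h r0 t tr0; lia.
case: e => -> xm; apply: P'_out => u uA /(idx_inj vn (alive_n uA))[xe _].
by case: xm.
Qed.

Lemma mid_in : (c < mid <= T)%N.
Proof. by have := lmr; have := r_le; rewrite /l; lia. Qed.

(** Nothing is stored inside the interval yet, so the search from [mid] passes on to that from [r].
    Dead vertices thus receive their value at [mid] without any write. *)
Lemma stored_val_mid v : (v < n)%N -> stored_val h n S P mid v = stored_val h n S P r v.
Proof.
move=> vn; have mi := mid_in; have lm := lmr; have rT := r_le.
have ri : (c < r <= T)%N by lia.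
rewrite /stored_val !chunk_end_T //; congr (P (_ * n + v)%N).
apply: (isnext_uniq (next_stored_chunk (li_clo LI vn) mi)).
have [/andP[h1 h1'] h2 h3] := next_stored_chunk (li_clo LI vn) ri.
split=> //; first by lia.
move=> y /andP[my yx]; have [yr|ry] := ltnP y r; last by apply: h3; rewrite ry.
by apply: (fresh_node LI kh qh _ vn); rewrite -/l -/r; lia.
Qed.

Lemma look_alive v : v \in A -> next_stored (fun x => 0 < S' (x * n + v))%N h T mid = mid.
Proof.
move=> vA; have vn := alive_n vA; have mi := mid_in.
apply: (isnext_uniq (next_stored_chunk (clo' vn) mi)); split; first by lia.
  by right; rewrite S'E // eqxx vA.
by move=> y; lia.
Qed.

Lemma look_dead v : (v < n)%N -> v \notin A ->
  P (next_stored (fun x => 0 < S' (x * n + v))%N h T mid * n + v)%N = stored_val h n S P r v.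
Proof.
move=> vn vA; rewrite -stored_val_mid // /stored_val chunk_end_T ?mid_in //; congr (P (_ * n + v)%N).
by apply: next_stored_ext => y _; rewrite S'E // (negbTE vA) andbF.
Qed.

Lemma stored_val_new v : (v < n)%N -> stored_val h n S' P' mid v =
  if v \in A then P' (mid * n + v)%N else stored_val h n S P r v.
Proof.
move=> vn; rewrite /stored_val chunk_end_T ?mid_in //; case: ifP => vA; first by rewrite look_alive.
rewrite P'_out ?look_dead ?vA // => u uA /(idx_inj vn (alive_n uA))[_ vu].
by rewrite vu uA in vA.
Qed.

Lemma dead_stored_dist v : (v < n)%N -> v \notin A -> stored_dist S P l v <= od * stored_dist S P r v.
Proof.
move=> vn; rewrite mem_filter negb_and negbK => /orP[le|vL]; last exact: (rd_dead RD).
case: (boolP (v \in L)) => vL; last exact: (rd_dead RD).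
by rewrite /stored_dist (rd_l RD vL) (rd_r RD vL).
Qed.

Let b := od ^+ (h - k.+1).
Let b' := od ^+ (h - k).
Lemma b'E : b' = od * b.
Proof. by rewrite /b' /b -exprS; congr (_ ^+ _); lia. Qed.
Lemma b1 : 1 <= b. Proof. exact: exprn_ege1. Qed.
Lemma b'1 : 1 <= b'. Proof. exact: exprn_ege1. Qed.

Let low := stored_dist S P r.

(** The lower bound comes from the right end and the path from the left end: D_l <= od * D_r turns
    the factor [b] into od * b. *)
Lemma valid_val_dead v : (v < n)%N -> v \notin A ->
  valid_val s INF pth mid b' low v (stored_val h n S P r v).
Proof.
move=> vn vA; have -> : stored_val h n S P r v = INF - stored_dist S P r v by rewrite /stored_dist; lra.
apply: (valid_val_good pth_mono _ (rd_gl RD)) => //.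
- by have := lmr; rewrite -/l; lia.
- exact: g_1 (rd_gr RD) v vn.
- rewrite -/b b'E (mulrC od) -mulrA ler_wpM2l //; last exact: dead_stored_dist.
  by apply: le_trans b1.
Qed.

Lemma valid_val_alive v : v \in A -> valid_val s INF pth mid b' low v (P (l * n + v)%N).
Proof.
move=> vA; have vn := alive_n vA.
have -> : P (l * n + v)%N = INF - stored_dist S P l v.
  by rewrite /stored_dist -(rd_l RD (alive_sub vA)) -/l; lra.
apply: (valid_val_good pth_mono _ (rd_gl RD)) => //.
- by have := lmr; rewrite -/l; lia.
- exact: g_1 (rd_gl RD) v vn.
- exact: (rd_mono RD).
- rewrite -/b -/l; have D0 := g_0 (rd_gl RD) vn; rewrite -/l in D0.
  by rewrite ler_wpM2r // b'E ler_peMl // (le_trans _ b1).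
Qed.

Lemma Pl_ge0 v : v \in A -> 0 <= P (l * n + v)%N.
Proof.
move=> vA; have := g_inf (rd_gl RD) (alive_n vA).
by rewrite /stored_dist (rd_l RD (alive_sub vA)) -/l; lra.
Qed.

Lemma valid_val_relax i x e : (i < mid)%N -> (i < m)%N -> e = Wt i ->
  valid_val s INF pth mid b' low (U i) x -> valid_val s INF pth mid b' low (V i) (x - e).
Proof.
move=> im iM ->; apply: (valid_val_edge W1 pth_edge pth_mono) => //; first exact: b'1.
  exact: g_0 (rd_gr RD) _ (Un iM).
by apply: (g_edge (rd_gr RD)) => //; have := lmr; rewrite /r; lia.
Qed.

Hypothesis P'_ge : forall v, v \in A -> 0 <= P' (mid * n + v)%N.
Hypothesis P'_val : forall v, v \in A -> valid_val s INF pth mid b' low v (P' (mid * n + v)%N).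
Hypothesis P'_mono : forall v, v \in A -> P (l * n + v)%N <= P' (mid * n + v)%N.
Hypothesis P'_edge : forall i, (i < mid)%N -> (i < m)%N -> V i \in A ->
  stored_val h n S' P' mid (U i) - Wt i <= P' (mid * n + V i)%N.
Hypothesis lst_mid : row_list n AL' CN' mid = A.
Hypothesis lst_other : forall t, t != mid -> (CN t <= n)%N -> row_list n AL' CN' t = row_list n AL CN t.

Lemma s_alive : s \notin A.
Proof. by apply/negP => /alive_sub /(rd_sub RD) /HLn[_]; rewrite eqxx. Qed.

Lemma stored_val_valid v : (v < n)%N -> valid_val s INF pth mid b' low v (stored_val h n S' P' mid v).
Proof.
move=> vn; rewrite stored_val_new //; case: ifP => vA; first exact: P'_val.
by apply: valid_val_dead; rewrite ?vA.
Qed.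

(** Edges into alive vertices were settled by Dijkstra's algorithm. An edge into a dead vertex is
    feasible because it is so for D_r and no new distance undercuts D_r; this is where rounding
    downwards pays off. *)
Lemma good_mid : Good mid b' (stored_dist S' P' mid) /\
  forall v, (v < n)%N -> low v <= stored_dist S' P' mid v.
Proof.
apply: good_valid_val.
- rewrite /stored_dist stored_val_new // (negbTE s_alive).
  exact: (g_s (rd_gr RD)).
- move=> v vn; rewrite /stored_dist stored_val_new //; case: ifP => vA; first by have := P'_ge vA; lra.
  exact: (g_inf (rd_gr RD) vn).
- by move=> v vn; exact: (g_0 (rd_gr RD) vn).
- move=> v vn; have -> : INF - stored_dist S' P' mid v = stored_val h n S' P' mid v by rewrite /stored_dist; lra.
  exact: stored_val_valid.
- move=> i im iM; case: (boolP (V i \in A)) => vA.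
    have := P'_edge im iM vA.
    by rewrite {2}/stored_dist [stored_dist _ _ _ (V i)]/stored_dist (stored_val_new (Vn iM)) vA; lra.
  have -> : stored_dist S' P' mid (V i) = low (V i).
    by rewrite /stored_dist stored_val_new ?Vn // (negbTE vA).
  have h1 : low (V i) <= low (U i) + Wt i.
    by apply: (g_edge (rd_gr RD)) => //; have := lmr; rewrite /r; lia.
  have [_ h2 _] := stored_val_valid (Un iM).
  by rewrite /stored_dist; lra.
Qed.

Lemma stored_dist_mid_le v : (v < n)%N -> stored_dist S' P' mid v <= stored_dist S P l v.
Proof.
move=> vn; rewrite /stored_dist stored_val_new //; case: ifP => vA.
  by have := P'_mono vA; rewrite -(rd_l RD (alive_sub vA)) -/l; lra.
exact: (rd_mono RD).
Qed.

Lemma stored_dist_mid_dead v : (v < n)%N -> v \notin A -> stored_dist S' P' mid v = stored_dist S P r v.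
Proof. by move=> vn vA; rewrite /stored_dist stored_val_new // (negbTE vA). Qed.

Lemma good_weaken t D : Good t b D -> Good t b' D.
Proof.
case=> h1 h2 h3 h4 h5 h6; split=> // v vn.
have le : b * D v <= b' * D v by rewrite ler_wpM2r ?h4 // b'E ler_peMl // (le_trans _ b1).
by have [hv|hv] := h6 v vn; [left; lra|right; exact: pth_mono (leqnn t) le hv].
Qed.

Lemma stored_dist_stable a v : (v < n)%N -> a != (2 * q + 1)%N -> (c + a * 2 ^ k <= T)%N ->
  stored_dist S' P' (c + a * 2 ^ k) v = stored_dist S P (c + a * 2 ^ k) v.
Proof. by move=> vn am aT; rewrite /stored_dist stored_val_stable. Qed.

Lemma P'_row x v : (v < n)%N -> x != mid -> P' (x * n + v)%N = P (x * n + v)%N.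
Proof.
move=> vn xm; apply: P'_out => u uA /(idx_inj vn (alive_n uA))[xe _].
by rewrite xe eqxx in xm.
Qed.

Lemma row_list_size t : uniq (row_list n AL CN t) -> {subset row_list n AL CN t <= HL} -> (CN t <= n)%N.
Proof.
move=> un sub; rewrite -(size_row_list n AL CN t) -[X in (_ <= X)%N](size_iota 0).
by apply: uniq_leq_size => // v /sub/HLn[vn _]; rewrite mem_iota.
Qed.

(** The five numbers are, in units of 2 ^ k', the ends of the interval and the ends and midpoint of
    its parent. As none of them is [mid], no value or list that [ready] speaks of changes. *)
Lemma ready_stable k' q' : (k <= k')%N -> (q' < 2 ^ (h - k'))%N -> (k' <= h)%N ->
  (forall x, x \in [:: q'; q'.+1; 2 * (q' %/ 2); 2 * (q' %/ 2) + 2; 2 * (q' %/ 2) + 1]%N ->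
     (x * 2 ^ (k' - k))%N != (2 * q + 1)%N) ->
  ready S P AL CN k' q' -> ready S' P' AL' CN' k' q'.
Proof.
move=> kk' q'h k'h ne R'.
have e2 x : (x * 2 ^ k' = (x * 2 ^ (k' - k)) * 2 ^ k)%N by rewrite -mulnA -expnD subnK.
have eT : (2 ^ h = 2 ^ (h - k') * 2 ^ k')%N by rewrite -expnD subnK.
have p0 : (0 < 2 ^ k')%N by rewrite expn_gt0.
have nl : (q' * 2 ^ (k' - k))%N != (2 * q + 1)%N by apply: ne; rewrite !inE eqxx.
have nr : (q'.+1 * 2 ^ (k' - k))%N != (2 * q + 1)%N by apply: ne; rewrite !inE eqxx ?orbT.
have lT : (c + q' * 2 ^ k' <= T)%N by rewrite leq_add2l eT leq_mul2r ltnW ?orbT.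
have rT : (c + q'.+1 * 2 ^ k' <= T)%N by rewrite leq_add2l eT leq_mul2r q'h ?orbT.
have row x : (x * 2 ^ (k' - k))%N != (2 * q + 1)%N -> (c + x * 2 ^ k')%N != mid.
  by move=> xn; rewrite e2 mid_eq eqn_add2l eqn_mul2r negb_or xn andbT -lt0n expn_gt0.
have pm : parenttime c k' q' != mid.
  by apply: row; apply: ne; rewrite !inE eqxx ?orbT.
have El : row_list n AL' CN' (parenttime c k' q') = row_list n AL CN (parenttime c k' q').
  by apply: lst_other => //; apply: row_list_size; [exact: rd_uniq R'|exact: rd_sub R'].
have Dl v : (v < n)%N -> stored_dist S' P' (c + q' * 2 ^ k') v = stored_dist S P (c + q' * 2 ^ k') v.
  by move=> vn; rewrite e2 stored_dist_stable // -e2.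
have Dr v : (v < n)%N -> stored_dist S' P' (c + q'.+1 * 2 ^ k') v = stored_dist S P (c + q'.+1 * 2 ^ k') v.
  by move=> vn; rewrite e2 stored_dist_stable // -e2.
have Ln v : v \in row_list n AL CN (parenttime c k' q') -> (v < n)%N by move/(rd_sub R')/HLn => [].
have gs t D D' : (t <= T)%N -> Good t (od ^+ (h - k')) D -> (forall v, (v < n)%N -> D' v = D v) -> Good t (od ^+ (h - k')) D'.
  move=> _ [h1 h2 h3 h4 h5 h6] e; split; first by rewrite e.
  - by move=> i it im; rewrite !e ?Un ?Vn //; exact: h2.
  - by move=> v vn; rewrite e //; exact: h3.
  - by move=> v vn; rewrite e //; exact: h4.
  - by move=> v vn; rewrite e //; exact: h5.
  - by move=> v vn; rewrite e //; exact: h6.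
split; rewrite ?El.
- by move=> v vn vL; rewrite Dl ?Dr //; exact: (rd_dead R').
- exact: rd_sub R'.
- move=> v vL; have vn := Ln v vL; rewrite P'_row ?row // -(rd_l R' vL).
  by have := Dl v vn; rewrite /stored_dist; lra.
- move=> v vL; have vn := Ln v vL; rewrite P'_row ?row // -(rd_r R' vL).
  by have := Dr v vn; rewrite /stored_dist; lra.
- by move=> v vL; have [->|h0] := rd_ls R' vL; [left|right; apply: S'_ge h0; exact: Ln].
- by move=> v vL; have [->|h0] := rd_ps R' vL; [left|right; apply: S'_ge h0; exact: Ln].
- exact: rd_uniq R'.
- exact: gs lT (rd_gl R') Dl.
- exact: gs rT (rd_gr R') Dr.
- by move=> v vn; rewrite Dl ?Dr //; exact: (rd_mono R').
- move=> v vL; have vn := Ln v vL; have [->|hp] := rd_par R' vL; [by left|].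
  have [k'e|k'n] := eqVneq k' h; [by left|right].
  have e3 x : (x * 2 ^ k'.+1 = (2 * x) * 2 ^ k')%N by rewrite expnS; lia.
  have hh : (2 ^ (h - k') = 2 * 2 ^ (h - k'.+1))%N by rewrite -expnS; congr (_ ^ _)%N; lia.
  have n1 : (2 * (q' %/ 2) * 2 ^ (k' - k))%N != (2 * q + 1)%N.
    by apply: ne; rewrite !inE eqxx ?orbT.
  have n2 : (2 * (q' %/ 2).+1 * 2 ^ (k' - k))%N != (2 * q + 1)%N.
    by rewrite mulnS addnC; apply: ne; rewrite !inE eqxx ?orbT.
  have T2 : (c + (2 * (q' %/ 2).+1) * 2 ^ k' <= T)%N.
    by rewrite leq_add2l eT leq_mul2r; apply/orP; right; lia.
  have T1 : (c + (2 * (q' %/ 2)) * 2 ^ k' <= T)%N.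
    by rewrite leq_add2l eT leq_mul2r; apply/orP; right; lia.
  move: hp; rewrite !e3 (e2 (2 * (q' %/ 2).+1)%N) (e2 (2 * (q' %/ 2))%N).
  by rewrite (stored_dist_stable vn n2) ?(stored_dist_stable vn n1) // -e2.
Qed.

Lemma ready_left : ready S' P' AL' CN' k (2 * q).
Proof.
have ep : parenttime c k (2 * q) = mid.
  by rewrite /parenttime mulKn // mid_eq.
have e1 : (c + (2 * q).+1 * 2 ^ k)%N = mid by rewrite mid_eq addn1.
have nl : (2 * q)%N != (2 * q + 1)%N by lia.
have nr : (2 * q + 2)%N != (2 * q + 1)%N by lia.
have lT : (c + 2 * q * 2 ^ k <= T)%N by rewrite -l_eq; have := lmr; have := r_le; lia.
have rT : (c + (2 * q + 2) * 2 ^ k <= T)%N by rewrite -r_eq r_le.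
have Dl v : (v < n)%N -> stored_dist S' P' l v = stored_dist S P l v by move=> vn; rewrite l_eq stored_dist_stable.
have Dr v : (v < n)%N -> stored_dist S' P' r v = stored_dist S P r v by move=> vn; rewrite r_eq stored_dist_stable.
split; rewrite ?ep ?lst_mid ?e1 -?l_eq.
- by move=> v vn vA; rewrite Dl // stored_dist_mid_dead // dead_stored_dist.
- by move=> v /alive_sub/(rd_sub RD).
- move=> v vA; have vn := alive_n vA; rewrite P'_row //; last by have := lmr; lia.
  by rewrite l_eq stored_val_stable // -l_eq; exact: rd_l RD _ (alive_sub vA).
- by move=> v vA; rewrite stored_val_new ?alive_n // vA.
- move=> v vA; have [->|h0] := rd_ls RD (alive_sub vA); first by left.
  by right; apply: S'_ge; [exact: alive_n|exact: h0].
- by move=> v vA; right; rewrite S'E ?alive_n // eqxx vA.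
- by rewrite filter_uniq //; exact: rd_uniq RD.
- apply: good_weaken; case: (rd_gl RD) => h1 h2 h3 h4 h5 h6; rewrite -/l in h1 h2 h3 h4 h5 h6.
  split; first by rewrite Dl.
  + by move=> i it im; rewrite !Dl ?Un ?Vn //; exact: h2.
  + by move=> v vn; rewrite Dl //; exact: h3.
  + by move=> v vn; rewrite Dl //; exact: h4.
  + by move=> v vn; rewrite Dl //; exact: h5.
  + by move=> v vn; rewrite Dl //; exact: h6.
- by have [] := good_mid.
- by move=> v vn; rewrite Dl // stored_dist_mid_le.
- move=> v vA; right; have vn := alive_n vA; rewrite mulKn // -/l -/r Dl // Dr //.
  have vL := alive_sub vA; move: vA; rewrite mem_filter -ltNge => /andP[h1 _].
  by rewrite /stored_dist (rd_l RD vL) (rd_r RD vL).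
Qed.

Lemma ready_right : ready S' P' AL' CN' k (2 * q + 1).
Proof.
have ep : parenttime c k (2 * q + 1) = mid.
  by rewrite /parenttime (_ : (2 * q + 1) %/ 2 = q)%N ?mid_eq //; lia.
have e1 : (c + (2 * q + 1).+1 * 2 ^ k)%N = r by rewrite r_eq -addnS.
have nl : (2 * q)%N != (2 * q + 1)%N by lia.
have nr : (2 * q + 2)%N != (2 * q + 1)%N by lia.
have lT : (c + 2 * q * 2 ^ k <= T)%N by rewrite -l_eq; have := lmr; have := r_le; lia.
have rT : (c + (2 * q + 2) * 2 ^ k <= T)%N by rewrite -r_eq r_le.
have Dl v : (v < n)%N -> stored_dist S' P' l v = stored_dist S P l v by move=> vn; rewrite l_eq stored_dist_stable.
have Dr v : (v < n)%N -> stored_dist S' P' r v = stored_dist S P r v by move=> vn; rewrite r_eq stored_dist_stable.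
split; rewrite ?ep ?lst_mid ?e1 -?mid_eq.
(* A vertex that is dead at [mid] has the same distance at [mid] and [r], hence is dead in the right
   half. *)
- move=> v vn vA; rewrite Dr // stored_dist_mid_dead // ler_peMl //.
  exact: g_0 (rd_gr RD) v vn.
- by move=> v /alive_sub/(rd_sub RD).
- by move=> v vA; rewrite stored_val_new ?alive_n // vA.
- move=> v vA; have vn := alive_n vA; rewrite P'_row //; last by have := lmr; lia.
  by rewrite r_eq stored_val_stable // -r_eq; exact: rd_r RD _ (alive_sub vA).
- by move=> v vA; right; rewrite S'E ?alive_n // eqxx vA.
- by move=> v vA; right; rewrite S'E ?alive_n // eqxx vA.
- by rewrite filter_uniq //; exact: rd_uniq RD.
- by have [] := good_mid.
- apply: good_weaken; case: (rd_gr RD) => h1 h2 h3 h4 h5 h6; rewrite -/r in h1 h2 h3 h4 h5 h6.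
  split; first by rewrite Dr.
  + by move=> i it im; rewrite !Dr ?Un ?Vn //; exact: h2.
  + by move=> v vn; rewrite Dr //; exact: h3.
  + by move=> v vn; rewrite Dr //; exact: h4.
  + by move=> v vn; rewrite Dr //; exact: h5.
  + by move=> v vn; rewrite Dr //; exact: h6.
- by move=> v vn; rewrite Dr //; have [_ h1] := good_mid; exact: h1.
- move=> v vA; right; have vn := alive_n vA.
  rewrite (_ : (2 * q + 1) %/ 2 = q)%N; last by lia.
  rewrite -/l -/r Dl // Dr //.
  have vL := alive_sub vA; move: vA; rewrite mem_filter -ltNge => /andP[h1 _].
  by rewrite /stored_dist (rd_l RD vL) (rd_r RD vL).
Qed.

Lemma sweep_inv_step : sweep_inv S' P' AL' CN' k q.+1.
Proof.
have lm := lmr.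
split.
- move=> q' qq' q'h; apply: ready_stable => //; last by apply: (li_hi LI) => //; lia.
  (* A multiple of 2 ^ k.+1 is never the midpoint, by parity. *)
  by rewrite subSnn expn1 => x; rewrite !inE => /or4P[/eqP ->|/eqP ->|/eqP ->|/orP[]/eqP ->]; lia.
- move=> q' q'q; have [e|e] := eqVneq q' (2 * q)%N; first by rewrite e; exact: ready_left.
  have [e'|e'] := eqVneq q' (2 * q + 1)%N; first by rewrite e'; exact: ready_right.
  have hh : (2 ^ (h - k) = 2 * 2 ^ (h - k.+1))%N by rewrite -expnS; congr (_ ^ _)%N; lia.
  apply: ready_stable => //; [lia|lia| |by apply: (li_lo LI); lia].
  by rewrite subnn expn0 => x; rewrite !inE => /or4P[/eqP ->|/eqP ->|/eqP ->|/orP[]/eqP ->]; lia.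
- exact: clo'.
- move=> t v ct vn; rewrite S'E //; case: ifP => [/andP[/eqP -> _] _|_ h0].
    split; first by rewrite mid_eq addKn dvdn_mull.
    by right; have := lmr; rewrite /r; lia.
  have [h1 [h2|h2]] := li_fresh LI ct vn h0; split=> //; [by left|right].
  by rewrite mulSn; lia.
- rewrite lst_other ?(li_HL LI) //; first by have := lmr; have := r_le; lia.
  by apply: row_list_size; rewrite (li_HL LI).
Qed.

End Step.
Record level_inv S P AL CN k : Prop := Lev {
  lv_ready : forall q, (q < 2 ^ (h - k))%N -> ready S P AL CN k q;
  lv_clo : forall v, (v < n)%N -> closedS c h (fun x => 0 < S (x * n + v))%N;
  lv_fresh : forall t v, (c < t < T)%N -> (v < n)%N -> (0 < S (t * n + v))%N ->
    (2 ^ k %| t - c)%N;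
  lv_HL : row_list n AL CN T = HL }.

Lemma sweep_inv_start S P AL CN k : (k < h)%N -> level_inv S P AL CN k.+1 -> sweep_inv S P AL CN k 0.
Proof.
move=> kh [h1 h2 h3 h4]; split=> //; first by move=> q' _; exact: h1.
move=> t v ct vn St; have h5 := h3 t v ct vn St; split; last by left.
by apply: dvdn_trans h5; rewrite expnS dvdn_mull.
Qed.

Lemma sweep_inv_end S P AL CN k : (k < h)%N -> sweep_inv S P AL CN k (2 ^ (h - k.+1)) -> level_inv S P AL CN k.
Proof.
move=> kh [h1 h2 h3 h4 h5]; split=> //.
  by move=> q qh; apply: h2; rewrite -expnS; apply: leq_trans qh _; rewrite leq_exp2l //; lia.
by move=> t v ct vn /(h4 t v ct vn)[].
Qed.

(** Both halves of an interval have the same parent, so sums over intervals become twice a sum over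
    parents. *)
Lemma sum_half (g : nat -> R) Q : \sum_(0 <= q < 2 * Q) g (q %/ 2)%N = 2 * \sum_(0 <= i < Q) g i.
Proof.
elim: Q => [|Q IH]; first by rewrite muln0 !big_geq // mulr0.
rewrite mulnS [X in index_iota 0 X](_ : _ = (2 * Q).+2)%N; last by lia.
rewrite !big_nat_recr //= IH (_ : ((2 * Q) %/ 2 = Q)%N); last by lia.
by rewrite (_ : ((2 * Q).+1 %/ 2 = Q)%N); [lra|lia].
Qed.

Lemma sum_sub (F : nat -> R) (L M : seq nat) : uniq L -> uniq M -> {subset L <= M} ->
  \sum_(v <- L) F v = \sum_(v <- M) (if v \in L then F v else 0).
Proof.
move=> uL uM LM; rewrite -big_mkcond /= -[RHS]big_filter; apply: perm_big.
apply: uniq_perm => //; first exact: filter_uniq.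
move=> v; rewrite mem_filter; case: (boolP (v \in L)) => //= /LM ->; exact: erefl.
Qed.

(** Telescoping: [rd_par] makes the number of intervals in which [v] is alive at most
    [(ln (D_c v) - ln (D_T v)) / ln od], and [1 <= D_T v <= D_c v <= INF]. *)
Lemma level_work_le (dg : nat -> R) S P AL CN k : level_inv S P AL CN k -> (k <= h)%N -> 1 < od -> 1 <= INF ->
  (forall v, 0 <= dg v) ->
  \sum_(0 <= q < 2 ^ (h - k)) \sum_(v <- row_list n AL CN (parenttime c k q)) dg v <=
  (\sum_(v <- HL) dg v) * (1 + 2 * ln INF / ln od).
Proof.
move=> LV; rewrite leq_eqVlt => /predU1P[->|kh] odgt INF1 dg0.
  (* The topmost level has a single interval with the full list; this accounts for the summand 1. *)
  rewrite subnn expn0 big_nat1 (_ : parenttime c h 0 = T); last by rewrite /parenttime mul1n.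
  rewrite (lv_HL LV) ler_peMr ?sumr_ge0 // ler_wpDr //.
  by rewrite divr_ge0 ?mulr_ge0 ?ln_ge0 // ltW.
have lod : 0 < ln od by rewrite ln_gt0.
set Q := (2 ^ (h - k.+1))%N.
have e2 : (2 ^ (h - k) = 2 * Q)%N by rewrite /Q -expnS; congr (_ ^ _)%N; lia.
pose lam i v := ln (stored_dist S P (c + i * 2 ^ k.+1) v).
have Rd q : (q < 2 * Q)%N -> ready S P AL CN k q by rewrite -e2; exact: lv_ready.
have ek i : (i * 2 ^ k.+1 = (2 * i) * 2 ^ k)%N by rewrite expnS; lia.
have mono i v : (v < n)%N -> (i < Q)%N ->
    stored_dist S P (c + i.+1 * 2 ^ k.+1) v <= stored_dist S P (c + i * 2 ^ k.+1) v.
  move=> vn iQ; rewrite !ek; have R1 : ready S P AL CN k (2 * i) by apply: Rd; lia.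
  have R2 : ready S P AL CN k (2 * i).+1 by apply: Rd; lia.
  apply: le_trans (rd_mono R1 vn); have := rd_mono R2 vn.
  by rewrite (_ : (2 * i).+2 = 2 * i.+1)%N //; lia.
have D1 i v : v \in HL -> (i <= Q)%N -> 1 <= stored_dist S P (c + i * 2 ^ k.+1) v <= INF.
  move=> /HLn[vn vs] iQ; rewrite ek.
  have Q0 : (0 < Q)%N by rewrite expn_gt0.
  case: i iQ => [|i] iQ.
    have R1 : ready S P AL CN k 0 by apply: Rd; lia.
    by rewrite muln0; rewrite (g_1 (rd_gl R1)) // (g_inf (rd_gl R1)).
  have R1 : ready S P AL CN k (2 * i).+1 by apply: Rd; lia.
  rewrite (_ : 2 * i.+1 = (2 * i).+2)%N; last by lia.
  by rewrite (g_1 (rd_gr R1)) // (g_inf (rd_gr R1)).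
have lam_mono i v : v \in HL -> (i < Q)%N -> lam i.+1 v <= lam i v.
  move=> vH iQ; have [vn _] := HLn vH; rewrite ler_ln ?mono // posrE.
    by have /andP[h1 _] := D1 i.+1 v vH iQ; lra.
  by have /andP[h1 _] := D1 i v vH (ltnW iQ); lra.
have step q : (q < 2 * Q)%N -> \sum_(v <- row_list n AL CN (parenttime c k q)) dg v <=
    \sum_(v <- HL) dg v * ((lam (q %/ 2)%N v - lam (q %/ 2).+1 v) / ln od).
  move=> qQ; have R1 := Rd q qQ.
  rewrite (sum_sub dg (rd_uniq R1) HLuniq (rd_sub R1)) !big_seq; apply: ler_sum => v vH.
  have qQ2 : (q %/ 2 < Q)%N by lia.
  case: ifP => vL; last first.
    by apply: mulr_ge0 => //; apply: divr_ge0; [rewrite subr_ge0 lam_mono|exact: ltW].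
  rewrite ler_peMr // ler_pdivlMr // mul1r lerBrDl addrC.
  have [ke|hp] := rd_par R1 vL; first by move: kh; rewrite ke ltnn.
  have /andP[h1 _] := D1 (q %/ 2).+1 v vH qQ2.
  rewrite /lam -lnM ?posrE; [|lra|lra].
  rewrite ler_ln ?posrE; [exact: ltW|apply: mulr_gt0; lra|].
  by have /andP[h2 _] := D1 (q %/ 2)%N v vH (ltnW qQ2); lra.
rewrite e2; apply: (@le_trans _ _ (\sum_(0 <= q < 2 * Q) \sum_(v <- HL) dg v * ((lam (q %/ 2)%N v - lam (q %/ 2).+1 v) / ln od))).
  by rewrite !big_nat; apply: ler_sum => q /andP[_ qQ]; exact: step.
rewrite exchange_big /= mulr_suml !big_seq; apply: ler_sum => v vH.
rewrite -mulr_sumr ler_wpM2l // -mulr_suml.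
(* The list of an interval is used for both of its halves, whence the factor 2; the sum that is left
   telescopes. *)
rewrite (sum_half (fun i => lam i v - lam i.+1 v)).
have -> : \sum_(0 <= i < Q) (lam i v - lam i.+1 v) = lam 0%N v - lam Q v.
  elim: (Q) => [|q IH]; first by rewrite big_geq // subrr.
  by rewrite big_nat_recr //= IH; lra.
have /andP[a1 a2] := D1 0%N v vH (leq0n _); have /andP[b1' b2] := D1 Q v vH (leqnn _).
have l1 : lam 0%N v <= ln INF by rewrite /lam ler_ln ?posrE; lra.
have l2 : 0 <= lam Q v by rewrite /lam ln_ge0.
have : 2 * (lam 0%N v - lam Q v) / ln od <= 2 * ln INF / ln od by rewrite ler_pM2r ?invr_gt0 //; lra.
by lra.
Qed.

End Level.

(** * Execution of the sweeps over a chunk *)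

Section Sweep.
Context {R : realType} (w NB : nat).
Hypothesis NB1 : (1 < NB)%N.
Hypothesis NBw : (8 * NB * NB < 2 ^ w)%N.
Variables (n h j0 m s B NE LG : nat) (INF od : R) (HL : seq nat).
Variables (U V : nat -> nat) (Wt : nat -> R) (pth : nat -> nat -> R -> Prop).
Variables (EU EV HD NX : nat -> nat) (EW : nat -> R) (adj : nat -> seq nat).
Local Notation c := (j0 * 2 ^ h)%N.
Local Notation T := (c + 2 ^ h)%N.
Hypothesis sn : (s < n)%N.
Hypothesis Un : forall i, (i < m)%N -> (U i < n)%N.
Hypothesis Vn : forall i, (i < m)%N -> (V i < n)%N.
Hypothesis W1 : forall i, (i < m)%N -> 1 <= Wt i.
Hypothesis pth_edge : forall t i x, (i < t)%N -> (i < m)%N -> pth t (U i) x -> pth t (V i) (x + Wt i).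
Hypothesis pth_mono : forall t t' v x y, (t <= t')%N -> x <= y -> pth t v x -> pth t' v y.
Hypothesis od1 : 1 <= od.
Hypothesis HLuniq : uniq HL.
Hypothesis HLn : forall v, v \in HL -> (v < n)%N /\ v != s.
Hypothesis bounds : [/\ (n <= NB)%N, (T <= NB)%N, (B + 2 ^ h <= NB)%N, (2 * NE + 1 <= NB)%N &
  (h <= LG)%N /\ (2 * n <= 2 ^ LG)%N].
Hypothesis EUn : forall j, (j < NE)%N -> (EU j < n)%N.
Hypothesis EVn : forall j, (j < NE)%N -> (EV j < n)%N.
Hypothesis EW0 : forall j, (j < NE)%N -> 0 < EW j.
Hypothesis adjL : forall x, (x < n)%N -> linked NX (HD (c * n + x)%N) (adj x).
Hypothesis adjN : forall x j, (x < n)%N -> j \in adj x -> (j < NE)%N.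
Hypothesis adjU : forall j, (j < NE)%N -> j \in adj (EU j).
Hypothesis adjV : forall j, (j < NE)%N -> j \in adj (EV j).
(** The edges at positions below [B + (t - c)] represent [G_t]: the first [B]
    of them stand for the edges that precede the chunk. *)
Hypothesis edge_sound : forall t j, (c < t <= T)%N -> (j < NE)%N -> (j < B + (t - c))%N ->
  exists i, [/\ (i < t)%N, (i < m)%N, EU j = U i, EV j = V i & EW j = Wt i].
Hypothesis edge_complete : forall t i, (c < t <= T)%N -> (i < t)%N -> (i < m)%N ->
  exists j, [/\ (j < NE)%N, (j < B + (t - c))%N, EU j = U i, EV j = V i & EW j <= Wt i].
Implicit Types (st : state R).

Record chunk_env st : Prop := Cenv {
  ce_n : ivar st vn = n; ce_T : ivar st vT = T; ce_K : ivar st vK = (2 ^ h)%N;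
  ce_c : ivar st vc = c; ce_B : ivar st vB = B;
  ce_EU : iarr st aEU = EU; ce_EV : iarr st aEV = EV; ce_HD : iarr st aHD = HD;
  ce_NX : iarr st aNX = NX; ce_EW : rarr st rEW = EW;
  ce_inf : rvar st xinf = INF; ce_del : rvar st xdel = od }.

Lemma chunk_env_frame cm st st' : frame cm st st' ->
  all (fun x => x \notin written_ivars cm) [:: vn; vT; vK; vc; vB] ->
  all (fun x => x \notin written_iarrs cm) [:: aEU; aEV; aHD; aNX] ->
  rEW \notin written_rarrs cm -> all (fun x => x \notin written_rvars cm) [:: xinf; xdel] -> chunk_env st -> chunk_env st'.
Proof.
case=> f1 f2 f3 f4 /= /and5P[i1 i2 i3 i4 /andP[i5 _]].
move=> /and5P[a1 a2 a3 a4 _] r1 /and3P[r2 r3 _] [e1 e2 e3 e4 e5 e6 e7 e8 e9 e10 e11 e12].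
by split; rewrite ?f1 ?f2 ?f3 ?f4.
Qed.

Definition tree_empty st := tree_ok n (rarr st rTR) /\
  forall u, (u < n)%N -> rarr st rTR (n + u)%N = 0.

Definition swept st k q := sweep_inv n h j0 m s INF od HL U V Wt pth
  (iarr st aS) (rarr st rP) (iarr st aAL) (iarr st aCN) k q.

Definition kept st st' := forall x v, (v < n)%N -> ~~ (c < x < T)%N ->
  iarr st' aS (x * n + v)%N = iarr st aS (x * n + v)%N /\
  rarr st' rP (x * n + v)%N = rarr st rP (x * n + v)%N.

(** The 80 on top of the coefficient of [dijkstra_cost] pays for [filterlist], whose cost is linear
    in the parent's list. *)
Definition process_cost L := ((160 * LG + 560) * (\sum_(v <- L) (size (adj v)).+1) + 600)%N.
Definition state_list st t := row_list n (iarr st aAL) (iarr st aCN) t.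

Lemma process_run st k q : chunk_env st -> tree_empty st -> (k < h)%N -> (q < 2 ^ (h - k.+1))%N ->
  swept st k q -> ivar st vq = q -> ivar st vsz = (2 ^ k.+1)%N ->
  run w process st (process_cost (state_list st (parenttime c k.+1 q))) (fun st' =>
    [/\ chunk_env st', tree_empty st', swept st' k q.+1, ivar st' vq = q.+1 &
     kept st st' /\ forall t, t != midtime c k q -> (iarr st aCN t <= n)%N -> state_list st' t = state_list st t]).
Proof.
move=> E [tok leaf] kh qh LI eq esz.
have [nN TN BN NEN [hL nL]] := bounds.
have RD := li_hi LI (leqnn q) qh.
set mid := midtime c k q; set p := parenttime c k.+1 q.
set l := (c + q * 2 ^ k.+1)%N; set r := (c + q.+1 * 2 ^ k.+1)%N.
set L := state_list st p.
have n0 : (0 < n)%N by lia.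
have lm : (l < mid < r)%N by exact: mid_bounds.
have rT : (r <= T)%N by exact: right_le.
have k20 : (0 < 2 ^ k.+1)%N by rewrite expn_gt0.
have qk : (q.+1 * 2 ^ k.+1 <= 2 ^ h)%N by move: rT; rewrite /r leq_add2l.
have q2 : (q <= NB)%N by nia.
have pT : (p <= T)%N by exact: parent_le.
have e2k : (2 ^ k.+1 %/ 2 = 2 ^ k)%N by rewrite expnS mulKn.
have pmid : p != mid by exact: parent_neq_mid.
have km : (2 ^ k <= 2 ^ k.+1)%N by rewrite leq_exp2l.
have pe : (c + (2 * (q %/ 2) + 1) * 2 ^ k.+1)%N = p by [].
set K := process_cost L.
have cl0 : (q * 2 ^ k.+1 <= NB)%N by nia.
have lmid : (l + 2 ^ k = mid)%N by [].
have rmid : (l + 2 ^ k.+1 = r)%N by rewrite /l /r mulSn; lia.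
apply: (@run_loop_free_seq _ _ _ _ _ (K - 10)) => //; last by rewrite /K /process_cost /=; lia.
  by rewrite /= (ce_c E) eq esz; oks NB1 NBw.
rewrite /= (ce_c E) eq esz -/l.
apply: (@run_loop_free_seq _ _ _ _ _ (K - 20)) => //; last by rewrite /K /process_cost /=; lia.
  by rewrite /= esz; oks NB1 NBw.
rewrite /= esz rmid.
apply: (@run_loop_free_seq _ _ _ _ _ (K - 30)) => //; last by rewrite /K /process_cost /=; lia.
  by rewrite /= esz e2k; oks NB1 NBw.
rewrite /= esz e2k lmid.
apply: (@run_loop_free_seq _ _ _ _ _ (K - 50)) => //; last by rewrite /K /process_cost /=; lia.
  by rewrite /= esz (ce_c E) eq; oks NB1 NBw; rewrite ?pe; oks NB1 NBw.
rewrite /= esz (ce_c E) eq pe.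
set st1 := set_ivar _ vpm p.
have E1 : chunk_env st1 by case: E => *; split.
have LIn : sweep_inv n h j0 m s INF od HL U V Wt pth (iarr st aS) (rarr st rP) (iarr st aAL) (iarr st aCN) k q by [].
have cn : (iarr st aCN p <= n)%N by apply: (row_list_size HLn); [exact: rd_uniq RD|exact: rd_sub RD].
have Ln v : v \in L -> (v < n)%N by move/(rd_sub RD)/HLn => [].
have FR := @filter_run R w NB NB1 NBw st1 n mid p l r (ce_n E1) erefl erefl erefl erefl.
have hb : (l <= NB)%N /\ (r <= NB)%N /\ (mid <= NB)%N /\ (p <= NB)%N by lia.
case: hb => lNB [rNB [mNB pNB]].
have {FR} FR := FR nN mNB pNB lNB rNB pmid cn Ln.
rewrite (ce_inf E1) (ce_del E1) /= -/L in FR.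
set A := alive n h j0 INF od (rarr st rP) (iarr st aAL) (iarr st aCN) k q.
set cA := \sum_(x <- A) (size (adj x)).+1.
have cAL : (cA <= \sum_(x <- L) (size (adj x)).+1)%N.
  by rewrite /cA /A /alive big_filter big_mkcond; apply: leq_sum => v _; case: ifP.
have sL : (size L <= \sum_(x <- L) (size (adj x)).+1)%N.
  by rewrite -sum1_size; apply: leq_sum.
apply: (run_seq_frame FR (k2 := ((160 * LG + 480) * cA + 110)%N)); last first.
  rewrite /K /process_cost; set X := \sum_(_ <- L) _ in cAL sL *.
  have : ((160 * LG + 480) * cA <= (160 * LG + 480) * X)%N by rewrite leq_mul2l cAL orbT.
  have -> : (160 * LG + 560 = (160 * LG + 480) + 80)%N by lia.
  by rewrite (mulnDl _ 80%N) -/(state_list st p) -/L; lia.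
move=> st2 [eCN2 eA2 eO2] F2.
have E2 : chunk_env st2 by apply: chunk_env_frame F2 _ _ _ _ E1.
have [t2 l2 q2'] : [/\ ivar st2 vt = mid, ivar st2 vl = l & ivar st2 vq = q].
  by split; rewrite (frame_iv F2).
have [S2 P2 T2] : [/\ iarr st2 aS = iarr st aS, rarr st2 rP = rarr st rP & rarr st2 rTR = rarr st rTR].
  by split; rewrite ?(frame_ia F2) ?(frame_ra F2).
set P := rarr st rP; set S := iarr st aS; set S1 := marked n mid S A.
set lim := (B + (mid - c))%N.
have An v : v \in A -> (v < n)%N by move=> vA; apply: (alive_n HLn qh LIn vA).
have midin : (c < mid <= T)%N by lia.
have limN : (lim <= NB)%N by rewrite /lim; lia.
pose low := stored_dist n h INF S P r.
pose Val := valid_val s INF pth mid (od ^+ (h - k)) low.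
have Auniq : uniq A by apply: filter_uniq; exact: rd_uniq RD.
have CNmid : iarr st2 aCN mid = size A by rewrite eCN2 /= eqxx.
have DR := @dijkstra_run R w NB NB1 NBw n T h c mid lim NE LG EU EV HD NX (iarr st2 aAL) (iarr st2 aCN)
  S1 EW P A (fun u => stored_val h n S P r u) (fun v => P (l * n + v)%N) Val.
have {DR} DR := DR _ _ EUn EVn EW0 An.
have b1 : [/\ (0 < n <= NB)%N, (T <= NB)%N, (2 ^ h <= NB)%N, (c <= NB)%N & (mid <= NB)%N].
  by split; lia.
have b2 : [/\ (lim <= NB)%N, (2 * NE + 1 <= NB)%N, (h <= LG)%N & (2 * n <= 2 ^ LG)%N] by [].
have {DR} DR := DR b1 b2.
have S1A v : (v < n)%N -> (0 < S1 (mid * n + v))%N = (v \in A).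
  move=> vn; have e := S'E HLn qh LIn (erefl S1) mid vn.
  rewrite -/mid -/A eqxx /= in e; rewrite e; case: ifP => // _.
  by apply: (fresh_node sn od1 HLuniq LIn kh qh _ vn); exact: mid_bounds.
have {DR} DR := DR S1A (look_alive sn od1 HLuniq HLn kh qh LIn erefl) (look_dead sn od1 HLuniq HLn kh qh LIn erefl).
have vE j x : (j < lim)%N -> (j < NE)%N -> EV j \in A -> Val (EU j) x -> Val (EV j) (x - EW j).
  move=> jl jN _ vx; have [i [it im eu ev ew]] := edge_sound midin jN jl.
  by rewrite ev ew; rewrite eu in vx; apply: (valid_val_relax sn Un W1 pth_edge pth_mono od1 HLuniq kh qh LIn).
have vD u : (u < n)%N -> u \notin A -> Val u (stored_val h n S P r u).
  exact: (valid_val_dead sn pth_mono od1 HLuniq kh qh LIn).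
have {DR} DR := DR vE vD adj adjL adjN Auniq adjU adjV l S lNB.
have lmid' : l != mid by lia.
have An' : (iarr st2 aCN mid <= n)%N.
  rewrite CNmid /A /alive size_filter; apply: leq_trans (count_size _ _) _.
  by rewrite /L size_row_list in sL *.
have PlE v : v \in A -> P (l * n + v)%N = P (l * n + v)%N by [].
have Pl0 v : v \in A -> 0 <= P (l * n + v)%N by exact: (Pl_ge0 HLn qh LIn).
have VP v : v \in A -> Val v (P (l * n + v)%N).
  exact: (valid_val_alive sn pth_mono od1 HLuniq HLn kh qh LIn).
have {DR} DR := DR lmid' (esym eA2) An' erefl PlE Pl0 VP st2.
have dE : dijkstra_envS n T h c mid lim EU EV HD NX (iarr st2 aAL) (iarr st2 aCN) EW S (set_ivar st2 vlim lim).
  by case: (E2) => *; split.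
have {DR} DR := DR dE l2 _ _ _ P2 _ _.
apply: (run_seq_frame (DR _ _ _ _ _) (k2 := 6)).
- by rewrite (ce_B E2).
- by lia.
- by rewrite (ce_B E2); lia.
- by rewrite T2.
- by move=> u un; rewrite T2 leaf.
- move=> st3 [S3 D3 leaf3 ed3] F3.
  have E3 : chunk_env st3 by apply: chunk_env_frame F3 _ _ _ _ E2.
  have q3 : ivar st3 vq = q by rewrite (frame_iv F3).
  have [AL3 CN3] : iarr st3 aAL = iarr st2 aAL /\ iarr st3 aCN = iarr st2 aCN.
    by split; rewrite (frame_ia F3).
  apply: run_loop_free => //=.
    by rewrite q3; oks NB1 NBw.
  set st4 := set_ivar _ _ _.
  have out3 x : (forall v, v \in A -> x <> mid * n + v)%N -> rarr st3 rP x = P x.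
    exact: (di_out D3).
  have lo t : t != mid -> (iarr st aCN t <= n)%N -> state_list st4 t = state_list st t.
    move=> tm tn; rewrite /state_list /st4 /= AL3 CN3; apply: row_list_ext.
      by rewrite eCN2 /= (negbTE tm).
    move=> i it; apply: eO2 => j jn e; have iN : (i < n)%N by lia.
    by have [te _] := idx_inj iN jn e; move: tm; rewrite te eqxx.
  split.
  + by case: E3 => *; split.
  + by split; [exact: (di_tree D3)|].
  + apply: (sweep_inv_step sn Un Vn pth_mono od1 HLuniq HLn kh qh LIn S3 out3).
    * exact: (di_ge D3).
    * exact: (di_val D3).
    * exact: (di_mono D3).
    * move=> i im iM iA; have [j [jN jl eu ev ew]] := edge_complete midin im iM.
      have := ed3 j jl jN; rewrite ev => /(_ iA); rewrite eu /cur.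
      rewrite (stored_val_new sn od1 HLuniq HLn kh qh LIn S3 out3) ?Un //.
      by move=> h1; apply: le_trans h1; rewrite lerB // -?ew; case: ifP => _ //; lra.
    * by rewrite /= AL3 CN3.
    * exact: lo.
  + by rewrite /= q3 addn1.
  + split=> // x v vn' xr /=.
    have xm : x != mid by apply/eqP => e; move: xr; rewrite e negb_and; lia.
    split; first by rewrite S3 (S'E HLn qh LIn (erefl S1) x vn') -/mid (negbTE xm).
    by apply: out3 => u uA /(idx_inj vn' (An u uA))[e _]; rewrite e eqxx in xm.
- rewrite /dijkstra_cost -/cA; lia.
Qed.

Definition swept_level st k := level_inv n h j0 m s INF od HL U V Wt pth
  (iarr st aS) (rarr st rP) (iarr st aAL) (iarr st aCN) k.

Lemma kept_trans st1 st2 st3 : kept st1 st2 -> kept st2 st3 -> kept st1 st3.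
Proof.
by move=> k1 k2 x v vn' xr; have [-> ->] := k2 x v vn' xr; exact: k1.
Qed.

Definition sweep_cost st k :=
  (\sum_(0 <= q < 2 ^ (h - k.+1)) (process_cost (state_list st (parenttime c k.+1 q)) + 10) + 40)%N.

Lemma level_run st k : chunk_env st -> tree_empty st -> (k < h)%N -> swept_level st k.+1 ->
  ivar st vsz = (2 ^ k.+1)%N ->
  run w level st (sweep_cost st k) (fun st' =>
    [/\ chunk_env st', tree_empty st', swept_level st' k, ivar st' vsz = (2 ^ k)%N & kept st st']).
Proof.
move=> E te kh LV esz.
have [nN TN BN NEN [hL nL]] := bounds.
set Q := (2 ^ (h - k.+1))%N; set f := fun q => (process_cost (state_list st (parenttime c k.+1 q)) + 10)%N.
have Qe : (Q * 2 ^ k.+1 = 2 ^ h)%N by rewrite /Q -expnD subnK.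
have k20 : (0 < 2 ^ k.+1)%N by rewrite expn_gt0.
have -> : sweep_cost st k = (\sum_(0 <= q < Q) f q + 40)%N by [].
apply: (@run_loop_free_seq _ _ _ _ _ (\sum_(0 <= q < Q) f q + 36)%N) => //=; last by lia.
  by words NB1 NBw.
set st1 := set_ivar _ _ _.
pose I kk st' := exists q, [/\ (q <= Q)%N, chunk_env st' /\ tree_empty st', swept st' k q,
  ivar st' vq = q /\ ivar st' vsz = (2 ^ k.+1)%N & [/\ kept st st',
  forall q', (q <= q')%N -> (q' < Q)%N -> state_list st' (parenttime c k.+1 q') = state_list st (parenttime c k.+1 q') &
  (\sum_(q <= q' < Q) f q' + 10 <= kk)%N]].
apply: (run_seq (k1 := (\sum_(0 <= q < Q) f q + 10)%N) (k2 := 10)); last by lia.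
apply: (@run_while_frame _ _ _ _ I).
- move=> kk st' F [q [qQ [E' te'] sw [q' sz'] _]] /=.
  by rewrite q' sz'; have : (q * 2 ^ k.+1 <= 2 ^ h)%N; [rewrite -Qe leq_mul2r qQ orbT|move=> le; oks NB1 NBw].
- move=> kk st' F [q [qQ [E' te'] sw [q' sz'] [kp ls le]]] /=.
  rewrite q' sz' (ce_K E') -Qe leq_pmul2r // -ltnNge => ltq.
  move: le; rewrite big_ltn // => le.
  exists (process_cost (state_list st (parenttime c k.+1 q))), (\sum_(q.+1 <= q' < Q) f q' + 10)%N.
  split; last by rewrite /f in le *; lia.
  rewrite -ls //; apply: run_weaken (run_frame (process_run E' te' kh ltq sw q' sz')) _ _ => //.
  move=> st2 [[E2 te2 sw2 q2 [kp2 ls2]] F2]; exists q.+1; split=> //.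
    by split=> //; rewrite (frame_iv F2).
  split; [exact: kept_trans kp kp2| |exact: leqnn].
  move=> q1 qq1 q1Q; rewrite -ls ?(ltnW qq1) // ls2 //; first exact: parent_neq_mid.
  have R1 := li_hi sw (ltnW qq1) q1Q.
  by apply: (row_list_size HLn); [exact: rd_uniq R1|exact: rd_sub R1].
- move=> kk st' F [q [qQ [E' te'] sw [q' sz'] [kp ls le]]] /=.
  rewrite q' sz' (ce_K E') -Qe leq_pmul2r // negbK => Qq; split; first by lia.
  have qe : q = Q by lia.
  apply: run_loop_free => //=; first by oks NB1 NBw.
  split.
  + by case: E' => *; split.
  + by [].
  + by apply: (sweep_inv_end sn od1 HLuniq kh); rewrite -/Q -qe.
  + by rewrite sz' expnS mulKn.
  + by [].
- exists 0%N; split=> //.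
  + by split=> //; case: E => *; split.
  + exact: (sweep_inv_start kh LV).
Qed.

Variable X : nat.
Hypothesis X_bound : (0 < h)%N ->
  (\sum_(v <- HL) (size (adj v)).+1)%:R * (1 + 2 * ln INF / ln od) <= X%:R :> R.
Hypothesis od_gt1 : (0 < h)%N -> 1 < od.
Hypothesis INF1 : 1 <= INF.

(** [X] bounds the degrees, plus one each, summed over all lists of one level; 640 * 2 ^ h covers
    the fixed costs of at most 2 ^ h intervals. *)
Definition sweep_budget := ((160 * LG + 560) * X + 640 * 2 ^ h + 60)%N.

Lemma sweep_cost_le st k : (k < h)%N -> swept_level st k.+1 -> (sweep_cost st k <= sweep_budget - 20)%N.
Proof.
move=> kh LV; have h0 : (0 < h)%N by lia.
have : (\sum_(0 <= q < 2 ^ (h - k.+1)) \sum_(v <- state_list st (parenttime c k.+1 q)) (size (adj v)).+1 <= X)%N.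
  rewrite -(ler_nat R); apply: le_trans (X_bound h0).
  rewrite natr_sum natr_sum.
  rewrite (eq_bigr (fun q => \sum_(v <- state_list st (parenttime c k.+1 q)) (size (adj v)).+1%:R)); last first.
    by move=> q _; rewrite natr_sum.
  exact: (level_work_le sn od1 HLuniq HLn (dg := fun v => (size (adj v)).+1%:R) LV kh (od_gt1 h0) INF1 (fun v => ler0n R _)).
move=> le; rewrite /sweep_cost /sweep_budget /process_cost.
have -> : (\sum_(0 <= q < 2 ^ (h - k.+1))
    ((160 * LG + 560) * (\sum_(v <- state_list st (parenttime c k.+1 q)) (size (adj v)).+1) + 600 + 10) =
  (160 * LG + 560) * (\sum_(0 <= q < 2 ^ (h - k.+1)) \sum_(v <- state_list st (parenttime c k.+1 q)) (size (adj v)).+1)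
  + 610 * 2 ^ (h - k.+1))%N.
  under eq_bigr do rewrite -addnA.
  by rewrite big_split /= -big_distrr /= sum_nat_const_nat subn0; lia.
set A1 := ((160 * LG + 560) * _)%N; set A2 := ((160 * LG + 560) * X)%N.
have : (A1 <= A2)%N by rewrite leq_mul2l le orbT.
have : (2 ^ (h - k.+1) <= 2 ^ h)%N by rewrite leq_exp2l //; lia.
by have : (0 < 2 ^ h)%N; [rewrite expn_gt0|lia].
Qed.

Lemma levels_run st : chunk_env st -> tree_empty st -> swept_level st h ->
  run w levels st (h * sweep_budget + 20) (fun st' =>
    [/\ chunk_env st', tree_empty st', swept_level st' 0 & kept st st']).
Proof.
move=> E te LV.
have [nN TN BN NEN [hL nL]] := bounds.
apply: (@run_loop_free_seq _ _ _ _ _ (h * sweep_budget + 15)) => //=; last by lia.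
set st1 := set_ivar _ _ _.
pose I kk st' := exists k, [/\ (k <= h)%N, chunk_env st' /\ tree_empty st', swept_level st' k,
  ivar st' vsz = (2 ^ k)%N & kept st st' /\ (k * sweep_budget + 10 <= kk)%N].
apply: (@run_while_frame _ _ _ _ I).
- by move=> kk st' F _ /=; oks NB1 NBw.
- move=> kk st' F [k [kh [E' te'] sw sz' [kp le]]] /=; rewrite sz'.
  case: k kh sw sz' le => [//|k] kh sw sz' le _.
  have cl := sweep_cost_le kh sw.
  exists (sweep_cost st' k), (k * sweep_budget + 10)%N; split; last by move: le cl; rewrite mulSn {2}/sweep_budget /sweep_budget /=; lia.
  apply: run_weaken (level_run E' te' kh sw sz') _ _ => // st2 [E2 te2 sw2 z2 kp2].
  by exists k; split=> //; [lia|split=> //; exact: kept_trans kp kp2].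
- move=> kk st' F [k [kh [E' te'] sw sz' [kp le]]] /=; rewrite sz'.
  case: k kh sw sz' le => [|k] kh sw sz' le; last first.
    by rewrite expnS; have : (0 < 2 ^ k)%N; [rewrite expn_gt0|lia].
  by move=> _; split; [lia|].
- exists h; split=> //=; last by split=> //; lia.
  + by split=> //; case: E => *; split.
  + exact: ce_K E.
Qed.

End Sweep.

(** * Chunks *)

Section Adjacency.
Variables (EU EV : nat -> nat) (s : nat).

(** Mirrors [buildb]: the newest entry comes first, and the head is inserted after the tail. A loop
    occurs twice. *)
Fixpoint incident k x : seq nat :=
  if k is k'.+1 then
    (if EV k' == x then [:: k'] else [::]) ++ (if EU k' == x then [:: k'] else [::]) ++ incident k' x
  else [::].

Fixpoint heads k : seq nat :=
  if k is k'.+1 then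
    if (EV k' != s) && (EV k' \notin heads k') then rcons (heads k') (EV k') else heads k'
  else [::].

Lemma incident_lt k x j : j \in incident k x -> (j < k)%N.
Proof.
elim: k => //= k IH; rewrite !mem_cat => /or3P[]; try by case: ifP; rewrite ?inE // => _ /eqP ->.
by move/IH => /ltnW.
Qed.

Lemma incident_tail k j : (j < k)%N -> j \in incident k (EU j).
Proof.
elim: k => //= k IH; rewrite ltnS leq_eqVlt => /predU1P[->|/IH jk]; rewrite !mem_cat.
  by rewrite eqxx inE eqxx orbT.
by rewrite jk !orbT.
Qed.

Lemma incident_head k j : (j < k)%N -> j \in incident k (EV j).
Proof.
elim: k => //= k IH; rewrite ltnS leq_eqVlt => /predU1P[->|/IH jk]; rewrite !mem_cat.
  by rewrite eqxx inE eqxx.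
by rewrite jk !orbT.
Qed.

Lemma heads_uniq k : uniq (heads k).
Proof.
elim: k => //= k IH; case: ifP => // /andP[_ h].
by rewrite rcons_uniq h.
Qed.

Lemma mem_heads k v : v \in heads k -> v != s /\ exists2 j, (j < k)%N & EV j = v.
Proof.
elim: k => //= k IH; case: ifP => [/andP[h1 _]|_].
  rewrite mem_rcons inE => /orP[/eqP ->|/IH[h2 [j jk e]]]; first by split=> //; exists k.
  by split=> //; exists j => //; exact: ltnW.
by move=> /IH[h2 [j jk e]]; split=> //; exists j => //; exact: ltnW.
Qed.

Lemma heads_mem k j : (j < k)%N -> EV j != s -> EV j \in heads k.
Proof.
elim: k => //= k IH; rewrite ltnS leq_eqVlt => /predU1P[->|jk] h.
  by rewrite h /=; case: ifP => [_|/negbFE//]; rewrite mem_rcons mem_head.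
by case: ifP => _; rewrite ?mem_rcons ?inE IH ?orbT.
Qed.

Lemma size_heads k : (size (heads k) <= k)%N.
Proof.
elim: k => //= k IH; case: ifP => _; first by rewrite size_rcons.
exact: leq_trans IH _.
Qed.

(** An edge contributes only to the lists of its two ends. *)
Lemma sum_incident k (L : seq nat) : uniq L -> (\sum_(x <- L) size (incident k x) <= 2 * k)%N.
Proof.
move=> uL; elim: k => [|k IH] /=; first by rewrite big1.
have cnt y : (\sum_(x <- L) (y == x) <= 1)%N.
  rewrite (eq_bigr (fun x => if x == y then 1 else 0)%N); last by move=> x _; rewrite eq_sym; case: eqP.
  by rewrite -big_mkcond sum1_count count_uniq_mem // leq_b1.
under eq_bigr => x _ do rewrite !size_cat !(fun_if size) /=.
rewrite !big_split /=.
have := cnt (EV k); have := cnt (EU k).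
rewrite (eq_bigr (fun x => if EU k == x then 1 else 0)%N); last by move=> x _; case: eqP.
rewrite [in X in _ -> X -> _](eq_bigr (fun x => if EV k == x then 1 else 0)%N); last by move=> x _; case: eqP.
move=> h1 h2; apply: leq_trans (leq_add h2 (leq_add h1 IH)) _; lia.
Qed.

Lemma linked_ext NX NX' k p L : (forall y, (y < 2 * k)%N -> NX' y = NX y) ->
  (forall j, j \in L -> (j < k)%N) -> linked NX p L -> linked NX' p L.
Proof.
move=> e; elim: L p => //= j L IH p Lk [p0 [pj lk]]; split=> //; split=> //.
have jk := Lk j (mem_head _ _).
rewrite e; last by lia.
by apply: IH lk => i iL; apply: Lk; rewrite inE iL orbT.
Qed.

End Adjacency.

(** * Loading, indexing and folding the edges of a chunk *)

Section Build.
Context {R : realType} (w NB : nat).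
Hypothesis NB1 : (1 < NB)%N.
Hypothesis NBw : (8 * NB * NB < 2 ^ w)%N.
Implicit Types (st : state R).

Lemma load_run st c B cnt :
  ivar st vc = c -> ivar st vB = B -> ivar st vcnt = cnt ->
  (c + cnt <= NB)%N -> (B + cnt <= NB)%N ->
  run w load st (60 * cnt + 20) (fun st' =>
    [/\ forall j, iarr st' aEU j = if (B <= j < B + cnt)%N then iarr st aTail (c + (j - B))%N else iarr st aEU j,
        forall j, iarr st' aEV j = if (B <= j < B + cnt)%N then iarr st aHead (c + (j - B))%N else iarr st aEV j &
        forall j, rarr st' rEW j = if (B <= j < B + cnt)%N then rarr st rWt (c + (j - B))%N else rarr st rEW j]).
Proof.
move=> ec eB en cN BN.
apply: (@run_loop_free_seq _ _ _ _ _ (60 * cnt + 15)) => //=; last by lia.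
  by words NB1 NBw.
set st1 := set_ivar _ _ _.
pose I kk st' := exists k, [/\ ivar st' vk = k, (k <= cnt)%N, (60 * (cnt - k) + 10 <= kk)%N,
  forall j, iarr st' aEU j = if (B <= j < B + k)%N then iarr st aTail (c + (j - B))%N else iarr st aEU j &
  (forall j, iarr st' aEV j = if (B <= j < B + k)%N then iarr st aHead (c + (j - B))%N else iarr st aEV j) /\
  forall j, rarr st' rEW j = if (B <= j < B + k)%N then rarr st rWt (c + (j - B))%N else rarr st rEW j].
apply: (@run_while_frame _ _ _ _ I).
- by [].
- move=> kk st' F [k [ek kc le e1 [e2 e3]]] /=.
  have [c' [B' n']] : ivar st' vc = c /\ ivar st' vB = B /\ ivar st' vcnt = cnt.
    by split; [|split]; rewrite (frame_iv F).
  have [T' [H' W']] : iarr st' aTail = iarr st aTail /\ iarr st' aHead = iarr st aHead /\ rarr st' rWt = rarr st rWt.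
    by split; [|split]; rewrite ?(frame_ia F) ?(frame_ra F).
  rewrite ek n' -ltnNge => lt; exists 45, (60 * (cnt - k.+1) + 10)%N; split; last by lia.
  apply: run_loop_free => //=; first by rewrite ek c' B'; oks NB1 NBw.
  exists k.+1; rewrite /= ek c' B' T' H' W'; split=> //; [by rewrite addn1| |].
    move=> j; rewrite e1; case: eqP => [->|ne].
      by rewrite ifT; [rewrite addKn|lia].
    by congr (if _ then _ else _); lia.
  split=> j; rewrite ?e2 ?e3; case: eqP => [->|ne].
  + by rewrite ifT; [rewrite addKn|lia].
  + by congr (if _ then _ else _); lia.
  + by rewrite ifT; [rewrite addKn|lia].
  + by congr (if _ then _ else _); lia.
- move=> kk st' F [k [ek kc le e1 [e2 e3]]] /=.
  rewrite ek (frame_iv F) //= en negbK => ck; split; first by lia.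
  have ke : k = cnt by lia.
  by rewrite ke in e1 e2 e3.
- exists 0%N; rewrite subn0; split=> //=; first by lia.
    by move=> j; rewrite ifF //; lia.
  by split=> j; rewrite ifF //; lia.
Qed.

Lemma build_run st n c T NE s :
  ivar st vn = n -> ivar st vc = c -> ivar st vT = T -> ivar st vNE = NE -> ivar st vs = s ->
  (n <= NB)%N -> (c <= NB)%N -> (T <= NB)%N -> (2 * NE + 2 <= NB)%N -> (s < n)%N ->
  (forall j, (j < NE)%N -> (iarr st aEU j < n)%N) ->
  (forall j, (j < NE)%N -> (iarr st aEV j < n)%N) ->
  (forall v, (v < n)%N -> iarr st aHD (c * n + v)%N = 0%N) ->
  (forall v, (v < n)%N -> iarr st aHF (c * n + v)%N = 0%N) ->
  let EU := iarr st aEU in let EV := iarr st aEV in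
  run w build st (200 * NE + 40) (fun st' =>
    [/\ forall x, (x < n)%N -> linked (iarr st' aNX) (iarr st' aHD (c * n + x)%N) (incident EU EV NE x),
      row_list n (iarr st' aAL) (iarr st' aCN) T = heads EV s NE,
      forall t v, (v < n)%N -> t != c -> iarr st' aHD (t * n + v)%N = iarr st aHD (t * n + v)%N &
      forall t v, (v < n)%N -> t != c -> iarr st' aHF (t * n + v)%N = iarr st aHF (t * n + v)%N]).
Proof.
move=> en ec eT eN es nN cN TN NEN sn EUn EVn HD0 HF0 EU EV.
apply: (@run_loop_free_seq _ _ _ _ _ (200 * NE + 35)) => //=; last by lia.
  by words NB1 NBw.
apply: (@run_loop_free_seq _ _ _ _ _ (200 * NE + 30)) => //=; last by lia.
  by words NB1 NBw.
set st1 := set_ivar _ _ _.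
pose J k st' := [/\ forall x, (x < n)%N -> linked (iarr st' aNX) (iarr st' aHD (c * n + x)%N) (incident EU EV k x),
   ivar st' vna = size (heads EV s k) /\
     (forall i, (i < size (heads EV s k))%N -> iarr st' aAL (T * n + i)%N = nth 0%N (heads EV s k) i),
   forall v, (v < n)%N -> (0 < iarr st' aHF (c * n + v))%N = (v \in heads EV s k),
   forall t v, (v < n)%N -> t != c -> iarr st' aHD (t * n + v)%N = iarr st aHD (t * n + v)%N &
   forall t v, (v < n)%N -> t != c -> iarr st' aHF (t * n + v)%N = iarr st aHF (t * n + v)%N].
pose I kk st' := exists k, [/\ ivar st' vk = k, (k <= NE)%N, (200 * (NE - k) + 10 <= kk)%N & J k st'].
have szh k : (k <= NE)%N -> (size (heads EV s k) <= n)%N.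
  move=> kN; rewrite -[X in (_ <= X)%N](size_iota 0); apply: uniq_leq_size; first exact: heads_uniq.
  by move=> v /mem_heads[_ [j jk <-]]; rewrite mem_iota /= add0n EVn //; exact: leq_trans jk kN.
apply: (run_seq_frame (Qa := J NE) (k1 := (200 * NE + 10)%N) (k2 := 6)); last by lia.
  apply: (@run_while_frame _ _ _ _ I).
  - by [].
  - move=> kk st' F [k [ek kN le [j1 [j2 j3] j4 j5 j6]]].
    have [n' [c' [T' [N' s']]]] : ivar st' vn = n /\ ivar st' vc = c /\ ivar st' vT = T /\
      ivar st' vNE = NE /\ ivar st' vs = s by do ! split; rewrite (frame_iv F).
    have [U' V'] : iarr st' aEU = EU /\ iarr st' aEV = EV by split; rewrite (frame_ia F).
    rewrite /= ek N' -ltnNge => lt; exists 190, (200 * (NE - k.+1) + 10)%N; split; last by lia.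
    have un := EUn k lt; have vn' := EVn k lt; rewrite -/EU -/EV in un vn'.
    apply: (@run_loop_free_seq _ _ _ _ _ 185) => //=; rewrite ?ek ?U'.
    apply: (@run_loop_free_seq _ _ _ _ _ 180) => //=; rewrite ?ek ?V'.
    apply: (@run_loop_free_seq _ _ _ _ _ 165) => //=; rewrite ?ek ?n' ?c'.
      by oks NB1 NBw.
    apply: (@run_loop_free_seq _ _ _ _ _ 148) => //=; rewrite ?ek ?n' ?c'.
      by oks NB1 NBw.
    apply: (@run_loop_free_seq _ _ _ _ _ 131) => //=; rewrite ?ek ?n' ?c'.
      by oks NB1 NBw.
    apply: (@run_loop_free_seq _ _ _ _ _ 114) => //=; rewrite ?ek ?n' ?c'.
      by oks NB1 NBw.
    set st2 := set_iarr _ _ _ _.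
    have [vk2 [vna2 [v2 [c2 [n2 [T2 s2]]]]]] : ivar st2 vk = k /\ ivar st2 vna = size (heads EV s k) /\
      ivar st2 vv = EV k /\ ivar st2 vc = c /\ ivar st2 vn = n /\ ivar st2 vT = T /\ ivar st2 vs = s.
      by do ! split.
    have [AL2 HF2] : iarr st2 aAL = iarr st' aAL /\ iarr st2 aHF = iarr st' aHF by [].
    (* The two cells written, 2k and 2k + 1, lie above all cells used by the older lists, so
       [linked_ext] carries those over. *)
    have lk2 x : (x < n)%N -> linked (iarr st2 aNX) (iarr st2 aHD (c * n + x)%N) (incident EU EV k.+1 x).
      move=> xn; pose HDk := iarr st' aHD; pose NXk := iarr st' aNX.
      pose HD1 := upd HDk (c * n + EU k)%N (2 * k + 1)%N.
      have hd1 y : (y < n)%N -> HD1 (c * n + y)%N = if y == EU k then (2 * k + 1)%N else HDk (c * n + y)%N.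
        by move=> yn; rewrite /HD1 /= idx_eq // eqxx.
      have hd2 : iarr st2 aHD (c * n + x)%N = if x == EV k then (2 * k + 2)%N else HD1 (c * n + x)%N.
        by rewrite /HD1 /HDk /st2 /= !idx_eq // !eqxx.
      have [NX2 -> nx2] : exists2 NX2, iarr st2 aNX = NX2 & forall y, NX2 y =
          if y == (2 * k + 1)%N then HD1 (c * n + EV k)%N
          else if y == (2 * k)%N then HDk (c * n + EU k)%N else NXk y by eexists.
      have base y : (y < n)%N -> linked NX2 (HDk (c * n + y)%N) (incident EU EV k y).
        move=> yn; apply: linked_ext (j1 y yn) => [z z2k|j]; last exact: incident_lt.
        by rewrite nx2 !ifF //; lia.
      have half y : (y < n)%N -> linked NX2 (HD1 (c * n + y)%N)
          ((if EU k == y then [:: k] else [::]) ++ incident EU EV k y).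
        move=> yn; rewrite hd1 // [EU k == y]eq_sym; have [->|_] := eqVneq y (EU k); last exact: base.
        rewrite cat1s /=; split; first by lia.
        split; first by lia.
        by rewrite addn1 subn1 /= nx2 ifF ?eqxx; [exact: base|lia].
      rewrite hd2 /= [EV k == x]eq_sym; have [->|_] := eqVneq x (EV k); last exact: half.
      rewrite cat1s /=; split; first by lia.
      split; first by lia.
      rewrite (_ : 2 * k + 2 - 1 = 2 * k + 1)%N; last by lia.
      by rewrite nx2 eqxx; exact: half.
    have HD2 t v : (v < n)%N -> t != c -> iarr st2 aHD (t * n + v)%N = iarr st aHD (t * n + v)%N.
      by move=> vn tc; rewrite /st2 /= !idx_eq // (negbTE tc) /=; exact: j5.
    clearbody st2.
    have fin st3 hs : hs = heads EV s k.+1 -> ivar st3 vk = k -> iarr st3 aNX = iarr st2 aNX -> iarr st3 aHD = iarr st2 aHD ->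
      ivar st3 vna = size hs ->
      (forall i, (i < size hs)%N -> iarr st3 aAL (T * n + i)%N = nth 0%N hs i) ->
      (forall v, (v < n)%N -> (0 < iarr st3 aHF (c * n + v))%N = (v \in hs)) ->
      (forall t v, (v < n)%N -> t != c -> iarr st3 aHF (t * n + v)%N = iarr st aHF (t * n + v)%N) ->
      run w (vk ::= $vk + #1)%prog st3 10 (I (200 * (NE - k.+1) + 10)%N).
      move=> -> ek3 nx3 hd3 na3 al3 hf3 hfo3.
      apply: run_loop_free => //=; first by rewrite ek3; oks NB1 NBw.
      exists k.+1; split=> //=; first by rewrite ek3 addn1.
      by split=> //=; rewrite ?nx3 ?hd3.
    have szk1 := szh k.+1 lt; have szk := szh k kN.
    have same : heads EV s k = heads EV s k.+1 -> run w (vk ::= $vk + #1)%prog st2 10 (I (200 * (NE - k.+1) + 10)%N).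
      move=> e; apply: (fin st2 _ e) => //.
      + by move=> i hi; rewrite AL2 j3.
      + by move=> v vn; rewrite HF2 j4.
      + by move=> t v vn tc; rewrite HF2 j6.
    apply: (run_seq (k1 := 90) (k2 := 10)) => //.
    apply: (@run_if _ _ _ _ _ _ _ 70) => //=; rewrite v2 s2 -eqn_leq.
      move=> evs; have ne : EV k != s by rewrite evs.
      apply: (@run_if _ _ _ _ _ _ _ 45) => //=; rewrite ?c2 ?n2 ?v2 ?HF2 ?leqn0.
      + by oks NB1 NBw.
      + move=> hf0; have nin : EV k \notin heads EV s k by rewrite -j4 // (eqP hf0).
        have hk1 : rcons (heads EV s k) (EV k) = heads EV s k.+1 by rewrite /= ne nin.
        have szlt : (size (heads EV s k) < n)%N by rewrite -(size_rcons _ (EV k)) hk1.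
        apply: run_loop_free => //=; first by rewrite c2 n2 v2 T2 vna2; oks NB1 NBw.
        apply: (fin _ _ hk1) => //=.
        * by rewrite vna2 size_rcons addn1.
        * move=> i; rewrite size_rcons nth_rcons T2 n2 vna2 v2 eqn_add2l ltnS leq_eqVlt AL2.
          by case: eqP => [->|_] /=; [rewrite ltnn|move=> il; rewrite il j3].
        * move=> v vn; rewrite c2 n2 v2 idx_eq // eqxx /= mem_rcons inE HF2.
          by case: eqP => //= _; exact: j4.
        * move=> t v vn tc; rewrite c2 n2 v2 idx_eq // (negbTE tc) /= HF2; exact: j6.
      + move=> hf; apply: run_loop_free => //=; apply: same.
        by rewrite /= ne -j4 // lt0n hf.
    rewrite negbK => evs; apply: run_loop_free => //=; apply: same.
    by rewrite /= evs.
  - move=> kk st' F [k [ek kN le jj]].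
    rewrite /= ek (frame_iv F) //= eN negbK => Nk; split; first by lia.
    by have -> : NE = k by lia.
  - exists 0%N; split=> //=; first by rewrite subn0.
    by split=> //= v vn; rewrite ?HD0 ?HF0.
move=> st2 [j1 [j2 j3] j4 j5 j6] F.
have T2 : ivar st2 vT = T by rewrite (frame_iv F).
apply: run_loop_free => //=; split=> //=.
rewrite T2 j2 /row_list /= eqxx; apply: (@eq_from_nth _ 0%N); first by rewrite size_map size_iota.
move=> i; rewrite size_map size_iota => hi.
by rewrite (nth_map 0%N) ?size_iota // nth_iota // j3.
Qed.

(** [bi_M] and [bi_Mj] make [aM] an inverse of the map from positions to vertex pairs; the pairs are
    thus distinct, and at most n * n positions are in use. *)
Record base_inv (n m : nat) (U V : nat -> nat) (Wt : nat -> R) c B st : Prop := Basinv {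
  bi_sound : forall j, (j < B)%N -> exists i, [/\ (i < c)%N, (i < m)%N, iarr st aEU j = U i,
    iarr st aEV j = V i & rarr st rEW j = Wt i];
  bi_complete : forall i, (i < c)%N -> (i < m)%N -> exists j, [/\ (j < B)%N, iarr st aEU j = U i,
    iarr st aEV j = V i & rarr st rEW j <= Wt i];
  bi_M : forall u v x, (u < n)%N -> (v < n)%N -> iarr st aM (u * n + v)%N = x.+1 ->
    [/\ (x < B)%N, iarr st aEU x = u & iarr st aEV x = v];
  bi_Mj : forall j, (j < B)%N -> iarr st aM (iarr st aEU j * n + iarr st aEV j)%N = j.+1;
  bi_B : (B <= minn c m)%N }.

Lemma base_inv_ext n m U V Wt c B st st' :
  (forall j, (j < B)%N -> [/\ iarr st' aEU j = iarr st aEU j, iarr st' aEV j = iarr st aEV j &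
    rarr st' rEW j = rarr st rEW j]) -> iarr st' aM = iarr st aM ->
  base_inv n m U V Wt c B st -> base_inv n m U V Wt c B st'.
Proof.
move=> e eM [h1 h2 h3 h4 h5]; split=> //.
- by move=> j jB; have [-> -> ->] := e j jB; exact: h1.
- move=> i ic im; have [j [jB e1 e2 e3]] := h2 i ic im.
  by exists j; have [-> -> ->] := e j jB.
- move=> u v x un vn'; rewrite eM => ex; have [xB e1 e2] := h3 u v x un vn' ex.
  by have [-> ->] := e x xB.
- by move=> j jB; have [-> -> _] := e j jB; rewrite eM; exact: h4.
Qed.

Lemma base_inv_size n m U V Wt c B st : (forall i, (i < m)%N -> (U i < n)%N /\ (V i < n)%N) ->
  base_inv n m U V Wt c B st -> (B <= n * n)%N.
Proof.
move=> UVn [h1 h2 h3 h4 h5].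
pose f j := (iarr st aEU j * n + iarr st aEV j)%N.
rewrite -(size_iota 0 B) -(size_map f) -[X in (_ <= X)%N](size_iota 0); apply: uniq_leq_size.
  rewrite map_inj_in_uniq ?iota_uniq // => i j; rewrite !mem_iota !add0n /= => iB jB e.
  by have := h4 i iB; rewrite -/(f i) e /f h4 // => -[].
move=> y /mapP[j]; rewrite !mem_iota !add0n => /= jB ->; rewrite /f.
have [i [_ im -> -> _]] := h1 j jB; have [un vn'] := UVn i im.
by have : ((U i).+1 * n <= n * n)%N; [rewrite leq_mul2r un orbT|rewrite mulSn; lia].
Qed.

Lemma fold_run st n m U V Wt c B cnt :
  ivar st vn = n -> ivar st vc = c -> ivar st vB = B -> ivar st vcnt = cnt ->
  iarr st aTail = U -> iarr st aHead = V -> rarr st rWt = Wt ->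
  (forall i, (i < m)%N -> (U i < n)%N /\ (V i < n)%N) ->
  (c + cnt <= m)%N -> (m <= NB)%N -> (n <= NB)%N ->
  base_inv n m U V Wt c B st ->
  run w fold st (120 * cnt + 20) (fun st' => exists2 B', ivar st' vB = B' &
    base_inv n m U V Wt (c + cnt) B' st').
Proof.
move=> en ec eB ecn eT eH eW UVn cm mN nN B0.
apply: (@run_loop_free_seq _ _ _ _ _ (120 * cnt + 15)) => //=; last by lia.
  by words NB1 NBw.
set st1 := set_ivar _ _ _.
pose I kk st' := exists k B', [/\ ivar st' vk = k, (k <= cnt)%N, (120 * (cnt - k) + 10 <= kk)%N,
  ivar st' vB = B' & base_inv n m U V Wt (c + k) B' st'].
apply: (@run_while_frame _ _ _ _ I).
- by [].
- move=> kk st' F [k [B' [ek kc le eB' BI]]].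
  have [n' [c' N']] : ivar st' vn = n /\ ivar st' vc = c /\ ivar st' vcnt = cnt.
    by do ! split; rewrite (frame_iv F).
  have [T' [H' W']] : iarr st' aTail = U /\ iarr st' aHead = V /\ rarr st' rWt = Wt.
    by do ! split; rewrite ?(frame_ia F) ?(frame_ra F).
  rewrite /= ek N' -ltnNge => lt; exists 110, (120 * (cnt - k.+1) + 10)%N; split; last by lia.
  set i := (c + k)%N; have im : (i < m)%N by rewrite /i; lia.
  have [un vltn] := UVn i im; have BB := bi_B BI.
  apply: (@run_loop_free_seq _ _ _ _ _ 100) => //=; rewrite ?ek ?c' ?T'.
    by oks NB1 NBw.
  apply: (@run_loop_free_seq _ _ _ _ _ 92) => //=; rewrite ?ek ?c' ?H'.
    by oks NB1 NBw.
  apply: (@run_loop_free_seq _ _ _ _ _ 80) => //=; rewrite ?n' -/i.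
    by oks NB1 NBw.
  set st2 := set_ivar _ _ _.
  have [vk2 [B2 [u2 [v2 [j2 [c2 n2]]]]]] : ivar st2 vk = k /\ ivar st2 vB = B' /\ ivar st2 vu = U i /\
    ivar st2 vv = V i /\ ivar st2 vj = iarr st' aM (U i * n + V i)%N /\ ivar st2 vc = c /\ ivar st2 vn = n.
    by do ! split.
  have BI2 : base_inv n m U V Wt i B' st2 by apply: base_inv_ext BI.
  have [W2 M2] : rarr st2 rWt = Wt /\ iarr st2 aM = iarr st' aM by [].
  clearbody st2.
  have fin st3 B3 : ivar st3 vk = k -> ivar st3 vB = B3 -> base_inv n m U V Wt i.+1 B3 st3 ->
      run w (vk ::= $vk + #1)%prog st3 10 (I (120 * (cnt - k.+1) + 10)%N).
    move=> ek3 eB3 BI3; apply: run_loop_free => //=; first by rewrite ek3; oks NB1 NBw.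
    exists k.+1, B3; split=> //=; first by rewrite ek3 addn1.
    by rewrite addnS; apply: base_inv_ext BI3.
  have mono_c : (minn i m <= minn i.+1 m)%N by lia.
  case: BI2 => h1 h2 h3 h4 h5.
  apply: (run_seq (k1 := 68) (k2 := 10)) => //.
  apply: (@run_if _ _ _ _ _ _ _ 60) => //=; rewrite ?j2; first by oks NB1 NBw.
  + case e : (iarr st' aM _) => [//|x] _.
    have [|xB xU xV] := h3 (U i) (V i) x un vltn; first by rewrite M2.
    have xN : (x < NB)%N by lia.
    apply: (@run_if _ _ _ _ _ _ _ 20) => //=; rewrite ?j2 ?e ?c2 ?vk2 ?W2 ?subn1 /= -/i.
    * by oks NB1 NBw.
    * move=> lew; apply: run_loop_free => //=; apply: (fin _ B') => //; split=> //.
      - by move=> j jB; have [i' [q1 q2 q3 q4 q5]] := h1 j jB; exists i'; split=> //; exact: ltnW.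
      - move=> i'; rewrite ltnS leq_eqVlt => /predU1P[->|i'i] i'm; last exact: h2.
        by exists x.
      - exact: leq_trans mono_c.
    * rewrite -ltNge => ltw; apply: run_loop_free => //=.
        by rewrite j2 e c2 vk2 -/i; oks NB1 NBw.
      rewrite j2 e c2 vk2 W2 -/i subn1 /=.
      apply: (fin _ B') => //; split=> //=.
      - move=> j jB; case: eqP => [->|_]; first by exists i.
        by have [i' [q1 q2 q3 q4 q5]] := h1 j jB; exists i'; split=> //; exact: ltnW.
      - move=> i'; rewrite ltnS leq_eqVlt => /predU1P[->|i'i] i'm.
          by exists x; rewrite eqxx.
        have [j [jB q1 q2 q3]] := h2 i' i'i i'm; exists j; split=> //.
        by case: eqP => // jx; apply: le_trans q3; rewrite jx; exact: ltW.
      - exact: leq_trans mono_c.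
  + rewrite -leqNgt leqn0 => /eqP e.
    apply: run_loop_free => //=.
      by rewrite ?B2 ?u2 ?v2 ?n2 ?c2 ?vk2 -/i; oks NB1 NBw.
    rewrite B2 u2 v2 n2 c2 vk2 W2 -/i.
    apply: (fin _ B'.+1) => //=; first by rewrite addn1.
    split=> /=.
    - move=> j; rewrite ltnS leq_eqVlt; case: eqP => [-> _|jn /= jB].
        by exists i.
      by have [i' [q1 q2 q3 q4 q5]] := h1 j jB; exists i'; split=> //; exact: ltnW.
    - move=> i'; rewrite ltnS leq_eqVlt => /predU1P[->|i'i] i'm.
        by exists B'; rewrite eqxx.
      have [j [jB q1 q2 q3]] := h2 i' i'i i'm; exists j; rewrite ifF; last by lia.
      by rewrite ifF; [rewrite ifF; [split=> //; exact: ltnW|lia]|lia].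
    - move=> u v x un' vn'; rewrite idx_eq //; case: ifP => [/andP[/eqP -> /eqP ->]|_].
        by rewrite addn1 => -[<-]; rewrite eqxx.
      move=> ex; have [xB q1 q2] := h3 u v x un' vn' ex.
      by rewrite !ifF; [split=> //; exact: ltnW|lia|lia].
    - move=> j; rewrite ltnS leq_eqVlt; case: eqP => [-> _|jn /= jB].
        by rewrite eqxx addn1.
      rewrite ifF; first exact: h4.
      (* An older edge between the same vertices would have its position recorded in [aM], against
         [e]. *)
      apply/eqP => ee; have := h4 j jB; rewrite M2 ee e => //.
    - by rewrite /i in h5 *; lia.
- move=> kk st' F [k [B' [ek kc le eB' BI]]].
  rewrite /= ek (frame_iv F) //= ecn negbK => ck; split; first by lia.
  by exists B' => //; rewrite (_ : cnt = k) //; lia.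
- exists 0%N, B; rewrite subn0 addn0; split=> //=; first by lia.
  by apply: base_inv_ext B0.
Qed.

End Build.

(** * From one chunk to the next *)

Section Chunks.
Context {R : realType} (w NB : nat).
Hypothesis NB1 : (1 < NB)%N.
Hypothesis NBw : (8 * NB * NB < 2 ^ w)%N.
Variables (n h m s LG X : nat) (INF od : R).
Variables (U V : nat -> nat) (Wt : nat -> R) (pth : nat -> nat -> R -> Prop).
Hypothesis sn : (s < n)%N.
Hypothesis Un : forall i, (i < m)%N -> (U i < n)%N.
Hypothesis Vn : forall i, (i < m)%N -> (V i < n)%N.
Hypothesis W1 : forall i, (i < m)%N -> 1 <= Wt i.
Hypothesis pth_s : forall t, pth t s 0.
Hypothesis pth_edge : forall t i x, (i < t)%N -> (i < m)%N -> pth t (U i) x -> pth t (V i) (x + Wt i).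
Hypothesis pth_mono : forall t t' v x y, (t <= t')%N -> x <= y -> pth t v x -> pth t' v y.
Hypothesis od1 : 1 <= od.
Hypothesis od_gt1 : (0 < h)%N -> 1 < od.
Hypothesis INF1 : 1 <= INF.
Hypothesis bounds : [/\ (n <= NB)%N, (m + 2 ^ h <= NB)%N, (4 * 2 ^ h + 2 <= NB)%N,
  (h <= LG)%N & (2 * n <= 2 ^ LG)%N].
Hypothesis h_large : (m <= 2 ^ h)%N \/ (n * n <= 2 ^ h)%N.
Hypothesis X_bound : (0 < h)%N -> (6 * 2 ^ h)%:R * (1 + 2 * ln INF / ln od) <= X%:R :> R.
Implicit Types (st : state R).
Local Notation Good := (good n m s INF U V Wt pth).
Local Notation K := (2 ^ h)%N.

Definition state_dist st t v := INF - stored_val h n (iarr st aS) (rarr st rP) t v.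

(** The rows after time [j * K] are still blank, the row of that time is exact, and
    all earlier times are approximated. *)
Record chunk_inv j st : Prop := Chinv {
  ci_n : ivar st vn = n; ci_m : ivar st vm = m; ci_s : ivar st vs = s; ci_K : ivar st vK = K;
  ci_c : ivar st vc = (j * K)%N;
  ci_U : iarr st aTail = U; ci_V : iarr st aHead = V; ci_W : rarr st rWt = Wt;
  ci_inf : rvar st xinf = INF; ci_del : rvar st xdel = od;
  ci_base : base_inv n m U V Wt (j * K) (ivar st vB) st;
  ci_tree : tree_empty n st;
  ci_HD : forall t v, (v < n)%N -> (j * K <= t)%N -> iarr st aHD (t * n + v)%N = 0%N;
  ci_HF : forall t v, (v < n)%N -> (j * K <= t)%N -> iarr st aHF (t * n + v)%N = 0%N;
  ci_S : forall t v, (v < n)%N -> (j * K < t)%N -> iarr st aS (t * n + v)%N = 0%N;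
  ci_P : forall t v, (v < n)%N -> (j * K < t)%N -> rarr st rP (t * n + v)%N = 0;
  ci_head : forall v, (v < n)%N -> v != s -> rarr st rP (j * K * n + v)%N <> 0 ->
    exists i, [/\ (i < j * K)%N, (i < m)%N & V i = v];
  ci_last : Good (j * K)%N 1 (fun v => INF - rarr st rP (j * K * n + v)%N);
  ci_done : forall t, (t <= j * K)%N -> Good t (od ^+ h) (state_dist st t) }.

Lemma good_ext t b D D' : (forall v, (v < n)%N -> D' v = D v) -> Good t b D -> Good t b D'.
Proof.
move=> e [h1 h2 h3 h4 h5 h6]; split; first by rewrite e.
- by move=> i it im; rewrite !e ?Un ?Vn //; exact: h2.
- by move=> v vn'; rewrite e //; exact: h3.
- by move=> v vn'; rewrite e //; exact: h4.
- by move=> v vn'; rewrite e //; exact: h5.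
- by move=> v vn'; rewrite e //; exact: h6.
Qed.

Lemma stored_val_old j S P S' P' t v : (v < n)%N -> (t <= j * K)%N ->
  (forall x, (x < j * K)%N -> S' (x * n + v)%N = S (x * n + v)%N) ->
  (forall x, (x <= j * K)%N -> P' (x * n + v)%N = P (x * n + v)%N :> R) ->
  stored_val h n S' P' t v = stored_val h n S P t v.
Proof.
move=> vn' tj eS eP; rewrite /stored_val; have Tj := chunk_end_le tj.
rewrite (@next_stored_ext _ (fun x => 0 < S (x * n + v))%N) ?eP //.
  exact: leq_trans (@next_stored_le _ _ _ _) Tj.
by move=> y /andP[_ yT]; rewrite eS //; exact: leq_trans yT Tj.
Qed.

Definition chunk_cost := ((160 * LG + 480) * (6 * K) + 1000 * K + h * sweep_budget h LG X + 700)%N.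

Section OneChunk.
Variables (j B NE : nat) (EU EV HD NX : nat -> nat) (EW : nat -> R).
Local Notation c := (j * K)%N.
Local Notation T := (c + K)%N.
Local Notation HL := (heads EV s NE).
Local Notation adj := (incident EU EV NE).
Hypothesis cm : (c < m)%N.
Hypothesis BK : (B <= K)%N.
Hypothesis NEK : (NE <= 2 * K)%N.
Hypothesis EUn : forall j, (j < NE)%N -> (EU j < n)%N.
Hypothesis EVn : forall j, (j < NE)%N -> (EV j < n)%N.
Hypothesis EW0 : forall j, (j < NE)%N -> 0 < EW j.
Hypothesis adjL : forall x, (x < n)%N -> linked NX (HD (c * n + x)%N) (adj x).
Hypothesis edge_sound : forall t j, (c < t <= T)%N -> (j < NE)%N -> (j < B + (t - c))%N ->
  exists i, [/\ (i < t)%N, (i < m)%N, EU j = U i, EV j = V i & EW j = Wt i].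
Hypothesis edge_complete : forall t i, (c < t <= T)%N -> (i < t)%N -> (i < m)%N ->
  exists j, [/\ (j < NE)%N, (j < B + (t - c))%N, EU j = U i, EV j = V i & EW j <= Wt i].
Local Notation env := (chunk_env n h j B INF od EU EV HD NX EW).
Local Notation slevel := (swept_level n h j m s INF od HL U V Wt pth).

Lemma heads_n v : v \in HL -> (v < n)%N /\ v != s.
Proof. by case/mem_heads => vs [i iN e]; split=> //; rewrite -e; exact: EVn. Qed.

(** At most 2K edges give at most 2K heads and at most 4K incidences. *)
Lemma sum_heads : (\sum_(v <- HL) (size (adj v)).+1 <= 6 * K)%N.
Proof.
under eq_bigr => v _ do rewrite -addn1.
rewrite big_split /= sum1_size.
have := sum_incident EU EV NE (heads_uniq EV s NE); have := size_heads EV s NE; lia.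
Qed.

(** At the end of a chunk every listed head counts as alive, so nothing is rounded: the factor stays
    1, and errors do not accumulate over the chunks. *)
Lemma boundary_run st : env st -> tree_empty n st -> ivar st vl = c -> ivar st vt = T ->
  state_list n st T = HL ->
  (forall t v, (v < n)%N -> (c < t)%N -> iarr st aS (t * n + v)%N = 0%N) ->
  (forall t v, (v < n)%N -> (c < t)%N -> rarr st rP (t * n + v)%N = if (t == T) && (v == s) then INF else 0) ->
  (forall v, (v < n)%N -> v != s -> rarr st rP (c * n + v)%N <> 0 -> v \in HL) ->
  Good c 1 (fun v => INF - rarr st rP (c * n + v)%N) ->
  run w dijkstra st ((160 * LG + 480) * (6 * K) + 100) (fun st' =>
    [/\ env st', tree_empty n st', slevel st' h,
      forall x v, (v < n)%N -> x != T -> iarr st' aS (x * n + v)%N = iarr st aS (x * n + v)%N /\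
        rarr st' rP (x * n + v)%N = rarr st rP (x * n + v)%N &
      forall v, (v < n)%N -> v != s -> rarr st' rP (T * n + v)%N <> 0 -> v \in HL]).
Proof.
move=> E [tok leaf] el et eL S0 P0 Ph Gc.
have [nN mN KN hL nL] := bounds.
have K0 : (0 < K)%N by rewrite expn_gt0.
have INF0 : 0 <= INF by exact: le_trans ler01 INF1.
set S := iarr st aS; set P := rarr st rP; set S1 := marked n T S HL.
have midin : (c < T <= T)%N by lia.
set lim := (B + (T - c))%N.
pose Val := valid_val s INF pth T 1 (fun=> 0).
have CNT : iarr st aCN T = size HL by rewrite -eL /state_list size_row_list.
have HLn v : v \in HL -> (v < n)%N by case/heads_n.
have szH : (size HL <= n)%N.
  rewrite -[X in (_ <= X)%N](size_iota 0); apply: uniq_leq_size; first exact: heads_uniq.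
  by move=> v /HLn vn'; rewrite mem_iota.
have S1E x v : (v < n)%N -> S1 (x * n + v)%N = if (x == T) && (v \in HL) then 1%N else S (x * n + v)%N.
  move=> vn'; rewrite /S1 /marked; case: mapP => [[u uA /(idx_inj vn' (HLn u uA))[-> ->]]|H].
    by rewrite eqxx uA.
  by case: eqP => //= xm; case: ifP => // vA; case: H; exists v; rewrite ?xm.
have b1 : [/\ (0 < n <= NB)%N, (T <= NB)%N, (K <= NB)%N, (c <= NB)%N & (T <= NB)%N] by split; lia.
have b2 : [/\ (lim <= NB)%N, (2 * NE + 1 <= NB)%N, (h <= LG)%N & (2 * n <= 2 ^ LG)%N].
  by split=> //; rewrite /lim; lia.
have DR := @dijkstra_run R w NB NB1 NBw n T h c T lim NE LG EU EV HD NX (iarr st aAL) (iarr st aCN)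
  S1 EW P HL (fun u => P (T * n + u)%N) (fun v => P (c * n + v)%N) Val b1 b2 EUn EVn EW0 HLn.
have S1A v : (v < n)%N -> (0 < S1 (T * n + v))%N = (v \in HL).
  by move=> vn'; rewrite S1E // eqxx /=; case: ifP => // _; rewrite /S S0 //; lia.
have cT SS : next_stored SS h T T = T by apply: next_stored_none => y; lia.
have lA u : u \in HL -> next_stored (fun x => 0 < S1 (x * n + u))%N h T T = T by rewrite cT.
have lD u : (u < n)%N -> u \notin HL ->
    P (next_stored (fun x => 0 < S1 (x * n + u))%N h T T * n + u)%N = P (T * n + u)%N by rewrite cT.
have {DR lA lD} DR := DR S1A lA lD.
have vE i x : (i < lim)%N -> (i < NE)%N -> EV i \in HL -> Val (EU i) x -> Val (EV i) (x - EW i).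
  move=> il iN _ vx; have [i' [it im eu ev ew]] := edge_sound midin iN il.
  rewrite ev ew; rewrite eu in vx; apply: (valid_val_edge W1 pth_edge pth_mono) => //.
  by rewrite add0r (le_trans ler01) // W1.
have PT u : (u < n)%N -> P (T * n + u)%N = if u == s then INF else 0.
  by move=> un; rewrite /P P0 // ?eqxx //; lia.
(* Off the list only the source has a finite distance; the others store 0, which stands for
   [INF]. *)
have vD u : (u < n)%N -> u \notin HL -> Val u (P (T * n + u)%N).
  move=> un uH; rewrite PT //; case: eqP => [->|/eqP us].
    by split; rewrite ?eqxx ?subrr ?mulr0 //; right; exact: pth_s.
  by split; rewrite ?subr0 ?mul1r //; left.
have lNB : (c <= NB)%N by lia.
have lT : c != T by lia.
have aN x i : (x < n)%N -> i \in adj x -> (i < NE)%N by move=> _; exact: incident_lt.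
have aU i : (i < NE)%N -> i \in adj (EU i) by exact: incident_tail.
have aV i : (i < NE)%N -> i \in adj (EV i) by exact: incident_head.
have {DR} DR := DR vE vD adj adjL aN (heads_uniq EV s NE) aU aV c S lNB lT (esym eL).
have szH' : (iarr st aCN T <= n)%N by rewrite CNT.
have PlE v : v \in HL -> P (c * n + v)%N = P (c * n + v)%N by [].
have Pl0 v : v \in HL -> 0 <= P (c * n + v)%N.
  by move=> /HLn vn'; have := g_inf Gc vn'; rewrite /= -/P; lra.
have VP v : v \in HL -> Val v (P (c * n + v)%N).
  move=> /HLn vn'; have -> : P (c * n + v)%N = INF - (INF - P (c * n + v)%N) by lra.
  apply: (valid_val_good pth_mono _ Gc) => //; first by lia.
    exact: (g_1 Gc).
  exact: (g_0 Gc).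
have dE : dijkstra_envS n T h c T lim EU EV HD NX (iarr st aAL) (iarr st aCN) EW S (set_ivar st vlim lim).
  by case: (E) => *; split.
have {DR} DR := DR szH' erefl PlE Pl0 VP st dE el _ _ _ erefl tok leaf.
have DR' : run w dijkstra st (dijkstra_cost LG HL adj) (fun st' => [/\ iarr st' aS = S1,
     dijkstra_inv n T lim NE EU EV EW P HL (fun u => P (T * n + u)%N) (fun v => P (c * n + v)%N) Val (fun=> False) [::] st',
     forall u, (u < n)%N -> rarr st' rTR (n + u)%N = 0 &
     forall i, (i < lim)%N -> (i < NE)%N -> EV i \in HL ->
       cur n T HL (fun u => P (T * n + u)%N) (rarr st' rP) (EU i) - EW i <= rarr st' rP (T * n + EV i)%N]).
  apply: DR; first by rewrite (ce_B E).
    by lia.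
  by rewrite (ce_B E); lia.
apply: run_weaken (run_frame DR') _ _.
  by rewrite /dijkstra_cost leq_add2r leq_mul2l sum_heads orbT.
move=> st' [[S' D' leaf' ed'] F'].
have E' : env st' by apply: chunk_env_frame F' _ _ _ _ E.
have out x : (forall v, v \in HL -> x <> T * n + v)%N -> rarr st' rP x = P x by exact: (di_out D').
have row x v : (v < n)%N -> x != T -> rarr st' rP (x * n + v)%N = P (x * n + v)%N.
  move=> vn' xT; apply: out => u uH /(idx_inj vn' (HLn u uH))[xe _].
  by rewrite xe eqxx in xT.
have dead v : (v < n)%N -> v \notin HL -> rarr st' rP (T * n + v)%N = P (T * n + v)%N.
  move=> vn' vH; apply: out => u uH /(idx_inj vn' (HLn u uH))[_ ve].
  by rewrite ve uH in vH.
have sH : s \notin HL by apply/negP => /mem_heads[]; rewrite eqxx.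
have jT : T = (j.+1 * K)%N by rewrite mulSn addnC.
have AL' : row_list n (iarr st' aAL) (iarr st' aCN) T = HL.
  by rewrite (frame_ia F') // (frame_ia F').
have dT v : stored_dist n h INF (iarr st' aS) (rarr st' rP) T v = INF - rarr st' rP (T * n + v)%N.
  by rewrite /stored_dist jT stored_val_mul.
have dc v : (v < n)%N -> stored_dist n h INF (iarr st' aS) (rarr st' rP) c v = INF - P (c * n + v)%N.
  by move=> vn'; rewrite /stored_dist stored_val_mul row.
have GT : Good T 1 (fun v => INF - rarr st' rP (T * n + v)%N) /\
    forall v, (v < n)%N -> 0 <= INF - rarr st' rP (T * n + v)%N.
  apply: good_valid_val => //.
  - by rewrite dead // PT // eqxx subrr.
  - move=> v vn'; case: (boolP (v \in HL)) => vH; first by have := di_ge D' vH; lra.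
    by rewrite dead // PT //; case: eqP => _; rewrite ?subrr ?subr0.
  - move=> v vn'; have -> : INF - (INF - rarr st' rP (T * n + v)%N) = rarr st' rP (T * n + v)%N by lra.
    case: (boolP (v \in HL)) => vH; first exact: (di_val D').
    by rewrite dead //; exact: vD.
  - move=> i iT im; have [i' [iN il eu ev ew]] := edge_complete midin iT im.
    (* The source is not listed, but its distance 0 satisfies every triangle inequality. *)
    have [Vs|Vs] := eqVneq (V i) s.
      rewrite Vs dead // PT // eqxx subrr.
      have : 0 <= INF - rarr st' rP (T * n + U i)%N.
        case: (boolP (U i \in HL)) => uH; last by rewrite dead ?Un // PT ?Un //; case: eqP => _; rewrite ?subrr ?subr0.
        by have [_ h1 _] := di_val D' uH.
      by have := W1 im; lra.
    have VH : V i \in HL by rewrite -ev heads_mem // ev.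
    have := ed' i' il iN; rewrite ev => /(_ VH); rewrite eu /cur.
    have -> : (if U i \in HL then rarr st' rP (T * n + U i)%N else P (T * n + U i)%N) = rarr st' rP (T * n + U i)%N.
      by case: ifP => // uH; rewrite dead ?Un ?uH.
    by lra.
split=> //.
- by split; [exact: (di_tree D')|].
- split.
  + move=> q; rewrite subnn expn0 ltnS leqn0 => /eqP ->.
    have pT : parenttime c h 0 = T by rewrite /parenttime mul1n.
    split; rewrite ?pT ?AL' ?mul1n ?mul0n ?addn0 //.
    * move=> v vn' vH; rewrite dc // dT dead // PT //.
      case: (eqVneq v s) => [->|vs].
        by have := g_s Gc; rewrite /= -/P => ->; rewrite subrr mulr0.
      (* A vertex at finite distance at time [c] is a head, so an unlisted one other than the source
         is infinitely far at both ends. *)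
      have -> : P (c * n + v)%N = 0.
        by apply/eqP; apply/negPn/negP => /eqP p0; move: vH; rewrite Ph.
      by rewrite !subr0 ler_peMl // (le_trans ler01).
    * by move=> v vH; rewrite stored_val_mul.
    * by move=> v vH; rewrite jT stored_val_mul.
    * by left.
    * by left.
    * exact: heads_uniq.
    * rewrite subnn expr0; apply: good_ext Gc => v vn'; exact: dc.
    * rewrite subnn expr0; case: GT => GT _; apply: good_ext GT => v vn'; exact: dT.
    * move=> v vn'; rewrite dT dc //.
      case: (boolP (v \in HL)) => vH; first by have := di_mono D' vH; lra.
      rewrite dead // PT //; case: (eqVneq v s) => [->|vs].
        by have := g_s Gc; rewrite /= -/P => ->; rewrite subrr.
      have -> : P (c * n + v)%N = 0.
        by apply/eqP; apply/negPn/negP => /eqP p0; move: vH; rewrite Ph.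
      exact: lexx.
    * by left.
  + move=> v vn' k1 q1 k1h q1h /=; rewrite S' S1E //.
    have := mid_bounds c k1 q1; have := right_le c k1h q1h => r1 r2.
    rewrite ifF; last by apply/negbTE; rewrite negb_and; apply/orP; left; lia.
    by rewrite /S S0 //; lia.
  + move=> t v ct vn'; rewrite S' S1E // ifF; last by apply/negbTE; rewrite negb_and; apply/orP; left; lia.
    by rewrite /S S0 //; lia.
  + exact: AL'.
- move=> x v vn' xT; split; last exact: row.
  by rewrite S' S1E // (negbTE xT).
- move=> v vn' vs; case: (boolP (v \in HL)) => // vH.
  by rewrite dead // PT // (negbTE vs).
Qed.

End OneChunk.

(** The last chunk may reach beyond [m], whereas [fold] stops there; the invariant depends on the
    time only through its minimum with [m]. *)
Lemma base_inv_time c c' B st : minn c m = minn c' m ->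
  base_inv n m U V Wt c B st -> base_inv n m U V Wt c' B st.
Proof.
move=> e [h1 h2 h3 h4 h5]; split=> //; last by rewrite -e.
- move=> i iB; have [i' [q1 q2 q3 q4 q5]] := h1 i iB; exists i'; split=> //; lia.
- by move=> i ic im; apply: h2 => //; lia.
Qed.

Lemma chunk_run j st : chunk_inv j st -> (j * K < m)%N -> run w chunk st chunk_cost (chunk_inv j.+1).
Proof.
move=> CI cm; have [nN mN KN hL nL] := bounds.
have K0 : (0 < K)%N by rewrite expn_gt0.
set c := (j * K)%N in cm *; set T := (c + K)%N; set B := ivar st vB.
have jT : (j.+1 * K = T)%N by rewrite mulSn addnC.
set cnt := if (T <= m)%N then K else (m - c)%N.
have cntE : (c + cnt = minn T m)%N by rewrite /cnt; case: ifP; rewrite /T; lia.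
have cntK : (cnt <= K)%N by rewrite /cnt; case: ifP; rewrite /T; lia.
set NE := (B + cnt)%N.
have BI := ci_base CI; rewrite -/c -/B in BI.
have UVn i : (i < m)%N -> (U i < n)%N /\ (V i < n)%N by move=> im; rewrite Un ?Vn.
(* If m <= K, the number of edges bounds [B]; otherwise the number of vertex pairs does. *)
have BK : (B <= K)%N.
  have := bi_B BI; have : (B <= n * n)%N.
    exact: (base_inv_size NB1 NBw UVn BI).
  by case: h_large; lia.
have NEK : (NE <= 2 * K)%N by rewrite /NE; lia.
have cT : (c < T)%N by rewrite /T; lia.
have TN : (T <= NB)%N by rewrite /T; lia.
have en := ci_n CI; have em := ci_m CI; have es := ci_s CI; have eK := ci_K CI; have ec := ci_c CI.
rewrite -/c in ec.
pose Qc st' := [/\ ivar st' vc = T, base_inv n m U V Wt T (ivar st' vB) st', tree_empty n st',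
  forall t v, (v < n)%N -> (T <= t)%N -> iarr st' aHD (t * n + v)%N = 0%N /\ iarr st' aHF (t * n + v)%N = 0%N &
  [/\ forall t v, (v < n)%N -> (T < t)%N -> iarr st' aS (t * n + v)%N = 0%N /\ rarr st' rP (t * n + v)%N = 0,
    forall v, (v < n)%N -> v != s -> rarr st' rP (T * n + v)%N <> 0 ->
      exists i, [/\ (i < T)%N, (i < m)%N & V i = v],
    Good T 1 (fun v => INF - rarr st' rP (T * n + v)%N) &
    forall t, (t <= T)%N -> Good t (od ^+ h) (state_dist st' t)]].
suff main : run w chunk st chunk_cost Qc.
  apply: run_weaken (run_frame main) _ _ => // st' [[q1 q2 q3 q4 [q5 q6 q7 q8]] F].
  split; rewrite ?jT //.
  - by rewrite (frame_iv F).
  - by rewrite (frame_iv F).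
  - by rewrite (frame_iv F).
  - by rewrite (frame_iv F).
  - by rewrite (frame_ia F) // (ci_U CI).
  - by rewrite (frame_ia F) // (ci_V CI).
  - by rewrite (frame_ra F) // (ci_W CI).
  - by rewrite (frame_rv F) // (ci_inf CI).
  - by rewrite (frame_rv F) // (ci_del CI).
  - by move=> t v vn' tT; have [] := q4 t v vn' tT.
  - by move=> t v vn' tT; have [] := q4 t v vn' tT.
  - by move=> t v vn' tT; have [] := q5 t v vn' tT.
  - by move=> t v vn' tT; have [] := q5 t v vn' tT.
rewrite /chunk_cost.
set KD := ((160 * LG + 480) * (6 * K) + 100)%N.
set KL := (h * sweep_budget h LG X + 20)%N.
set R3 := (120 * cnt + 20 + 10)%N.
set R2 := (KD + (KL + R3 + 2) + 20)%N.
apply: (@run_loop_free_seq _ _ _ _ _ (R2 + 60 * cnt + 200 * NE + 150)) => //; last first.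
  by rewrite /R2 /R3 /KL /KD /=; move: cntK NEK; clearbody cnt NE; lia.
  2: by rewrite /= ec eK -/T; oks NB1 NBw.
rewrite /= ec eK -/T.
apply: (@run_loop_free_seq _ _ _ _ _ (R2 + 60 * cnt + 200 * NE + 130)) => //=; last by lia.
  by rewrite en es; oks NB1 NBw.
rewrite en es.
apply: (@run_seq _ _ _ _ _ 18 (R2 + 60 * cnt + 200 * NE + 105)); last by lia.
set st2 := set_rarr _ _ _ _.
apply: (run_weaken (k := 18) (Q := fun st3 => st3 = set_ivar st2 vcnt cnt)) => //.
  apply: (@run_if _ _ _ _ _ _ _ 8) => //=; rewrite em => hT.
    by apply: run_loop_free => //=; rewrite eK /cnt hT.
  by apply: run_loop_free => //=; rewrite em ec ?/cnt ?(negbTE hT) //; oks NB1 NBw.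
move=> st3 ->.
apply: (@run_loop_free_seq _ _ _ _ _ (R2 + 60 * cnt + 200 * NE + 95)) => //=; last by lia.
  by oks NB1 NBw.
rewrite -/B -/NE.
set st4 := set_ivar _ _ _.
have Hload := @load_run R w NB NB1 NBw st4 c B cnt ec erefl erefl.
apply: (run_seq_frame (Hload _ _) (k2 := (R2 + 200 * NE + 70)%N)); try lia.
move=> {Hload} st5 [eEU eEV eEW] F5; rewrite /= in eEU eEV eEW.
have BI5 : base_inv n m U V Wt c B st5.
  apply: base_inv_ext BI; last by rewrite (frame_ia F5).
  move=> i iB; rewrite eEU eEV eEW; have -> : (B <= i < B + cnt)%N = false by lia.
  by [].
set EU := iarr st5 aEU; set EV := iarr st5 aEV; set EW := rarr st5 rEW.
have EUo i : (B <= i < B + cnt)%N -> EU i = U (c + (i - B))%N.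
  by move=> iB; rewrite /EU eEU iB (ci_U CI).
have EVo i : (B <= i < B + cnt)%N -> EV i = V (c + (i - B))%N.
  by move=> iB; rewrite /EV eEV iB (ci_V CI).
have EWo i : (B <= i < B + cnt)%N -> EW i = Wt (c + (i - B))%N.
  by move=> iB; rewrite /EW eEW iB (ci_W CI).
have esnd t i : (c < t <= T)%N -> (i < NE)%N -> (i < B + (t - c))%N ->
   exists i', [/\ (i' < t)%N, (i' < m)%N, EU i = U i', EV i = V i' & EW i = Wt i'].
  move=> ct iN it; have [iB|Bi] := ltnP i B.
    have [i' [q1 q2 q3 q4 q5]] := bi_sound BI5 iB; exists i'; split=> //; lia.
  have iB : (B <= i < B + cnt)%N by rewrite Bi iN.
  by exists (c + (i - B))%N; rewrite EUo ?EVo ?EWo //; split=> //; lia.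
have ecmp t i : (c < t <= T)%N -> (i < t)%N -> (i < m)%N ->
   exists j, [/\ (j < NE)%N, (j < B + (t - c))%N, EU j = U i, EV j = V i & EW j <= Wt i].
  move=> ct it im; have [ic|ci] := ltnP i c.
    by have [i' [q1 q2 q3 q4]] := bi_complete BI5 ic im; exists i'; split=> //; rewrite /NE; lia.
  have iB : (B <= B + (i - c) < B + cnt)%N by lia.
  exists (B + (i - c))%N; rewrite EUo ?EVo ?EWo // (_ : c + (B + (i - c) - B) = i)%N; last by lia.
  by split=> //; rewrite /NE; lia.
have Tin : (c < T <= T)%N by lia.
have TcK : (T - c = K)%N by rewrite /T; lia.
have lB i : (i < NE)%N -> (i < B + (T - c))%N by rewrite TcK /NE; lia.
have EUn i : (i < NE)%N -> (EU i < n)%N.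
  by move=> iN; have [i' [q1 q2 -> q4 q5]] := esnd T i Tin iN (lB i iN); exact: Un.
have EVn i : (i < NE)%N -> (EV i < n)%N.
  by move=> iN; have [i' [q1 q2 q3 -> q5]] := esnd T i Tin iN (lB i iN); exact: Vn.
have EW0 i : (i < NE)%N -> 0 < EW i.
  move=> iN; have [i' [q1 q2 q3 q4 ->]] := esnd T i Tin iN (lB i iN).
  exact: lt_le_trans ltr01 (W1 q2).
have [n5 [c5 [T5 [N5 s5]]]] : ivar st5 vn = n /\ ivar st5 vc = c /\ ivar st5 vT = T /\ ivar st5 vNE = NE /\ ivar st5 vs = s.
  by do ! split; rewrite (frame_iv F5) /= ?en ?ec ?es.
have HD5 t v : (v < n)%N -> (c <= t)%N -> iarr st5 aHD (t * n + v)%N = 0%N /\ iarr st5 aHF (t * n + v)%N = 0%N.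
  by move=> vn' ct; rewrite (frame_ia F5) // (frame_ia F5) //= (ci_HD CI) // (ci_HF CI).
have Hb := @build_run R w NB NB1 NBw st5 n c T NE s n5 c5 T5 N5 s5 nN _ TN _ sn EUn EVn.
apply: (run_seq_frame (Hb _ _ _ _) (k2 := (R2 + 20)%N)); try lia.
  by move=> v vn'; have [] := HD5 c v vn' (leqnn _).
  by move=> v vn'; have [] := HD5 c v vn' (leqnn _).
move=> {Hb} st6 [adjL eL HD6 HF6] F6.
apply: (@run_loop_free_seq _ _ _ _ _ (R2 + 10)) => //=; last by lia.
apply: (@run_loop_free_seq _ _ _ _ _ R2) => //=; last by lia.
set st7 := set_ivar _ _ _.
set HD := iarr st6 aHD in adjL; set NX := iarr st6 aNX in adjL.
have eS7 : iarr st7 aS = iarr st aS by rewrite /st7 /= (frame_ia F6) // (frame_ia F5).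
have eP7 : rarr st7 rP = upd (rarr st rP) (T * n + s)%N (rvar st xinf).
  by rewrite /st7 /= (frame_ra F6) // (frame_ra F5).
have eT7 : rarr st7 rTR = rarr st rTR by rewrite /st7 /= (frame_ra F6) // (frame_ra F5).
have E7 : chunk_env n h j B INF od EU EV HD NX EW st7.
  by split=> //; rewrite /st7 /= ?(frame_iv F6) ?(frame_ia F6) ?(frame_ra F6) ?(frame_rv F6) //;
    rewrite ?(frame_iv F5) ?(frame_ia F5) ?(frame_ra F5) ?(frame_rv F5) //= ?(ci_inf CI) ?(ci_del CI) ?en ?eK ?ec.
have te7 : tree_empty n st7 by rewrite /tree_empty eT7; exact: ci_tree CI.
have l7 : ivar st7 vl = c by rewrite /st7 /= (frame_iv F6) // (frame_iv F5) /= ?ec.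
have t7 : ivar st7 vt = T by rewrite /st7 /= (frame_iv F6) // (frame_iv F5).
have L7 : state_list n st7 T = heads EV s NE by exact: eL.
have S7 t v : (v < n)%N -> (c < t)%N -> iarr st7 aS (t * n + v)%N = 0%N.
  by move=> vn' ct; rewrite eS7; exact: (ci_S CI).
have P7 t v : (v < n)%N -> (c < t)%N -> rarr st7 rP (t * n + v)%N = if (t == T) && (v == s) then INF else 0.
  by move=> vn' ct; rewrite eP7 /= idx_eq // (ci_inf CI); case: ifP => // _; exact: (ci_P CI).
have P7c v : (v < n)%N -> rarr st7 rP (c * n + v)%N = rarr st rP (c * n + v)%N.
  by move=> vn'; rewrite eP7 /= idx_eq // (_ : (c == T) = false) //; apply/negbTE; rewrite neq_ltn cT.
have H7 v : (v < n)%N -> v != s -> rarr st7 rP (c * n + v)%N <> 0 -> v \in heads EV s NE.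
  move=> vn' vs; rewrite P7c // => /(ci_head CI vn' vs)[i [ic im e]].
  have iT : (i < T)%N by exact: ltn_trans ic cT.
  have [i' [q1 q2 q3 q4 q5]] := ecmp T i Tin iT im.
  by rewrite -e -q4; apply: heads_mem => //; rewrite q4 e.
have G7 : Good c 1 (fun v => INF - rarr st7 rP (c * n + v)%N).
  by apply: good_ext (ci_last CI) => v vn'; rewrite P7c.
have BR := boundary_run cm BK NEK EUn EVn EW0 adjL esnd ecmp E7 te7 l7 t7 L7 S7 P7 H7 G7.
apply: (run_seq_frame BR (k2 := (KL + R3 + 2)%N)); last by lia.
move=> st8 [E8 te8 lv8 row8 hd8] F8.
have b8 : [/\ (n <= NB)%N, (T <= NB)%N, (B + K <= NB)%N, (2 * NE + 1 <= NB)%N &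
  (h <= LG)%N /\ (2 * n <= 2 ^ LG)%N] by split; lia.
have aN x i : (x < n)%N -> i \in incident EU EV NE x -> (i < NE)%N by move=> _; exact: incident_lt.
have aU i : (i < NE)%N -> i \in incident EU EV NE (EU i) by exact: incident_tail.
have aV i : (i < NE)%N -> i \in incident EU EV NE (EV i) by exact: incident_head.
have hn v : v \in heads EV s NE -> (v < n)%N /\ v != s.
  by case/mem_heads => vs [i iN e]; split=> //; rewrite -e; exact: EVn.
have Xb : (0 < h)%N -> (\sum_(v <- heads EV s NE) (size (incident EU EV NE v)).+1)%:R *
    (1 + 2 * ln INF / ln od) <= X%:R :> R.
  move=> h0; apply: le_trans (X_bound h0); apply: ler_wpM2r.
    rewrite addr_ge0 // divr_ge0 ?mulr_ge0 ?ln_ge0 //.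
  by rewrite ler_nat; exact: (sum_heads EU EV cm BK NEK).
have LR := levels_run NB1 NBw sn Un Vn W1 pth_edge pth_mono od1 (heads_uniq EV s NE) hn b8
   EUn EVn EW0 adjL aN aU aV esnd ecmp Xb od_gt1 INF1 E8 te8 lv8.
apply: (run_seq_frame LR (k2 := R3)); last by rewrite /KL; lia.
move=> st9 [E9 te9 lv9 kp9] F9.
have r9 x v : (v < n)%N -> (x <= c)%N -> iarr st9 aS (x * n + v)%N = iarr st aS (x * n + v)%N /\
    rarr st9 rP (x * n + v)%N = rarr st rP (x * n + v)%N.
  move=> vn' xc; have xr : ~~ (c < x < T)%N by lia.
  have xT : x != T by lia.
  have [-> ->] := kp9 x v vn' xr; have [-> ->] := row8 x v vn' xT.
  by rewrite eS7 eP7 /= idx_eq // (negbTE xT).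
have rT v : (v < n)%N -> rarr st9 rP (T * n + v)%N = rarr st8 rP (T * n + v)%N.
  by move=> vn'; have [] := kp9 T v vn' _; first by lia.
have BI9 : base_inv n m U V Wt c B st9.
  apply: base_inv_ext BI5; last first.
    by rewrite (frame_ia F9) // (frame_ia F8) // /st7 /= (frame_ia F6).
  by move=> i iB; rewrite (ce_EU E9) (ce_EV E9) (ce_EW E9).
have cnt9 : ivar st9 vcnt = cnt.
  by rewrite (frame_iv F9) // (frame_iv F8) // /st7 /= (frame_iv F6) // (frame_iv F5).
have [U9 [V9 W9]] : iarr st9 aTail = U /\ iarr st9 aHead = V /\ rarr st9 rWt = Wt.
  rewrite !(frame_ia F9) // (frame_ra F9) // !(frame_ia F8) // (frame_ra F8) // /st7 /=.
  rewrite !(frame_ia F6) // (frame_ra F6) // !(frame_ia F5) // (frame_ra F5) //=.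
  by rewrite (ci_U CI) (ci_V CI) (ci_W CI).
have cm' : (c + cnt <= m)%N by rewrite cntE; lia.
have mNB : (m <= NB)%N by lia.
have FR := fold_run NB1 NBw (ce_n E9) (ce_c E9) (ce_B E9) cnt9 U9 V9 W9 UVn cm' mNB nN BI9.
apply: (run_seq_frame FR (k2 := 8)); last by rewrite /R3; lia.
move=> st10 [B' eB' BI10] F10.
apply: run_loop_free => //=.
have S10 : iarr st10 aS = iarr st9 aS by rewrite (frame_ia F10).
have P10 : rarr st10 rP = rarr st9 rP by rewrite (frame_ra F10).
split=> /=.
- by rewrite (frame_iv F10) // (ce_T E9).
- rewrite eB'; apply: (base_inv_time (c := (c + cnt)%N)); first by rewrite cntE; lia.
  by apply: base_inv_ext BI10.
- by rewrite /tree_empty /= (frame_ra F10).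
- move=> t v vn' Tt; have tc : t != c by lia.
  rewrite !(frame_ia F10) // !(frame_ia F9) // !(frame_ia F8) // /st7 /= HD6 // HF6 //.
  by apply: HD5 => //; lia.
split.
- move=> t v vn' Tt; rewrite S10 P10.
  have xr : ~~ (c < t < T)%N by lia.
  have xT : t != T by lia.
  have [-> ->] := kp9 t v vn' xr; have [-> ->] := row8 t v vn' xT.
  rewrite S7 ?P7 ?(negbTE xT) //; lia.
- move=> v vn' vs; rewrite P10 rT // => /(hd8 v vn' vs)/mem_heads[_ [i iN e]].
  have [i' [q1 q2 q3 q4 q5]] := esnd T i Tin iN (lB i iN).
  by exists i'; rewrite -e q4.
- have R8 : ready n h j m s INF od (heads EV s NE) U V Wt pth (iarr st8 aS) (rarr st8 rP)
      (iarr st8 aAL) (iarr st8 aCN) h 0 by apply: (lv_ready lv8); rewrite subnn.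
  have := rd_gr R8; rewrite subnn expr0 mul1n; apply: good_ext => v vn'.
  by rewrite P10 rT // /stored_dist -/c -/T -jT stored_val_mul.
- move=> t tT; have [tc|ct] := leqP t c.
    apply: good_ext (ci_done CI tc) => v vn'.
    rewrite /state_dist /= S10 P10 (stored_val_old vn' tc (S := iarr st aS) (P := rarr st rP)) //.
      by move=> x xc; have [] := r9 x v vn' (ltnW xc).
    by move=> x xc; have [] := r9 x v vn' xc.
  (* At level 0 every time after [c] is the right end of an interval of length 1. *)
  have qh : (t - c - 1 < 2 ^ (h - 0))%N by rewrite subn0; lia.
  have := rd_gr (lv_ready lv9 qh); rewrite subn0 expn0 muln1 (_ : c + (t - c - 1).+1 = t)%N; last by lia.
  by apply: good_ext => v vn'; rewrite /state_dist /= S10 P10.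
Qed.

Lemma chunks_run st Jm : chunk_inv 0 st -> (m <= Jm * K)%N ->
  run w chunks st (Jm * (chunk_cost + 10) + 10) (fun st' =>
    exists2 J, chunk_inv J st' & (m <= J * K)%N).
Proof.
move=> C0 mJ; have K0 : (0 < K)%N by rewrite expn_gt0.
pose I kk st' := exists j, [/\ (j <= Jm)%N, chunk_inv j st' & ((Jm - j) * (chunk_cost + 10) + 10 <= kk)%N].
apply: (@run_while_frame _ _ _ _ I).
- by move=> kk st' F _ /=.
- move=> kk st' F [j [jJ CI le]] /=; rewrite (ci_m CI) (ci_c CI) -ltnNge => lt.
  have jJ' : (j < Jm)%N by rewrite -(ltn_pmul2r K0); exact: leq_trans lt mJ.
  exists chunk_cost, ((Jm - j.+1) * (chunk_cost + 10) + 10)%N; split.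
    apply: run_weaken (chunk_run CI lt) _ _ => // st2 C2.
    by exists j.+1.
  move: le; rewrite (_ : (Jm - j) = (Jm - j.+1).+1)%N; last by lia.
  by rewrite mulSn; set A := ((Jm - j.+1) * _)%N; lia.
- move=> kk st' F [j [jJ CI le]] /=; rewrite (ci_m CI) (ci_c CI) negbK => mj.
  by split; [lia|exists j].
- by exists 0%N; rewrite subn0.
Qed.

End Chunks.

(** * Preprocessing and queries *)

(** Minimality of [h] keeps K below twice m and twice n * n, which makes K linear in m and h
    logarithmic in n. *)
Lemma chunk_exponent n m : exists2 h, (m <= 2 ^ h)%N \/ (n * n <= 2 ^ h)%N &
  (0 < h)%N -> (2 ^ h < 2 * m)%N /\ (2 ^ h < 2 * (n * n))%N.
Proof.
have ex : exists h, (m <= 2 ^ h)%N || (n * n <= 2 ^ h)%N.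
  by exists m; rewrite ltnW // ltn_expl.
case: (ex_minnP ex) => h /orP hP hmin; exists h => //.
case: h hP hmin => // h hP hmin _.
have : ~~ ((m <= 2 ^ h)%N || (n * n <= 2 ^ h)%N) by apply/negP => /hmin; rewrite ltnn.
by rewrite negb_or -!ltnNge => /andP[h1 h2]; rewrite expnS; lia.
Qed.

Section Setup.
Context {R : realType} (w NB : nat).
Hypothesis NB1 : (1 < NB)%N.
Hypothesis NBw : (8 * NB * NB < 2 ^ w)%N.
Implicit Types (st : state R).

(** The maximum starts from 1, so that [INF] is at least 1 even without edges. *)
Lemma maxw_run st m (Wt : nat -> R) W : ivar st vm = m -> (m <= NB)%N -> rarr st rWt = Wt ->
  1 <= W -> (forall i, (i < m)%N -> Wt i <= W) ->
  run w maxw st (40 * m + 30) (fun st' => 1 <= rvar st' xW <= W /\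
    forall i, (i < m)%N -> Wt i <= rvar st' xW).
Proof.
move=> em mN eW W1 Wle.
apply: (@run_loop_free_seq _ _ _ _ _ (40 * m + 25)) => //=; try lia.
apply: (@run_loop_free_seq _ _ _ _ _ (40 * m + 20)) => //=; try lia.
set st1 := set_ivar _ _ _.
pose I kk st' := exists k, [/\ ivar st' vk = k, (k <= m)%N, (40 * (m - k) + 10 <= kk)%N,
  1 <= rvar st' xW <= W & forall i, (i < k)%N -> Wt i <= rvar st' xW].
apply: (@run_while_frame _ _ _ _ I).
- by [].
- move=> kk st' F [k [ek km le /andP[x1 xW'] inn]] /=.
  rewrite ek (frame_iv F) //= em -ltnNge => lt.
  exists 30, (40 * (m - k.+1) + 10)%N; split; last by lia.
  have eW' : rarr st' rWt = Wt by rewrite (frame_ra F).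
  apply: (@run_loop_free_seq _ _ _ _ _ 10) => //=.
    by case: ifP.
  apply: run_loop_free => //=.
    by case: ifP => _ /=; rewrite ek; oks NB1 NBw.
  exists k.+1; rewrite ek eW'; case: leP => hle /=; rewrite ?ek ?eW'; split=> //; try lia.
  + by move=> i; rewrite ltnS leq_eqVlt => /predU1P[->|/inn].
  + by rewrite Wle // andbT (le_trans x1) // ltW.
  + move=> i; rewrite ltnS leq_eqVlt => /predU1P[->//|/inn h1].
    by apply: le_trans h1 _; exact: ltW.
- move=> kk st' F [k [ek km le x1 inn]] /=.
  rewrite ek (frame_iv F) //= em negbK => mk; split; first by lia.
  by split=> // i im; apply: inn; lia.
- by exists 0%N; rewrite subn0; split=> //=; [lia|rewrite lexx].
Qed.

Lemma sizeK_run st n m h : ivar st vm = m -> ivar st vn = n -> (n <= NB)%N -> (2 * m + 2 <= NB)%N ->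
  (m <= 2 ^ h)%N \/ (n * n <= 2 ^ h)%N -> ((0 < h)%N -> (2 ^ h < 2 * m)%N /\ (2 ^ h < 2 * (n * n))%N) ->
  run w sizeK st (40 * h + 40) (fun st' => ivar st' vK = (2 ^ h)%N /\ ivar st' vhh = h).
Proof.
move=> em en nN mN hP hS.
apply: (@run_loop_free_seq _ _ _ _ _ (40 * h + 35)) => //=; try lia.
apply: (@run_loop_free_seq _ _ _ _ _ (40 * h + 30)) => //=; try lia.
set st1 := set_ivar _ _ _.
pose I kk st' := exists k, [/\ ivar st' vhh = k, ivar st' vK = (2 ^ k)%N, (k <= h)%N & (40 * (h - k) + 30 <= kk)%N].
apply: (@run_while_frame _ _ _ _ I).
- move=> kk st' F [k [e1 e2 kh le]] /=.
  have en' : ivar st' vn = n by rewrite (frame_iv F).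
  by rewrite en'; split=> // _; oks NB1 NBw.
- move=> kk st' F [k [e1 e2 kh le]] /=.
  have en' : ivar st' vn = n by rewrite (frame_iv F).
  have em' : ivar st' vm = m by rewrite (frame_iv F).
  rewrite em' en' e2 -!ltnNge => /andP[h1 h2].
  have kh' : (k < h)%N.
    rewrite ltn_neqAle kh andbT; apply/eqP => ke; move: h1 h2; rewrite ke.
    by case: hP; lia.
  exists 15, (40 * (h - k.+1) + 30)%N; split; last by lia.
  have k2 : (k < 2 ^ k)%N by rewrite ltn_expl.
  apply: run_loop_free => //=; first by rewrite e1 e2; oks NB1 NBw.
  by exists k.+1; rewrite /= e1 e2 addn1 expnS mulnC; split.
- move=> kk st' F [k [e1 e2 kh le]] /=.
  have en' : ivar st' vn = n by rewrite (frame_iv F).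
  have em' : ivar st' vm = m by rewrite (frame_iv F).
  rewrite em' en' e2 -!ltnNge => hh.
  split; first by lia.
  (* The loop stops once either bound is reached, and by [hS] no power of two below 2 ^ h reaches
     one. *)
  case: (ltnP k h) => [lt|hk]; last by rewrite -(anti_leq (introT andP (conj kh hk))).
  have : (2 ^ k.+1 <= 2 ^ h)%N by rewrite leq_exp2l.
  have [|b1 b2] := hS; first by lia.
  by move: hh; rewrite expnS; lia.
- by exists 0%N; split=> //=; lia.
Qed.

End Setup.

(** * Paths and potentials *)

Section Paths.
Context {R : realType} (n : nat) (s : 'I_n) (sigma : seq (edge R n)).
Let U := nth 0%N [seq (src e : nat) | e <- sigma].
Let V := nth 0%N [seq (dst e : nat) | e <- sigma].
Let Wt := nth 0 [seq weight e | e <- sigma].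

(** The concrete instance of [pth]. Vertices are plain numbers here because that is what the arrays
    of the program hold. *)
Definition reach t (v : nat) (x : R) := exists (v' : 'I_n) p,
  [/\ v' = v :> nat, {subset p <= take t sigma}, is_path s p v' & \sum_(e <- p) weight e <= x].

Lemma reach_s t : reach t s 0.
Proof. by exists s, [::]; split=> //=; rewrite ?eqxx ?big_nil. Qed.

Lemma is_path_rcons (x : 'I_n) (p : seq (edge R n)) e : is_path x p (src e) -> is_path x (rcons p e) (dst e).
Proof. by elim: p x => /= [x /eqP ->|f p IH x /andP[-> /IH ->]] //; rewrite !eqxx. Qed.

Lemma edge_nth i : (i < size sigma)%N -> exists e,
  [/\ U i = src e, V i = dst e, Wt i = weight e & forall t, (i < t)%N -> e \in take t sigma].
Proof.
move=> im; have [e0 _] : exists e0 : edge R n, True by case: (sigma) im => // e0 *; exists e0.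
exists (nth e0 sigma i); rewrite /U /V /Wt !(nth_map e0) //; split=> // t it.
by rewrite -(nth_take _ it) mem_nth // size_take; case: ifP.
Qed.

Lemma reach_edge t i x : (i < t)%N -> (i < size sigma)%N -> reach t (U i) x -> reach t (V i) (x + Wt i).
Proof.
move=> it im [u [p [eu sub pa le]]]; have [e [e1 e2 e3 e4]] := edge_nth im.
exists (dst e), (rcons p e); split.
- by rewrite e2.
- by move=> f; rewrite mem_rcons inE => /orP[/eqP ->|/sub//]; exact: e4.
- by apply: is_path_rcons; have <- : u = src e by apply: val_inj; rewrite /= eu e1.
- by rewrite -cats1 big_cat /= big_seq1 e3 lerD2r.
Qed.

Lemma reach_mono t t' v x y : (t <= t')%N -> x <= y -> reach t v x -> reach t' v y.
Proof.
move=> tt xy [v' [p [e sub pa le]]]; exists v', p; split=> //; last exact: le_trans xy.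
move=> f /sub; rewrite -(minn_idPl tt) take_min => /mem_take; exact.
Qed.

Lemma edge_index t (e : edge R n) : e \in take t sigma -> exists i,
  [/\ (i < t)%N, (i < size sigma)%N, U i = src e, V i = dst e & Wt i = weight e].
Proof.
move=> et; exists (index e (take t sigma)).
have lt := et; rewrite -index_mem size_take_min in lt.
move: lt; rewrite leq_min => /andP[lt im].
have ne : nth e sigma (index e (take t sigma)) = e.
  by rewrite -(nth_take _ lt) nth_index.
by rewrite /U /V /Wt !(nth_map e) // ne.
Qed.

Lemma potential_path t (D : nat -> R) (x : 'I_n) p v :
  (forall i, (i < t)%N -> (i < size sigma)%N -> D (V i) <= D (U i) + Wt i) ->
  {subset p <= take t sigma} -> is_path x p v -> D v <= D x + \sum_(e <- p) weight e.
Proof.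
move=> feas; elim: p x => /= [x _ /eqP ->|e p IH x sub /andP[/eqP <- pa]]; first by rewrite big_nil addr0.
rewrite big_cons addrA; apply: le_trans (IH (dst e) _ pa) _.
  by move=> f fp; apply: sub; rewrite inE fp orbT.
have [|i [it im <- <- <-]] := @edge_index t e; first by apply: sub; rewrite mem_head.
by rewrite lerD2r; exact: feas.
Qed.

(** A path can be shortened to a simple one, which has fewer than [n] edges. *)
Lemma potential_simple t (D : nat -> R) p v (M : R) :
  (forall i, (i < t)%N -> (i < size sigma)%N -> D (V i) <= D (U i) + Wt i) ->
  (forall i, (i < size sigma)%N -> Wt i <= M) -> 0 < M -> D s = 0 ->
  {subset p <= take t sigma} -> is_path s p v -> D v < n%:R * M.
Proof.
move=> feas WM M0 Ds sub pa.
(* Shortening works on vertex sequences, hence the passage from edges to a relation. Parallel edges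
   are no longer told apart, which the uniform bound [M] permits. *)
pose E (x y : 'I_n) := has (fun e => (src e == x) && (dst e == y)) (take t sigma).
have pE : path E s (map dst p) /\ last s (map dst p) = v.
  elim: p (s) sub pa => /= [x _ /eqP -> //|e p IH x sub /andP[/eqP <- pa]].
  have [|h1 h2] := IH (dst e) _ pa; first by move=> f fp; apply: sub; rewrite inE fp orbT.
  split=> //; rewrite h1 andbT; apply/hasP; exists e; rewrite ?eqxx //.
  by apply: sub; rewrite mem_head.
case: pE => pE lv; rewrite -lv; case/shortenP: pE => q Eq uq _.
have sz : (size q < n)%N.
  by have := max_card (mem (s :: q)); rewrite (card_uniqP uq) card_ord.
have Eq' (x : 'I_n) r : path E x r -> D (last x r) <= D x + (size r)%:R * M.
  elim: r x => /= [x _|y r IH x /andP[/hasP[e et /andP[/eqP ex /eqP ey]] /IH h1]].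
    by rewrite mul0r addr0.
  apply: le_trans h1 _; have [i [it im e1 e2 e3]] := edge_index et.
  have := feas i it im; rewrite e1 e2 ex ey; have := WM i im.
  by rewrite -natr1 mulrDl mul1r; lra.
by apply: le_lt_trans (Eq' s q Eq) _; rewrite Ds add0r ltr_pM2r // ltr_nat.
Qed.

End Paths.

(** The origin of [kappa] = 12 with NB = 8 N: ten factors N >= 2 exceed the constant 8 * 8 * 8, and
    two more supply N * N. *)
Lemma word_room w N : (2 <= N)%N -> (N ^ 12 <= 2 ^ w)%N -> (8 * (8 * N) * (8 * N) < 2 ^ w)%N.
Proof.
move=> N2 Nw; apply: leq_trans Nw.
have h1 : (2 ^ 10 <= N ^ 10)%N by rewrite leq_exp2r.
rewrite (expnD N 10 2) -mulnn; apply: leq_trans (leq_mul h1 (leqnn (N * N)%N)).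
have : (0 < N * N)%N by rewrite muln_gt0; lia.
rewrite (_ : 8 * (8 * N) * (8 * N) = 8 * 8 * 8 * (N * N))%N; last by lia.
by move: (N * N)%N => a; lia.
Qed.

Section Algorithm.
Context {R : realType} (w NB n : nat) (s : 'I_n) (W eps : R) (sigma : seq (edge R n)).
Hypothesis W1 : 1 <= W.
Hypothesis sigmaW : forall e, e \in sigma -> 1 <= weight e <= W.
Hypothesis eps0 : 0 < eps.
Local Notation m := (size sigma).
Local Notation N := (n + m + 1)%N.
Hypothesis NB_ge : (8 * N <= NB)%N.
Hypothesis NBw : (8 * NB * NB < 2 ^ w)%N.
Let U := nth 0%N [seq (src e : nat) | e <- sigma].
Let V := nth 0%N [seq (dst e : nat) | e <- sigma].
Let Wt := nth 0 [seq weight e | e <- sigma].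
Variable h : nat.
Hypothesis h_large : (m <= 2 ^ h)%N \/ (n * n <= 2 ^ h)%N.
Hypothesis h_small : (0 < h)%N -> (2 ^ h < 2 * m)%N /\ (2 ^ h < 2 * (n * n))%N.
Local Notation K := (2 ^ h)%N.

Definition step : R := 1 + Num.min eps 1 / (2 * h)%:R.
Definition infinity (Wm : R) : R := (1 + eps) * n%:R * Wm.

Lemma n_gt0 : (0 < n)%N. Proof. by case: n s => [[]|]. Qed.

Lemma NB_gt1 : (1 < NB)%N.
Proof. by apply: leq_trans NB_ge; clear; lia. Qed.

Lemma K_le : (K <= 2 * m + 1)%N.
Proof. by case: h h_small => [|k] H; [clear; lia|case: (H isT); clear; lia]. Qed.

Lemma h_lt : (h < K)%N. Proof. by rewrite ltn_expl. Qed.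

Lemma UV_lt i : (i < m)%N -> (U i < n)%N /\ (V i < n)%N.
Proof. by move=> /(@edge_nth R n sigma)[e [eu ev _ _]]; rewrite /U /V eu ev !ltn_ord. Qed.

Lemma Wt_bounds i : (i < m)%N -> 1 <= Wt i <= W.
Proof.
move=> im; have [e [_ _ ew et]] := edge_nth im.
by rewrite /Wt ew; apply: sigmaW; have := et m im; rewrite take_size.
Qed.

Lemma step_ge1 : 1 <= step.
Proof. by rewrite lerDl divr_ge0 // le_min ltW //=. Qed.

Lemma step_gt1 : (0 < h)%N -> 1 < step.
Proof. by move=> h0; rewrite ltrDl divr_gt0 ?ltr0n ?muln_gt0 // lt_min eps0 ltr01. Qed.

Lemma infty_ge1 Wm : 1 <= Wm -> 1 <= infinity Wm.
Proof.
move=> h1; rewrite /infinity; have n1 : 1 <= n%:R :> R by rewrite ler1n n_gt0.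
by rewrite -[leLHS]mulr1 -[X in X * 1]mulr1 !ler_pM // lerDl ltW.
Qed.

(** The computed maximum weight [Wm] is at most [W], which the program does not know. *)
Record prepared (st : state R) : Prop := Result {
  re_par : [/\ iarr st aPar 0 = n, iarr st aPar 1 = K & rarr st rPar 1 = eps];
  re_good : exists Wm, [/\ 1 <= Wm <= W, forall i, (i < m)%N -> Wt i <= Wm,
    rarr st rPar 0 = infinity Wm &
    forall t, (t <= m)%N -> good n m s (infinity Wm) U V Wt (reach s sigma) t (step ^+ h) (state_dist n h (infinity Wm) st t)] }.

Definition preprocess_time LG X Jm := (Jm * (chunk_cost h LG X + 10) + 40 * m + 40 * h + 200)%N.

Lemma preprocess_run LG X Jm : (h <= LG)%N -> (2 * n <= 2 ^ LG)%N -> (m <= Jm * K)%N ->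
  ((0 < h)%N -> (6 * K)%:R * (1 + 2 * ln (infinity W) / ln step) <= X%:R) ->
  run w preprocess (input_state s sigma eps) (preprocess_time LG X Jm) prepared.
Proof.
move=> hL nL mJ Xb; set CK := (Jm * (chunk_cost h LG X + 10))%N.
have n0 := n_gt0; have Kle := K_le; have hK := h_lt.
apply: (@run_loop_free_seq _ _ _ _ _ (CK + 40 * m + 40 * h + 190)) => //=; last by rewrite /preprocess_time -/CK; lia.
set st0 := set_ivar _ _ _.
apply: (run_seq_frame (@maxw_run R w NB NB_gt1 NBw st0 m Wt W _ _ _ W1 _) (k2 := (CK + 40 * h + 150)%N)) => //; try lia.
  by move=> i /Wt_bounds/andP[].
move=> st1 [/andP[Wm1 WmW] Wmax] F1; set Wm := rvar st1 xW in Wm1 WmW Wmax.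
apply: (run_seq_frame (@sizeK_run R w NB NB_gt1 NBw st1 n m h _ _ _ _ h_large h_small) (k2 := (CK + 100)%N)) => //; try lia.
- by rewrite (frame_iv F1).
- by rewrite (frame_iv F1).
move=> st2 [eK eh] F2.
have en : ivar st2 vn = n by rewrite (frame_iv F2) // (frame_iv F1).
have es : ivar st2 vs = s by rewrite (frame_iv F2) // (frame_iv F1).
have em : ivar st2 vm = m by rewrite (frame_iv F2) // (frame_iv F1).
have eW : rvar st2 xW = Wm by rewrite (frame_rv F2).
have ee : rvar st2 xeps = eps by rewrite (frame_rv F2) // (frame_rv F1).
have ia x : iarr st2 x = iarr (input_state s sigma eps) x by rewrite (frame_ia F2) // (frame_ia F1).
have ra x : rarr st2 x = rarr (input_state s sigma eps) x by rewrite (frame_ra F2) // (frame_ra F1).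
apply: (@run_loop_free_seq _ _ _ _ _ (CK + 20)) => //; last by rewrite /=; lia.
  rewrite /= ?ee ?eW ?en ?eh ?es ?eK /=.
  by case: ifP => _ /=; rewrite ?ee ?eW ?en ?eh ?es ?eK /=; oks NB_gt1 NBw.
set st3 := final_state setup st2.
have [e1 e2] : rvar st3 xinf = infinity Wm /\ rvar st3 xdel = step.
  rewrite /st3 /=; case: ifP => /=; rewrite ?ee ?eW ?en ?eh ?es ?eK /infinity /step => ee1; split=> //.
    by rewrite (min_idPl ee1).
  by rewrite minC (min_idPl _) // ltW // ltNge ee1.
have INF1 := infty_ge1 Wm1.
have F3 : frame setup st2 st3 := frame_final_state setup st2.
have [P3 [c3 B3]] : rarr st3 rP = upd (fun=> 0) s (infinity Wm) /\ ivar st3 vc = 0%N /\ ivar st3 vB = 0%N.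
  by split=> //; rewrite -e1 /st3 /=; case: (rvar st2 0 <= 1) => /=; rewrite ra es.
have [p0 [p1 [q0 q1]]] : iarr st3 aPar 0 = n /\ iarr st3 aPar 1 = K /\ rarr st3 rPar 0 = infinity Wm /\ rarr st3 rPar 1 = eps.
  by rewrite -e1 /st3 /=; case: (rvar st2 0 <= 1) => /=; rewrite en eK ee.
have Pz t v : (v < n)%N -> rarr st3 rP (t * n + v)%N = if (t == 0%N) && (v == s) then infinity Wm else 0.
  by move=> vn'; rewrite P3 /= -(idx_eq t 0 vn' (ltn_ord s)) mul0n add0n.
have iz x y : x \notin [:: 0; 1; 2]%N -> iarr st3 x y = 0%N.
  rewrite !inE !negb_or => /and3P[x0 x1 x2]; rewrite (frame_ia F3) ?inE ?negb_or ?x2 // ia /=.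
  by case: x x0 x1 x2 => [|[|[|]]].
(* Before any edge, distance 0 for the source and [INF] elsewhere are exact. The claim is used with
   factor 1 for the boundary and with the full factor for the times done. *)
have G0 b : 1 <= b -> good n m s (infinity Wm) U V Wt (reach s sigma) 0 b (fun v => infinity Wm - rarr st3 rP (0 * n + v)%N).
  move=> b1; have I0 : 0 <= infinity Wm by exact: le_trans ler01 INF1.
  split=> //.
  - by rewrite Pz // !eqxx subrr.
  - by move=> v vn' vs; rewrite Pz // (negbTE vs) andbF subr0.
  - by move=> v vn'; rewrite Pz //; case: ifP => _; rewrite ?subrr ?subr0.
  - by move=> v vn'; rewrite Pz //; case: ifP => _; rewrite ?subrr ?subr0.
  - move=> v vn'; rewrite Pz //= ; case: eqP => /= [->|_]; [right|left].
      by rewrite subrr mulr0; exact: reach_s.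
    by rewrite subr0 ler_peMl.
have C0 : chunk_inv n h m s (infinity Wm) step U V Wt (reach s sigma) 0 st3.
  split=> //; try by rewrite ?(frame_iv F3) // ?(frame_ia F3) // ?(frame_ra F3) // ?ia ?ra.
  - by rewrite mul0n B3; split=> // u v x un vn'; rewrite iz.
  - split=> [i iN|u un]; rewrite (frame_ra F3) // ra /=; last by case: (n + u)%N.
    by rewrite maxxx.
  - by move=> t v vn' t0; rewrite Pz // gtn_eqF.
  - by move=> v vn' vs; rewrite mul0n Pz // (negbTE vs) andbF.
  - exact: G0.
  - move=> t; rewrite mul0n leqn0 => /eqP ->.
    have -> : state_dist n h (infinity Wm) st3 0 = (fun v => infinity Wm - rarr st3 rP (0 * n + v)%N).
      by apply: funext => v; rewrite /state_dist -(mul0n K) stored_val_mul mul0n.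
    by apply: G0; rewrite exprn_ege1 // step_ge1.
have bnd : [/\ (n <= NB)%N, (m + K <= NB)%N, (4 * K + 2 <= NB)%N, (h <= LG)%N & (2 * n <= 2 ^ LG)%N].
  by split=> //; apply: leq_trans NB_ge; lia.
have Xb' : (0 < h)%N -> (6 * K)%:R * (1 + 2 * ln (infinity Wm) / ln step) <= X%:R :> R.
  move=> h0; apply: le_trans (Xb h0); rewrite ler_wpM2l // lerD2l ler_wpM2r ?invr_ge0 ?ln_ge0 ?step_ge1 //.
  rewrite ler_wpM2l // ler_ln ?posrE ?(lt_le_trans ltr01) ?infty_ge1 //.
  by rewrite /infinity ler_wpM2l // mulr_ge0 ?addr_ge0 // ltW.
have Un i : (i < m)%N -> (U i < n)%N by case/UV_lt.
have Vn i : (i < m)%N -> (V i < n)%N by case/UV_lt.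
have Wt1 i : (i < m)%N -> 1 <= Wt i by case/Wt_bounds/andP.
have CR := @chunks_run R w NB NB_gt1 NBw n h m s LG X (infinity Wm) step U V Wt (reach s sigma)
  (ltn_ord s) Un Vn Wt1 (@reach_s _ _ _ _) (@reach_edge _ _ _ _) (@reach_mono _ _ _ _) step_ge1 step_gt1 INF1 bnd h_large Xb' st3 Jm C0 mJ.
apply: run_weaken (run_frame CR) _ _; first by rewrite -/CK; lia.
move=> st4 [[J CJ mJ'] F4]; split.
  by rewrite (frame_ia F4) // (frame_ra F4).
exists Wm; split=> //; first by rewrite Wm1.
  by rewrite (frame_ra F4).
by move=> t tm; apply: (ci_done CJ); exact: leq_trans mJ'.
Qed.
End Algorithm.

Section Query.
Context {R : realType} (w NB n : nat) (s : 'I_n) (W eps : R) (sigma : seq (edge R n)).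
Hypothesis W1 : 1 <= W.
Hypothesis sigmaW : forall e, e \in sigma -> 1 <= weight e <= W.
Hypothesis eps0 : 0 < eps.
Local Notation m := (size sigma).
Local Notation N := (n + m + 1)%N.
Hypothesis NB_ge : (8 * N <= NB)%N.
Hypothesis NBw : (8 * NB * NB < 2 ^ w)%N.
Let U := nth 0%N [seq (src e : nat) | e <- sigma].
Let V := nth 0%N [seq (dst e : nat) | e <- sigma].
Let Wt := nth 0 [seq weight e | e <- sigma].
Variable h : nat.
Hypothesis h_small : (0 < h)%N -> (2 ^ h < 2 * m)%N /\ (2 ^ h < 2 * (n * n))%N.
Local Notation K := (2 ^ h)%N.
Local Notation step := (step eps h).
Local Notation infinity := (@infinity R n eps).

Lemma query_run st INF (v : 'I_n) t : (t <= m)%N -> iarr st aPar 0 = n -> iarr st aPar 1 = K ->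
  rarr st rPar 1 = eps -> rarr st rPar 0 = INF ->
  run w query (query_state st v t) (40 * h + 200) (fun st' =>
    answer st' = if INF <= (1 + eps) * state_dist n h INF st t v then +oo%E
                 else ((1 + eps) * state_dist n h INF st t v)%:E).
Proof.
move=> tm en eK ee ei.
have NB1 := NB_gt1 NB_ge.
have Kle := K_le h_small; have K0 : (0 < K)%N by rewrite expn_gt0.
have vn' := ltn_ord v.
have tK : (chunk_end h t <= t + K - 1)%N by exact: leq_divM.
have TN : (chunk_end h t <= NB)%N by apply: leq_trans NB_ge; lia.
have aN a : (a <= 2 * n + 4 * m + 4)%N -> (a <= NB)%N by move=> le; apply: leq_trans NB_ge; lia.
apply: (@run_loop_free_seq _ _ _ _ _ (40 * h + 190)) => //=; last by lia.
apply: (@run_loop_free_seq _ _ _ _ _ (40 * h + 180)) => //=; last by lia.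
apply: (@run_loop_free_seq _ _ _ _ _ (40 * h + 170)) => //=; last by lia.
  by words NB1 NBw.
apply: (@run_loop_free_seq _ _ _ _ _ (40 * h + 160)) => //=; last by lia.
  by words NB1 NBw.
apply: (@run_loop_free_seq _ _ _ _ _ (40 * h + 140)) => //=; last by lia.
  rewrite eK -/(chunk_end h t); have a1 : (t + K <= NB)%N by apply: aN; lia.
  have a2 : (0 < t + K)%N by lia.
  by rewrite a2 /=; oks NB1 NBw.
set st1 := set_ivar _ _ _.
apply: (run_seq_frame (@lookup_run R w NB NB1 NBw st1 n (chunk_end h t) h t v _ _ _ _ _ _ _ _ _ _) (k2 := 60)) => //; try by apply: aN; lia.
  by rewrite /st1 /= eK.
2: by lia.
move=> st2 er F2.
have es : iarr st1 aS = iarr st aS by [].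
have en2 : ivar st2 vn = n by rewrite (frame_iv F2).
have eu2 : ivar st2 vu = v by rewrite (frame_iv F2).
have eA : iarr st2 = iarr st by apply: funext => x; rewrite (frame_ia F2).
have eR : rarr st2 = rarr st by apply: funext => x; rewrite (frame_ra F2).
have rN : (ivar st2 vr <= NB)%N by rewrite er; exact: leq_trans (@next_stored_le _ _ _ _) TN.
have ex : (1 + eps) * (INF - rarr st rP (ivar st2 vr * n + v)%N) = (1 + eps) * state_dist n h INF st t v.
  by rewrite er.
have nN : (n <= NB)%N by apply: aN; lia.
have vN : (v <= NB)%N by lia.
apply: run_loop_free => //=.
  by rewrite en2 eu2; case: ifP => _; oks NB1 NBw.
rewrite eR ei ee en2 eu2 ex; case: ifP => _; rewrite /answer /=.
  by [].
by [].
Qed.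

(** Induction gives (1 + y)^k (1 - k y) <= 1. As h y = e1 / 2, the second factor becomes 1 - e1 / 2,
    whose inverse is at most 1 + e1 because e1 <= 1; this explains the 2 in [step]. *)
Lemma step_expr_le : step ^+ h <= 1 + eps.
Proof.
pose e1 := Num.min eps 1.
have e0 : 0 <= e1 by rewrite le_min ltW //=.
have [ee e1le] : e1 <= eps /\ e1 <= 1 by rewrite !ge_min !lexx orbT.
case: (posnP h) => [->|h0]; first by rewrite expr0 lerDl ltW.
apply: (@le_trans _ _ (1 + e1)); last by rewrite lerD2l.
pose y := e1 / (2 * h)%:R; have h2 : (0 : R) < (2 * h)%:R by rewrite ltr0n muln_gt0.
have y0 : 0 <= y by rewrite divr_ge0 // ltW.
have hy : 2 * (h%:R * y) = e1 by rewrite mulrA -natrM mulrCA divff ?mulr1 // gt_eqF.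
have key k : (k <= h)%N -> (1 + y) ^+ k * (1 - k%:R * y) <= 1.
  elim: k => [|k IH] kh; first by rewrite expr0 mul0r subr0 mulr1.
  apply: le_trans (IH (ltnW kh)); rewrite exprSr -mulrA ler_wpM2l ?exprn_ge0 ?addr_ge0 //.
  have : 0 <= k%:R * y * y by rewrite !mulr_ge0.
  have : 0 <= y * y by rewrite mulr_ge0.
  by rewrite -natr1; nra.
have k1 := key h (leqnn h); rewrite -[1 + y]/step in k1.
have es : step = 1 + y by [].
have : 0 <= step ^+ h by rewrite exprn_ge0 // es addr_ge0.
by move: k1; set z := step ^+ h; nra.
Qed.

(** For a reachable [v], [potential_simple] gives D v < n * Wm, so (1 + eps) * D v stays below
    infinity and the test cannot succeed. When the test fails, the first alternative of [g_pth] is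
    excluded and a path exists. *)
Lemma good_answer Wm t b (D : nat -> R) (v : 'I_n) : 1 <= Wm -> (forall i, (i < m)%N -> Wt i <= Wm) ->
  b <= 1 + eps -> good n m s (infinity Wm) U V Wt (reach s sigma) t b D ->
  (dist sigma s t v <= (if (infinity Wm <= (1 + eps) * D v)%R then +oo else ((1 + eps) * D v)%:E)
     <= (1 + eps)%:E * dist sigma s t v)%E.
Proof.
move=> Wm1 WmW be G.
have e1 : 0 < 1 + eps by rewrite addr_gt0.
have D0 := g_0 G (ltn_ord v).
case: ifP => hx.
  have -> : dist sigma s t v = +oo%E.
    rewrite /dist (_ : [set _ | _ in _] = set0)%classic ?ereal_inf0 //.
    rewrite -subset0 => _ [p [sub pa] _] /=.
    have := @potential_simple R n s sigma t D p v Wm (g_edge G) WmW (lt_le_trans ltr01 Wm1) (g_s G) sub pa.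
    by move: hx; rewrite /infinity -mulrA ler_pM2l // leNgt => /negP.
  by rewrite gt0_muley ?lte_fin // lexx.
apply/andP; split.
  case: (g_pth G (ltn_ord v)) => [hb|[v' [p [e sub pa le]]]].
    by move: hx; rewrite (le_trans hb) // ler_wpM2r.
  have ev : v' = v by exact: val_inj.
  apply: (@le_trans _ _ (\sum_(e <- p) weight e)%:E).
    by apply: ereal_inf_lbound; exists p => //; split=> //; rewrite -ev.
  by rewrite lee_fin (le_trans le) // ler_wpM2r.
rewrite EFinM; apply: lee_wpmul2l; first by rewrite lee_fin ltW.
apply: le_ereal_inf_tmp => _ [p [sub pa] <-].
by rewrite lee_fin; have := potential_path (g_edge G) sub pa; rewrite (g_s G) add0r.
Qed.

End Query.

(** * Running time *)

Section Log2.
Context {R : realType}.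
Implicit Types x y : R.

Lemma ln2_gt0 : 0 < ln 2 :> R.
Proof. by rewrite ln_gt0 // ltr1n. Qed.

Lemma log2M x y : 0 < x -> 0 < y -> log2 (x * y) = log2 x + log2 y.
Proof. by move=> x0 y0; rewrite /log2 lnM // mulrDl. Qed.

Lemma log2X k : log2 (2 ^+ k) = k%:R :> R.
Proof. by rewrite /log2 lnXn // -[_ *+ k]mulr_natl mulfK // gt_eqF // ln2_gt0. Qed.

Lemma ler_log2 x y : 0 < x -> x <= y -> log2 x <= log2 y.
Proof.
move=> x0 xy; rewrite ler_wpM2r ?invr_ge0 ?(ltW ln2_gt0) // ler_ln // posrE //.
exact: lt_le_trans xy.
Qed.

Lemma exp2_le_log2 k x : (2 : R) ^+ k <= x -> k%:R <= log2 x.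
Proof. by rewrite -(log2X k); apply: ler_log2; rewrite exprn_gt0. Qed.

Lemma ln_le_log2 x : 1 <= x -> ln x <= log2 x.
Proof.
move=> x1; rewrite ler_pdivlMr ?ln2_gt0 // ler_piMr ?ln_ge0 //.
by have := @le_ln1Dx R 1; rewrite (_ : 1 + 1 = 2) // => -> //; lra.
Qed.

(** Use ln(1 - y) <= -y at y = x / (1 + x), where 1 - y is the inverse of 1 + x. *)
Lemma ln1D_ge x : 0 <= x <= 1 -> x / 2 <= ln (1 + x).
Proof.
move=> /andP[x0 x1]; have p : 0 < 1 + x by lra.
have : ln (1 + (- (x / (1 + x)))) <= - (x / (1 + x)).
  apply: le_ln1Dx; rewrite ltrN2 ltr_pdivrMr //; lra.
have -> : 1 + (- (x / (1 + x))) = (1 + x)^-1.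
  by rewrite -[X in X - _](divff (negbT (gt_eqF p))) -mulrBl addrK div1r.
rewrite lnV ?posrE // lerN2 => le; apply: le_trans le.
by rewrite ler_wpM2l // lef_pV2 ?posrE //; lra.
Qed.

End Log2.

Section Cost.
Context {R : realType}.

Lemma natr_cost (c1 c2 c3 c4 c5 c6 c7 c8 c9 c10 k x l z : nat) :
  ((c1 * l + c2) * (c3 * k) + c4 * k + x * ((c5 * l + c6) * z + c7 * k + c8) + c9 + c10)%:R =
  (c1%:R * l%:R + c2%:R) * (c3%:R * k%:R) + c4%:R * k%:R +
  x%:R * ((c5%:R * l%:R + c6%:R) * z%:R + c7%:R * k%:R + c8%:R) + c9%:R + c10%:R :> R.
Proof. by rewrite !(natrD, natrM). Qed.

(** [a] stands for log2 n, and K * Q, up to the constant [c], for the degree sums of one level;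
    every term is bounded by u = K a^2 Q. The terms with [X] add up to 160 * 18 + 560 * 3 = 60 * 76,
    the others stay below 15 * 1000. *)
Lemma chunk_cost_le (a Q c : R) h LG X : 1 <= a -> a <= Q -> 1 <= c ->
  h%:R <= 3 * a -> LG%:R <= 6 * a -> X%:R <= c * ((2 ^ h)%:R * Q) ->
  (chunk_cost h LG X + 10)%:R <= (15 * 1000 + 60 * 76 * c) * ((2 ^ h)%:R * (a * a * Q)).
Proof.
move=> a1 aQ c1 ha La Xc; rewrite /chunk_cost /sweep_budget natr_cost.
have : (1 : R) <= (2 ^ h)%:R by rewrite ler1n expn_gt0.
move: (2 ^ h)%:R Xc => k Xc.
move: h%:R LG%:R X%:R (ler0n R h) (ler0n R LG) (ler0n R X) Xc ha La => x l z x0 l0 z0 zc xa la k1.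
have a0 : 0 <= a by lra.
have Q1 : 1 <= Q by lra.
have aa : 1 <= a * a by rewrite -[leLHS]mulr1 ler_pM.
have aQ1 : 1 <= a * Q by rewrite -[leLHS]mulr1 ler_pM.
set u := k * (a * a * Q).
have h1 : a * a * Q >= a by rewrite -mulrA ler_peMr.
have h2 : 1 <= a * a * Q by lra.
have ku : k <= u by rewrite ler_peMr //; lra.
have u1 : 1 <= u by lra.
have aku : a * k <= u by rewrite mulrC ler_wpM2l //; lra.
have au : a <= u by apply: le_trans aku; rewrite ler_peMr.
have lk : l * k <= 6 * u.
  by apply: (@le_trans _ _ (6 * a * k)); [rewrite ler_wpM2r //; lra|lra].
have xk : x * k <= 3 * u.
  by apply: (@le_trans _ _ (3 * a * k)); [rewrite ler_wpM2r //; lra|lra].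
have cu : 0 <= c by lra.
have xz : x * z <= 3 * (c * u).
  apply: (@le_trans _ _ (3 * a * (c * (k * Q)))); first exact: ler_pM.
  have : c * (a * Q) * k <= c * (a * a * Q) * k.
    rewrite ler_wpM2r //; [lra|rewrite ler_wpM2l // -mulrA ler_peMl //; lra].
  by rewrite /u; lra.
have xlz : x * l * z <= 18 * (c * u).
  apply: (@le_trans _ _ (3 * a * (6 * a) * (c * (k * Q)))).
    by rewrite ler_pM ?mulr_ge0 // ler_pM.
  by rewrite /u; lra.
have cu1 : u <= c * u by rewrite ler_peMl //; lra.
by lra.
Qed.

(** By squaring: 3 * 3 >= 2 ^ 3. *)
Lemma log2_ge n : (3 <= n)%N -> 3 / 2 <= log2 n%:R :> R.
Proof.
move=> n3; have n0 : 0 < n%:R :> R by rewrite ltr0n; lia.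
have : 3%:R <= log2 (n%:R * n%:R) :> R.
  by apply: exp2_le_log2; rewrite -natrX -natrM ler_nat; nia.
by rewrite log2M //; lra.
Qed.

(** By squaring again: (3 / 2)^2 >= 2. *)
Lemma loglog2_ge n : (3 <= n)%N -> 1 / 2 <= log2 (log2 n%:R) :> R.
Proof.
move=> n3; have a1 := log2_ge n3; have a0 : 0 < log2 n%:R :> R by lra.
have : 1%:R <= log2 (log2 n%:R * log2 n%:R) :> R.
  apply: exp2_le_log2; rewrite expr1; apply: (@le_trans _ _ (3 / 2 * (3 / 2))); first by lra.
  by rewrite ler_pM //; lra.
by rewrite log2M //; lra.
Qed.

(** h <= 1 + 2 log2 n, and log2 n >= 1. *)
Lemma exponent_le n h : (3 <= n)%N -> ((0 < h)%N -> (2 ^ h < 2 * (n * n))%N) ->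
  h%:R <= 3 * log2 n%:R :> R.
Proof.
move=> n3 hs; have a1 := log2_ge n3; have n0 : 0 < n%:R :> R by rewrite ltr0n; lia.
case: (posnP h) => [->|h0]; first by lra.
have : h%:R <= log2 (2 ^+ 1 * (n%:R * n%:R)) :> R.
  by apply: exp2_le_log2; rewrite expr1 -natrX -!natrM ler_nat ltnW // hs.
by rewrite !log2M ?log2X ?mulr_gt0 //; lra.
Qed.

Lemma up_log_le n : (3 <= n)%N -> (up_log 2 (2 * n))%:R <= log2 n%:R + 2 :> R.
Proof.
move=> n3; have n0 : 0 < n%:R :> R by rewrite ltr0n; lia.
have := @up_log_gtn 2 (2 * n) isT; set k := up_log _ _ => kn.
have : k.-1%:R <= log2 (2 ^+ 1 * n%:R) :> R.
  by apply: exp2_le_log2; rewrite expr1 -natrX -!natrM ler_nat ltnW // kn //; lia.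
rewrite !log2M ?log2X //; case: (posnP k) => [->|k0]; last first.
  by rewrite -[X in _ -> X%:R <= _](prednK k0) -natr1; lra.
by have := log2_ge n3; lra.
Qed.

(** ln INF <= ln(1 + eps) + log2(n W) <= 2 M L and 1 / ln od <= 4 h / min(eps, 1) <= 12 a M / eps,
    so the fraction is at most 48 Q; 295 is 6 * 49 + 1. *)
Lemma sweep_bound_le n h (W eps M : R) : (3 <= n)%N -> 1 <= W -> 1 <= M -> 0 < eps <= M ->
  h%:R <= 3 * log2 n%:R :> R ->
  0 <= (6 * 2 ^ h)%:R * (1 + 2 * ln (infinity n eps W) / ln (step eps h)) /\
  (6 * 2 ^ h)%:R * (1 + 2 * ln (infinity n eps W) / ln (step eps h)) + 1 <=
  295 * ((2 ^ h)%:R * (log2 n%:R * M * (M * log2 (n%:R * W) / eps))).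
Proof.
move=> n3 W1 M1 /andP[e0 eM] ha.
have a1 := log2_ge n3; have n1 : 1 <= n%:R :> R by rewrite ler1n; lia.
have n0 : 0 < n%:R :> R by lra.
set a := log2 n%:R in ha a1 *; set L := log2 (n%:R * W).
have L1 : 1 <= L.
  apply: (@le_trans _ _ a); first by lra.
  by apply: ler_log2 => //; rewrite ler_peMr // ltW.
have nW : 1 <= n%:R * W by rewrite -[leLHS]mulr1 ler_pM.
have I1 : 1 <= infinity n eps W by rewrite /infinity -mulrA -[leLHS]mulr1 ler_pM //; lra.
have lI0 : 0 <= ln (infinity n eps W) by rewrite ln_ge0.
have lI : ln (infinity n eps W) <= 2 * (M * L).
  rewrite /infinity -mulrA lnM ?posrE; [|lra|lra].
  have h1 : ln (1 + eps) <= eps by apply: le_ln1Dx; lra.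
  have h2 := ln_le_log2 nW; have : 0 <= (M - 1) * (L - 1) by rewrite mulr_ge0 // subr_ge0.
  by rewrite -/L in h2 *; lra.
have Y1 : 1 <= M * L / eps.
  by rewrite ler_pdivlMr // mul1r; apply: le_trans eM _; rewrite ler_peMr //; lra.
have s0 : 0 <= (ln (step eps h))^-1.
  by rewrite invr_ge0 ln_ge0 // step_ge1.
have sI : (ln (step eps h))^-1 <= 12 * (a * (M / eps)).
  (* For h = 0 the logarithm of 1 is 0 with inverse 0, and the bound is trivial. *)
  case: (posnP h) => [->|h0].
    rewrite /step muln0 invr0 mulr0 addr0 ln1 invr0.
    by apply: mulr_ge0 => //; apply: mulr_ge0; [|apply: divr_ge0]; lra.
  pose e1 := Num.min eps 1; have e10 : 0 < e1 by rewrite lt_min e0 ltr01.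
  have h2 : 1 <= h%:R :> R by rewrite ler1n.
  have d0 : 0 < e1 / (2 * h)%:R by rewrite divr_gt0 // ltr0n muln_gt0.
  have e11 : e1 <= 1 by rewrite ge_min lexx orbT.
  have := @ln1D_ge R (e1 / (2 * h)%:R); rewrite (ltW d0) ler_pdivrMr ?ltr0n ?muln_gt0 //.
  rewrite mul1r (le_trans e11) ?ler1n ?muln_gt0 // => /(_ isT) le.
  have le' : (ln (step eps h))^-1 <= (e1 / (2 * h)%:R / 2)^-1.
    by rewrite lef_pV2 ?posrE ?divr_gt0 ?(lt_le_trans _ le) ?divr_gt0 ?ltr0n ?muln_gt0.
  apply: le_trans le' _; rewrite !invf_div natrM mulrA.
  (* eps / M is at most eps because M >= 1, and at most 1 because eps <= M. *)
  have eMe : eps / M <= e1.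
    rewrite le_min !ler_pdivrMr ?mul1r ?eM ?andbT; [|lra|lra].
    by rewrite ler_peMr // ltW.
  have : e1^-1 <= M / eps by rewrite -invf_div lef_pV2 ?posrE ?divr_gt0 //; lra.
  move=> hM; apply: (@le_trans _ _ (2 * (2 * (3 * a)) * (M / eps))); last by lra.
  by rewrite ler_pM ?mulr_ge0 ?invr_ge0 ?(ltW e10) //; lra.
have k1 : 1 <= (2 ^ h)%:R :> R by rewrite ler1n expn_gt0.
rewrite natrM; move: (2 ^ h)%:R k1 => k k1.
set Q := a * M * (M * L / eps).
have Q1 : 1 <= Q.
  rewrite /Q -[leLHS]mulr1 ler_pM // -[leLHS]mulr1 ler_pM //; lra.
have T0 : 0 <= 2 * ln (infinity n eps W) / ln (step eps h) by rewrite !mulr_ge0.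
have TQ : 2 * ln (infinity n eps W) / ln (step eps h) <= 48 * Q.
  apply: (@le_trans _ _ (2 * (2 * (M * L)) * (12 * (a * (M / eps))))).
    by rewrite ler_pM // ?mulr_ge0 // ler_wpM2l.
  by rewrite /Q; lra.
split; first by rewrite !mulr_ge0 ?addr_ge0 //; lra.
set T := 2 * _ / _ in T0 TQ *.
have : 6 * k * (1 + T) <= 6 * k * (49 * Q) by rewrite ler_wpM2l //; lra.
have : 1 <= k * Q by rewrite -[leLHS]mulr1 ler_pM.
by lra.
Qed.

Lemma preprocess_time_le (a Q c : R) m h LG X Jm : 1 <= a -> a <= Q -> 1 <= c -> (0 < m)%N ->
  h%:R <= 3 * a -> LG%:R <= 6 * a -> X%:R <= c * ((2 ^ h)%:R * Q) -> (Jm * 2 ^ h <= 4 * m)%N ->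
  (Jm * (chunk_cost h LG X + 10) + 40 * m + 40 * h + 200)%:R <=
  (4 * (15 * 1000 + 60 * 76 * c) + 400) * (m%:R * (a * a * Q)).
Proof.
move=> a1 aQ c1 m0 ha La Xc Jk; have := chunk_cost_le a1 aQ c1 ha La Xc.
move: (chunk_cost h LG X + 10)%N => cc; rewrite !natrD !natrM.
have m1 : (1 : R) <= m%:R by rewrite ler1n.
have : Jm%:R * (2 ^ h)%:R <= 4 * m%:R :> R by rewrite -!natrM ler_nat.
move: (2 ^ h)%:R => k jk cck.
have aa : 1 <= a * a by rewrite -[leLHS]mulr1 ler_pM.
have Z1 : 1 <= a * a * Q by rewrite -[leLHS]mulr1 ler_pM //; lra.
have aZ : a <= a * a * Q by rewrite -mulrA ler_peMr //; [|rewrite -[leLHS]mulr1 ler_pM]; lra.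
move: (a * a * Q) Z1 aZ cck => Z Z1 aZ cck.
set C := 15 * 1000 + _ in cck *.
have C0 : 0 <= C by rewrite /C; lra.
have h1 : Jm%:R * cc%:R <= 4 * C * (m%:R * Z).
  apply: (@le_trans _ _ (Jm%:R * (C * (k * Z)))); first by rewrite ler_wpM2l.
  have : C * Z * (Jm%:R * k) <= C * Z * (4 * m%:R) by rewrite ler_wpM2l ?mulr_ge0 //; lra.
  by lra.
have mZ : m%:R <= m%:R * Z by rewrite ler_peMr.
have zm : Z <= m%:R * Z by rewrite ler_peMl //; lra.
by lra.
Qed.

Definition time_const : R := 4 * (15 * 1000 + 60 * 76 * 295) + 400.

(** That eps is bounded enters through [M], which controls ln(1 + eps) and min(eps, 1). The factor 2
    comes from log2 (log2 n) >= 1 / 2. *)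
Lemma total_time_le n m h LG X (W eps M : R) : (3 <= n)%N -> (1 <= m)%N -> 1 <= W -> 1 <= M -> 0 < eps <= M ->
  ((0 < h)%N -> (2 ^ h < 2 * (n * n))%N) -> (2 ^ h <= 2 * m + 1)%N ->
  LG = (h + up_log 2 (2 * n))%N ->
  X = (Num.truncn ((6 * 2 ^ h)%:R * (1 + 2 * ln (infinity n eps W) / ln (step eps h)))).+1 ->
  ((m %/ 2 ^ h).+1 * (chunk_cost h LG X + 10) + 40 * m + 40 * h + 200)%:R <=
  2 * (time_const * (M * M)) * (m%:R * log2 (n%:R * W) * log2 n%:R ^+ 3 * log2 (log2 n%:R) / eps).
Proof.
move=> n3 m1 W1 M1 eM hs Kle eLG eX.
have ha := exponent_le n3 hs; have := up_log_le n3.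
have [] := sweep_bound_le n3 W1 M1 eM ha.
move: (_ * _) eX => B eX B0 B1 u1.
have a1 := log2_ge n3; have l1 := loglog2_ge n3.
have aL : log2 n%:R <= log2 (n%:R * W) by apply: ler_log2; rewrite ?ler_peMr ?ltr0n //; apply: leq_trans n3.
have LGa : LG%:R <= 6 * log2 n%:R :> R by rewrite eLG natrD; lra.
(* The number of chunks times K is at most m + K, and K <= 2 m + 1. *)
have Jk : ((m %/ 2 ^ h).+1 * 2 ^ h <= 4 * m)%N.
  rewrite mulSn; have := leq_divM m (2 ^ h); move: Kle m1.
  by move: (2 ^ h)%N (m %/ _ * _)%N => K D; clear; lia.
move: (log2 n%:R) (log2 (n%:R * W)) ha B1 a1 l1 aL LGa => a L ha B1 a1 l1 aL LGa {u1 hs n3 W1}.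
move/andP: eM => [e0 eM].
set Q := a * M * (M * L / eps) in B1.
have LM : 1 <= M * L / eps.
  by rewrite ler_pdivlMr // mul1r; apply: le_trans eM _; rewrite ler_peMr //; lra.
have aQ : a <= Q.
  by rewrite /Q -mulrA ler_peMr; [|lra|rewrite -[leLHS]mulr1 ler_pM]; lra.
have Xa : X%:R <= 295 * ((2 ^ h)%:R * Q).
  rewrite eX; apply: le_trans B1; rewrite -natr1 lerD2r.
  by case/andP: (truncn_itv B0).
have C1 : 1 <= 295 :> R by lra.
have a1' : 1 <= a by lra.
have := preprocess_time_le a1' aQ C1 m1 ha LGa Xa Jk; rewrite -/time_const => le.
apply: le_trans le _.
have c0 : 0 <= time_const by rewrite /time_const; lra.
move: time_const c0 => c c0.
pose Z := m%:R * L * a ^+ 3 / eps.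
have [a0 L0] : 0 <= a /\ 0 <= L by split; lra.
have Z0 : 0 <= Z by rewrite /Z !mulr_ge0 // ?exprn_ge0 // invr_ge0 ltW.
have -> : c * (m%:R * (a * a * Q)) = c * (M * M) * Z.
  by rewrite /Z /Q; lra.
have -> : m%:R * L * a ^+ 3 * log2 a / eps = Z * log2 a by rewrite /Z mulrAC.
have M0 : 0 <= M by lra.
move: Z Z0 => Z Z0; have cZ : 0 <= c * (M * M) * Z by do ! apply: mulr_ge0.
move: (log2 a) l1 => l l1.
have : c * (M * M) * Z * (1 / 2) <= c * (M * M) * Z * l by rewrite ler_wpM2l.
by lra.
Qed.

End Cost.

Theorem theorem1 (R : realType) :
  exists (preprocess query : cmd) (kappa : nat),
  forall eps_max : R, exists C : R,
  forall (n : nat) (s : 'I_n) (W : R) (sigma : seq (edge R n)) (eps : R)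
         (w : nat),
    1 <= W ->
    (forall e, e \in sigma -> 1 <= weight e <= W) ->
    0 < eps <= eps_max ->
    ((n + size sigma + 1) ^ kappa <= 2 ^ w)%N ->
    exists (T : nat) (D : state R),
      [/\ exec w preprocess (input_state s sigma eps) T D,
          (* the range where all the factors below are positive *)
          ((3 <= n)%N -> (1 <= size sigma)%N ->
           T%:R <= C * ((size sigma)%:R * log2 (n%:R * W) * log2 n%:R ^+ 3
                        * log2 (log2 n%:R) / eps))
        & forall (v : 'I_n) (t : nat), (t <= size sigma)%N ->
            exists (Tq : nat) (A : state R),
              [/\ exec w query (query_state D v t) Tq A,
                  Tq%:R <= C * log2 (n + size sigma + 1)%:R,
                  iarr A = iarr D /\ rarr A = rarr D
                & (dist sigma s t v <= answer A
                   <= (1 + eps)%:E * dist sigma s t v)%E ] ].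
Proof.
exists preprocess, query, 12%N => eps_max.
have [M [M1 eM']] : exists M : R, 1 <= M /\ eps_max <= M.
  by exists (Num.max 1 eps_max); rewrite !le_max !lexx orbT.
have M0 : 0 <= M by lra.
have CM : 0 <= 2 * (time_const * (M * M)) :> R.
  by do ! apply: mulr_ge0 => //; rewrite /time_const; lra.
(* 280 pays for a query: its time is at most 40 h + 200 with h <= log2 N + 1, and log2 N >= 1. *)
exists (2 * (time_const * (M * M)) + 280) => n s W sigma eps w W1 sW /andP[e0 ee] Nw.
set m := size sigma in Nw *; set N := (n + m + 1)%N in Nw *.
have eM : 0 < eps <= M by rewrite e0 (le_trans ee).
have n0 := n_gt0 s; have N2 : (2 <= N)%N by rewrite /N; lia.
have NBw := word_room N2 Nw; clear Nw; have NB_ge : (8 * N <= 8 * N)%N by [].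
have [h hl hs] := chunk_exponent n m; have Kle := K_le hs.
have KN : (2 ^ h <= 2 * N)%N by apply: leq_trans Kle _; rewrite /N /m; clear; lia.
have K0 : (0 < 2 ^ h)%N by rewrite expn_gt0.
pose B := (6 * 2 ^ h)%:R * (1 + 2 * ln (infinity n eps W) / ln (step eps h)).
(* Budgets are natural numbers, so the real bound is rounded up. [LG] covers both the rounds of a
   lookup and the depth of the tree. *)
pose X := (Num.truncn B).+1; pose LG := (h + up_log 2 (2 * n))%N; pose Jm := (m %/ 2 ^ h).+1.
have XB : B <= X%:R by rewrite ltW // truncnS_gt.
have nL : (2 * n <= 2 ^ LG)%N.
  by apply: leq_trans (up_logP (2 * n) (isT : 1 < 2)%N) _; rewrite leq_exp2l // leq_addl.
have mJ : (m <= Jm * 2 ^ h)%N by rewrite ltnW // ltn_ceil.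
have [T [D [eT leT [[pn pK pe] [Wm [/andP[Wm1 _] Wmax pI Good]]]]]] :=
  preprocess_run s W1 sW e0 NB_ge NBw hl hs (leq_addr _ h) nL mJ (fun=> XB).
exists T, D; split=> // [n3 m1|v t tm].
  apply: (@le_trans _ _ (2 * (time_const * (M * M)) * (m%:R * log2 (n%:R * W) * log2 n%:R ^+ 3
      * log2 (log2 n%:R) / eps))).
    apply: le_trans (total_time_le n3 m1 W1 M1 eM (fun h0 => (hs h0).2) Kle erefl erefl).
    by rewrite ler_nat.
  rewrite ler_wpM2r ?lerDl //; have a1 := @log2_ge R n n3; have l1 := @loglog2_ge R n n3.
  have L0 : 0 <= log2 (n%:R * W).
    by rewrite divr_ge0 ?ln_ge0 // ?ler1n // -[leLHS]mulr1 ler_pM // ler1n.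
  move: (log2 _) (log2 (log2 _)) (log2 _) L0 l1 a1 => L l a L0 l1 a1.
  by do ! apply: mulr_ge0 => //; rewrite ?exprn_ge0 ?invr_ge0 ?(ltW e0) //; lra.
have [Tq [A [eq leq [ans F]]]] := run_frame (query_run W1 e0 NB_ge NBw hs v tm pn pK pe pI).
exists Tq, A; split=> //.
- have N1 : 1 <= log2 N%:R :> R by apply: (@exp2_le_log2 R 1); rewrite expr1 ler_nat.
  have h1 : h%:R <= log2 N%:R + 1 :> R.
    have : h%:R <= log2 (2 ^+ 1 * N%:R) :> R.
      by apply: exp2_le_log2; rewrite expr1 -natrX -natrM ler_nat.
    by rewrite log2M ?log2X ?exprn_gt0 ?ltr0n ?(ltnW N2) //; lra.
  apply: (@le_trans _ _ (280 * log2 N%:R)).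
    apply: (@le_trans _ _ (40 * h + 200)%:R); first by rewrite ler_nat.
    by rewrite natrD natrM; lra.
  by rewrite ler_wpM2r ?lerDr //; lra.
- by split; apply: funext => x; rewrite ?(frame_ia F) ?(frame_ra F).
- by rewrite ans; apply: (good_answer e0 v Wm1 Wmax (step_expr_le e0 h) (Good t tm)).
Qed.
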